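(* Let $0\le s_0<1$ and let $f$ be a profile function: $f\in C^\infty(\mathbb{R})$ with $f(s)=0$ for $s\le0$ and $f(s)=1$ for $s\ge s_0$ if $s_0>0$, and $f$ the Heaviside function if $s_0=0$. Let $u=u_{in}+u_r+u_d$ be the solution of the NN-scattering problem given in the context. Then for every $\rho>0$, $\theta\in\Theta$ the amplitude $A(\rho,\theta,t):=u(\rho,\theta,t)e^{i\omega_0t}$ has a limit and $$\lim_{t\to\infty}A(\rho,\theta,t)=A_\infty(\rho,\theta):=A_{in}(\rho,\theta)+A_r(\rho,\theta)+A_d(\rho,\theta),$$ and the limiting amplitude $A_\infty$ admits the representation $$A_\infty(\rho,\theta)=\frac{i}{4\Phi}\int_{\mathcal{C}_1^+}e^{-\omega_0\rho\sinh\beta}H_N(\beta+i\theta)\,d\beta .$$ Moreover, $A_\infty$ satisfies the stationary scattering problem $$(\Delta+\omega_0^2)A_\infty(\rho,\theta)=0,\ (\rho,\theta)\in Q;\qquad\frac{\partial}{\partial\mathbf n}A_\infty(\rho,\theta)=0,\ (\rho,\theta)\in\partial Q .$$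
   Context: Fix $\omega_0>0$, $\phi\in(0,\pi)$, $\Phi:=2\pi-\phi\in(\pi,2\pi)$, $q:=\pi/(2\Phi)$, and $\alpha$ with $\max\{\phi-\frac{\pi}{2},0\}<\alpha<\min\{\frac{\pi}{2},\phi\}$. $W=\{(\rho\cos\theta,\rho\sin\theta):\rho\ge0,\ 0\le\theta\le\phi\}$, $Q=\mathbb{R}^2\setminus W$, with polar coordinates $(\rho,\theta)$, $\phi\le\theta\le2\pi$, in $\overline{Q}$; $\partial Q$ is the union of the open rays $\theta=\phi$ and $\theta=2\pi$, and $\partial/\partial\mathbf n$ is the exterior normal derivative. Put $\theta_1:=2\phi-\alpha$, $\theta_2:=2\pi-\alpha$, $\Theta:=[\phi,2\pi]\setminus\{\theta_1,\theta_2\}$, and $$H_N(\beta):=\coth\left[q\left(\beta+\tfrac{i\pi}{2}-i\alpha\right)\right]+\coth\left[q\left(\beta-\tfrac{3i\pi}{2}+i\alpha\right)\right],\qquad Z_N(\beta):=H_N\left(\beta-\tfrac{5i\pi}{2}\right)-H_N\left(\beta-\tfrac{i\pi}{2}\right).$$ The waves: $u_{in}(y,t)=e^{i\omega_0(\mathbf{n_0}\cdot y-t)}f(t-\mathbf{n_0}\cdot y)$, $\mathbf{n_0}=(\cos\alpha,\sin\alpha)$. With $\mathbf{v_j}=(\cos\theta_j,\sin\theta_j)$ and $u_{r,j}(y,t)=e^{i\omega_0(\mathbf{v_j}\cdot y-t)}f(t-\mathbf{v_j}\cdot y)$: $u_r=u_{r,1}$ for $\phi\le\theta\le\theta_1$,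 $u_r=0$ for $\theta_1<\theta<\theta_2$, $u_r=u_{r,2}$ for $\theta_2\le\theta\le2\pi$. For $\rho>0$, $\theta\in\Theta$, $$u_d(\rho,\theta,t)=\frac{i\,e^{-i\omega_0t}}{4\Phi}\int_{-\infty}^{+\infty}e^{i\omega_0\rho\cosh\beta}Z_N(\beta+i\theta)f(t-\rho\cosh\beta)\,d\beta.$$ $u=u_{in}+u_r+u_d$ is the solution of $(\partial_t^2-\Delta)u=0$ in $Q$, $\partial_{\mathbf n}u=0$ on $\partial Q$, $t\in\mathbb{R}$, with $u=u_{in}$ for $t<0$. The amplitudes, for $\rho>0$, $\theta\in\Theta$: $A_{in}(\rho,\theta)=e^{i\omega_0\rho\cos(\theta-\alpha)}$; $A_r(\rho,\theta)=e^{i\omega_0\rho\cos(\theta-\theta_1)}$ for $\phi\le\theta<\theta_1$, $A_r=0$ for $\theta_1\le\theta\le\theta_2$, $A_r(\rho,\theta)=e^{i\omega_0\rho\cos(\theta-\theta_2)}$ for $\theta_2<\theta\le2\pi$; and $$A_d(\rho,\theta)=\frac{i}{4\Phi}\int_{-\infty}^{+\infty}e^{i\omega_0\rho\cosh\beta}Z_N(\beta+i\theta)\,d\beta .$$ On the rays $\theta=\theta_1,\theta_2$, $A_\infty$ is understood through its contour integral representation. The contour: $\mathcal{C}_1=\{\beta_1-\frac{i\pi}{2}:\beta_1\ge1\}\cup\{1+i\beta_2:-\frac{5\pi}{2}\le\beta_2\le-\frac{\pi}{2}\}\cup\{\beta_1-\frac{5i\pi}{2}:\beta_1\ge1\}$,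 and $\mathcal{C}_1^+=[\mathcal{C}_1+\frac{i\pi}{4}]\cup[-\mathcal{C}_1-\frac{13i\pi}{4}]$. Orientation: $\mathcal{C}_1+\frac{i\pi}{4}$ runs from $+\infty-\frac{i\pi}{4}$ to $1-\frac{i\pi}{4}$, down to $1-\frac{9i\pi}{4}$, then to $+\infty-\frac{9i\pi}{4}$; $-\mathcal{C}_1-\frac{13i\pi}{4}$ runs from $-\infty-\frac{11i\pi}{4}$ to $-1-\frac{11i\pi}{4}$, up to $-1-\frac{3i\pi}{4}$, then to $-\infty-\frac{3i\pi}{4}$. *)

(* Defs.v *)
From Stdlib Require Import Reals Lra List.
From Coquelicot Require Import Coquelicot.
Import ListNotations.

Open Scope R_scope.

(** * Complex functions *)

Definition Cexp (z : C) : C := (exp (fst z) * cos (snd z), exp (fst z) * sin (snd z)).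
Definition Csinh (z : C) : C := ((Cexp z - Cexp (- z)) / 2)%C.
Definition Ccosh (z : C) : C := ((Cexp z + Cexp (- z)) / 2)%C.
Definition Ccoth (z : C) : C := (Ccosh z / Csinh z)%C.

(** [cis x] is e^{ix}. *)
Definition cis (x : R) : C := Cexp (Ci * x)%C.

(** * Integrals of complex-valued functions

    [C] is used as a complete normed module over [R]; Coquelicot's canonical
    structures would otherwise select the one over [C]. *)

Definition ex_int_R (g : R -> C) : Prop :=
  ex_RInt_gen (V := C_R_NormedModule) g (Rbar_locally m_infty) (Rbar_locally p_infty).
Definition int_R (g : R -> C) : C :=
  RInt_gen (V := C_R_CompleteNormedModule) g (Rbar_locally m_infty) (Rbar_locally p_infty).

(** The straight path [s |-> base + s * dir], for [s] going from [start] to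
    [stop]; [stop < start] is allowed. *)
Record line := Line { base : C; dir : C; start : Rbar; stop : Rbar }.

Definition end_filter (x : Rbar) : (R -> Prop) -> Prop :=
  match x with
  | Finite r => at_point r
  | _ => Rbar_locally x
  end.

Definition line_integrand (F : C -> C) (l : line) (s : R) : C :=
  (F (base l + s * dir l) * dir l)%C.

Definition contour_converges (F : C -> C) (g : list line) : Prop :=
  List.Forall (fun l => ex_RInt_gen (V := C_R_NormedModule) (line_integrand F l)
                          (end_filter (start l)) (end_filter (stop l))) g.

Definition contour_int (F : C -> C) (g : list line) : C :=
  fold_right (fun l acc =>
    (RInt_gen (V := C_R_CompleteNormedModule) (line_integrand F l)
       (end_filter (start l)) (end_filter (stop l)) + acc)%C) (RtoC 0) g.

(** The first three pieces are C_1 + i pi/4, the last three are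
    - C_1 - 13 i pi/4, both with their orientation. *)
Definition C1_plus : list line :=
  [ Line (0, - (PI / 4))       1  p_infty            1;
    Line 1                     Ci (- (PI / 4))       (- (9 * PI / 4));
    Line (0, - (9 * PI / 4))   1  1                  p_infty;
    Line (0, - (11 * PI / 4))  1  m_infty            (-1);
    Line (-1)                  Ci (- (11 * PI / 4))  (- (3 * PI / 4));
    Line (0, - (3 * PI / 4))   1  (-1)               m_infty ].

(** * Geometry *)

Definition polar (rho theta : R) : R * R := (rho * cos theta, rho * sin theta).

Definition dot (a b : R * R) : R := fst a * fst b + snd a * snd b.

Definition radius (y : R * R) : R := sqrt (fst y ^ 2 + snd y ^ 2).

(** The polar angle of [y <> 0] in the interval (0, 2 pi]. *)
Definition angle (y : R * R) : R :=
  if Rlt_dec 0 (snd y) then acos (fst y / radius y)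
  else 2 * PI - acos (fst y / radius y).

Lemma radius_polar (rho theta : R) : 0 < rho -> radius (polar rho theta) = rho.
Proof.
intros Hr. unfold radius, polar; cbn [fst snd].
replace ((rho * cos theta) ^ 2 + (rho * sin theta) ^ 2) with (Rsqr rho).
- apply sqrt_Rsqr; lra.
- generalize (sin2_cos2 theta); unfold Rsqr; intros H.
  replace ((rho * cos theta) ^ 2 + (rho * sin theta) ^ 2)
    with (rho * rho * (sin theta * sin theta + cos theta * cos theta)) by ring.
  rewrite H; ring.
Qed.

Lemma angle_polar (rho theta : R) :
  0 < rho -> 0 < theta <= 2 * PI -> angle (polar rho theta) = theta.
Proof.
intros Hr Ht. unfold angle. rewrite (radius_polar _ _ Hr).
unfold polar; cbn [fst snd].
replace (rho * cos theta / rho) with (cos theta) by (field; lra).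
destruct (Rlt_dec 0 (rho * sin theta)) as [Hs|Hs].
- assert (0 < sin theta) by (apply (Rmult_lt_reg_l rho); lra).
  apply acos_cos. split; [lra|].
  destruct (Rle_lt_dec theta PI) as [|Hpi]; [assumption|].
  generalize (sin_le_0 theta); lra.
- destruct (Rlt_le_dec theta PI) as [Hpi|Hpi].
  + exfalso. apply Hs, Rmult_lt_0_compat; [lra|]. apply sin_gt_0; lra.
  + replace (cos theta) with (cos (2 * PI - theta)).
    * rewrite acos_cos; lra.
    * rewrite cos_minus, cos_2PI, sin_2PI; ring.
Qed.

(** The wedge W and its complement Q. *)
Definition wedge (phi : R) (y : R * R) : Prop :=
  exists rho theta, 0 <= rho /\ 0 <= theta <= phi /\ y = polar rho theta.
Definition Qdom (phi : R) (y : R * R) : Prop := ~ wedge phi y.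

(** * Laplacian and normal derivative of a function on the plane *)

Definition is_second_derive (g : R -> C) (x : R) (l : C) : Prop :=
  exists g' : R -> C,
    locally x (fun s => is_derive (K := R_AbsRing) (V := C_R_NormedModule) g s (g' s)) /\
    is_derive (K := R_AbsRing) (V := C_R_NormedModule) g' x l.

Definition is_laplacian (v : R * R -> C) (y : R * R) (l : C) : Prop :=
  exists l1 l2 : C,
    is_second_derive (fun s => v (s, snd y)) (fst y) l1 /\
    is_second_derive (fun s => v (fst y, s)) (snd y) l2 /\
    l = (l1 + l2)%C.

(** One-sided, since [v] is only meaningful on the side of the boundary from
    which the exterior normal [n] points: the limit of (v(y) - v(y - h n)) / h
    as h -> 0+. *)
Definition is_normal_derive (v : R * R -> C) (y n : R * R) (l : C) : Prop :=
  filterlim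
    (fun h : R => ((v y - v (fst y - h * fst n, snd y - h * snd n)%R) / h)%C)
    (at_right 0) (locally l).

(** Unit normals pointing from Q into W. *)
Definition normal_phi (phi : R) : R * R := (sin phi, - cos phi).
Definition normal_2PI : R * R := (0, 1).

(** * Profile functions *)

(** For [s0 = 0] the value of the Heaviside function at 0 is left free. *)
Definition profile (s0 : R) (f : R -> R) : Prop :=
  (0 < s0 /\ (forall n x, ex_derive_n f n x) /\
     (forall s, s <= 0 -> f s = 0) /\ (forall s, s0 <= s -> f s = 1)) \/
  (s0 = 0 /\ (forall s, s < 0 -> f s = 0) /\ (forall s, 0 < s -> f s = 1)).

(** * The scattering problem *)

Definition Phi (phi : R) : R := 2 * PI - phi.
Definition qq (phi : R) : R := PI / (2 * Phi phi).
Definition theta1 (phi alpha : R) : R := 2 * phi - alpha.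
Definition theta2 (alpha : R) : R := 2 * PI - alpha.

Definition Theta (phi alpha theta : R) : Prop :=
  phi <= theta <= 2 * PI /\ theta <> theta1 phi alpha /\ theta <> theta2 alpha.

Definition H_N (phi alpha : R) (b : C) : C :=
  (Ccoth (qq phi * (b + Ci * (PI / 2)%R - Ci * alpha)) +
   Ccoth (qq phi * (b - Ci * (3 * PI / 2)%R + Ci * alpha)))%C.

Definition Z_N (phi alpha : R) (b : C) : C :=
  (H_N phi alpha (b - Ci * (5 * PI / 2)%R) - H_N phi alpha (b - Ci * (PI / 2)%R))%C.

(** The plane wave e^{i omega0 (v.y - t)} f(t - v.y), v = (cos a, sin a). *)
Definition plane_wave (omega0 : R) (f : R -> R) (a : R) (y : R * R) (t : R) : C :=
  let v := (cos a, sin a) in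
  (cis (omega0 * (dot v y - t)) * f (t - dot v y)%R)%C.

Definition u_in (omega0 alpha : R) (f : R -> R) (rho theta t : R) : C :=
  plane_wave omega0 f alpha (polar rho theta) t.

Definition u_r (omega0 phi alpha : R) (f : R -> R) (rho theta t : R) : C :=
  if Rle_dec theta (theta1 phi alpha) then
    plane_wave omega0 f (theta1 phi alpha) (polar rho theta) t
  else if Rlt_dec theta (theta2 alpha) then 0
  else plane_wave omega0 f (theta2 alpha) (polar rho theta) t.

Definition A_d_integrand (omega0 phi alpha rho theta beta : R) : C :=
  (cis (omega0 * rho * cosh beta) * Z_N phi alpha (beta + Ci * theta))%C.

Definition u_d_integrand (omega0 phi alpha : R) (f : R -> R) (rho theta t beta : R) : C :=
  (A_d_integrand omega0 phi alpha rho theta beta * f (t - rho * cosh beta)%R)%C.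

Definition u_d (omega0 phi alpha : R) (f : R -> R) (rho theta t : R) : C :=
  (Ci * cis (- (omega0 * t)) / (4 * Phi phi)%R *
   int_R (u_d_integrand omega0 phi alpha f rho theta t))%C.

Definition u_sol (omega0 phi alpha : R) (f : R -> R) (rho theta t : R) : C :=
  (u_in omega0 alpha f rho theta t + u_r omega0 phi alpha f rho theta t
   + u_d omega0 phi alpha f rho theta t)%C.

Definition amplitude (omega0 phi alpha : R) (f : R -> R) (rho theta t : R) : C :=
  (u_sol omega0 phi alpha f rho theta t * cis (omega0 * t))%C.

Definition A_in (omega0 alpha rho theta : R) : C :=
  cis (omega0 * rho * cos (theta - alpha)).

Definition A_r (omega0 phi alpha rho theta : R) : C :=
  if Rlt_dec theta (theta1 phi alpha) then
    cis (omega0 * rho * cos (theta - theta1 phi alpha))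
  else if Rle_dec theta (theta2 alpha) then 0
  else cis (omega0 * rho * cos (theta - theta2 alpha)).

Definition A_d (omega0 phi alpha rho theta : R) : C :=
  (Ci / (4 * Phi phi)%R * int_R (A_d_integrand omega0 phi alpha rho theta))%C.

Definition contour_integrand (omega0 phi alpha rho theta : R) (b : C) : C :=
  (Cexp (- ((omega0 * rho)%R * Csinh b)) * H_N phi alpha (b + Ci * theta))%C.

Definition A_contour (omega0 phi alpha rho theta : R) : C :=
  (Ci / (4 * Phi phi)%R *
   contour_int (contour_integrand omega0 phi alpha rho theta) C1_plus)%C.

(** The sum of the three amplitudes, except on the critical rays, where
    A_infinity is given by the contour integral. *)
Definition A_inf (omega0 phi alpha rho theta : R) : C :=
  if Req_dec_T theta (theta1 phi alpha) then A_contour omega0 phi alpha rho theta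
  else if Req_dec_T theta (theta2 alpha) then A_contour omega0 phi alpha rho theta
  else (A_in omega0 alpha rho theta + A_r omega0 phi alpha rho theta
        + A_d omega0 phi alpha rho theta)%C.

(** A_infinity as a function of the point of the closure of Q. *)
Definition A_inf_at (omega0 phi alpha : R) (y : R * R) : C :=
  A_inf omega0 phi alpha (radius y) (angle y).

(* Main.v *)
Require Import Defs.
From Stdlib Require Import Reals Lra List FunctionalExtensionality.
From Coquelicot Require Import Coquelicot.

Open Scope R_scope.

(** Write F(z) = e^{- omega0 rho sinh z} H_N(z + i theta).  The reflection
    z -> - z - 3 i pi maps the left half of C_1^+ onto the right half, and
    H_N is odd about i pi / 2, so the contour integral of F over C_1^+ is
    w(theta) + w(4 pi - theta), where w(theta) is the integral of F over the
    right half alone.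

    Representation: truncated at Re z = L, Cauchy's theorem moves the
    horizontal pieces of the contour to Im z = - pi/2 and Im z = - 5 pi/2,
    where F becomes the integrand of A_d; by Jordan's estimate the sides at
    Re z = L tend to 0.  What is left is the boundary of
    [-1, 1] x [- 5 pi/2, - pi/2], and the residues inside are the incident
    wave and, according to the position of theta with respect to theta_1 and
    theta_2, one of the reflected waves or none.

    Stationary problem: translating the contour by i (theta - theta0) shows
    that, near the direction theta0, w(theta) is an integral over a fixed
    contour of plane waves e^{- omega0 (X sinh z - i Y cosh z)} in Cartesian
    coordinates.  Each of them solves the Helmholtz equation, and the decay of
    the exponential allows differentiation under the integral.  As H_N has
    period 2 i Phi, w(theta) + w(4 pi - theta) is even about both theta = phi
    and theta = 2 pi, which gives the Neumann condition.

    Limit: Z_N decays exponentially, so only a bounded range of beta matters,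
    and there f(t - rho cosh beta) = 1 for large t. *)

(** * Complex calculus *)

(** All poles of the integrand lie on the imaginary axis. The contour stays in |Re z| >= 1, so no
    pole meets it as theta varies; the lines Im z = - pi/2 and Im z = - 5 pi/2 that carry [A_d] do
    meet one, exactly when theta is theta_1 or theta_2. This is why both equations of the stationary
    problem are proved from the contour integral, which does not see the critical rays.

    The heights - pi/4 and - 9 pi/4 make cos(Im z) positive on the half-lines, so the exponential
    decays like exp(- c e^{Re z}). Such decay survives rotations by less than pi/4 and beats every
    factor produced by differentiation. On the lines of [A_d] only oscillation is left, and
    convergence comes from a cancellation in [Z_N].

    In polar coordinates theta sits in the argument of [H_N]. The translation moves it into the
    exponent; the weight then no longer depends on the point, and the Laplacian acts on plane waves
    only.

    The central strip has height 2 pi, less than the spacing 2 Phi of the poles of each coth, so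
    each of the two contributes at most one residue. *)

Notation CV := C_R_CompleteNormedModule.
Notation CN := C_R_NormedModule.
Notation continuousCC := (@continuous C_UniformSpace C_UniformSpace).
Notation continuousRC := (@continuous R_UniformSpace C_UniformSpace).
Notation locallyC := (@locally C_UniformSpace).

Lemma norm_CN (z : C) : norm (V := CN) z = Cmod z.
Proof.
destruct z as [x y]. unfold Cmod. cbn [fst snd].
change (sqrt (Rabs x ^ 2 + Rabs y ^ 2) = sqrt (x ^ 2 + y ^ 2)).
now rewrite !pow2_abs.
Qed.

Lemma C_ext (z w : C) : fst z = fst w -> snd z = snd w -> z = w.
Proof. destruct z, w; cbn; intros -> ->; reflexivity. Qed.

Lemma continuous_C_pair (T : UniformSpace) (f : T -> C) (x : T) :
  continuous (fun t => fst (f t)) x -> continuous (fun t => snd (f t)) x ->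
  continuous f x.
Proof.
intros H1 H2 P [e He].
pose proof (H1 _ (locally_ball (fst (f x)) e)) as K1.
pose proof (H2 _ (locally_ball (snd (f x)) e)) as K2. unfold filtermap in K1, K2 |- *.
generalize (filter_and _ _ K1 K2). apply filter_imp.
intros t [h1 h2]. apply He. split; assumption.
Qed.

Lemma continuous_C_fst (T : UniformSpace) (f : T -> C) (x : T) :
  continuous f x -> continuous (fun t => fst (f t)) x.
Proof.
intros H P [e He]. generalize (H _ (locally_ball (f x) e)).
unfold filtermap. apply filter_imp. intros t [h1 _]. now apply He.
Qed.

Lemma continuous_C_snd (T : UniformSpace) (f : T -> C) (x : T) :
  continuous f x -> continuous (fun t => snd (f t)) x.
Proof.
intros H P [e He]. generalize (H _ (locally_ball (f x) e)).
unfold filtermap. apply filter_imp. intros t [_ h1]. now apply He.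
Qed.

Lemma continuous_Cplus (T : UniformSpace) (f g : T -> C) (x : T) :
  continuous f x -> continuous g x -> continuous (fun t => (f t + g t)%C) x.
Proof.
intros Hf Hg; apply continuous_C_pair; cbn.
- apply (continuous_plus (V := R_NormedModule) (fun t => fst (f t)) (fun t => fst (g t)));
  now apply continuous_C_fst.
- apply (continuous_plus (V := R_NormedModule) (fun t => snd (f t)) (fun t => snd (g t)));
  now apply continuous_C_snd.
Qed.

Lemma continuous_Copp (T : UniformSpace) (f : T -> C) (x : T) :
  continuous f x -> continuous (fun t => (- f t)%C) x.
Proof.
intros Hf; apply continuous_C_pair; cbn.
- apply (continuous_opp (V := R_NormedModule) (fun t => fst (f t))); now apply continuous_C_fst.
- apply (continuous_opp (V := R_NormedModule) (fun t => snd (f t))); now apply continuous_C_snd.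
Qed.

Lemma continuous_Cmult (T : UniformSpace) (f g : T -> C) (x : T) :
  continuous f x -> continuous g x -> continuous (fun t => (f t * g t)%C) x.
Proof.
intros Hf Hg.
pose proof (continuous_C_fst _ _ _ Hf) as H1. pose proof (continuous_C_snd _ _ _ Hf) as H2.
pose proof (continuous_C_fst _ _ _ Hg) as H3. pose proof (continuous_C_snd _ _ _ Hg) as H4.
apply continuous_C_pair.
- exact (continuous_minus (V := R_NormedModule) _ _ _
    (continuous_mult (K := R_AbsRing) _ _ _ H1 H3) (continuous_mult (K := R_AbsRing) _ _ _ H2 H4)).
- exact (continuous_plus (V := R_NormedModule) _ _ _
    (continuous_mult (K := R_AbsRing) _ _ _ H1 H4) (continuous_mult (K := R_AbsRing) _ _ _ H2 H3)).
Qed.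

Lemma Csqr_nonzero (z : C) : z <> 0%C -> fst z ^ 2 + snd z ^ 2 <> 0.
Proof.
intros H E. apply H. destruct z as [x y]; cbn [fst snd] in E.
assert (x = 0) by nra. assert (y = 0) by nra. subst. reflexivity.
Qed.

Lemma continuous_Cinv (T : UniformSpace) (f : T -> C) (x : T) :
  continuous f x -> f x <> 0%C -> continuous (fun t => (/ f t)%C) x.
Proof.
intros Hf Hn.
pose proof (continuous_C_fst _ _ _ Hf) as H1. pose proof (continuous_C_snd _ _ _ Hf) as H2.
assert (Hi : continuous (fun t => / (fst (f t) ^ 2 + snd (f t) ^ 2)) x).
{ apply (continuous_comp (fun t => fst (f t) ^ 2 + snd (f t) ^ 2) Rinv).
  - apply (continuous_ext (fun t => fst (f t) * fst (f t) + snd (f t) * snd (f t)));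
      [intros; cbn; ring|].
    exact (continuous_plus (V := R_NormedModule) _ _ _
      (continuous_mult (K := R_AbsRing) _ _ _ H1 H1) (continuous_mult (K := R_AbsRing) _ _ _ H2 H2)).
  - apply continuity_pt_filterlim, continuity_pt_inv; [apply continuity_pt_id|].
    now apply Csqr_nonzero. }
apply continuous_C_pair; cbn [Cinv fst snd]; unfold Rdiv;
  apply (continuous_mult (K := R_AbsRing)); try assumption.
now apply (continuous_opp (V := R_NormedModule) (fun t => snd (f t))).
Qed.

Lemma continuous_Cexp (T : UniformSpace) (f : T -> C) (x : T) :
  continuous f x -> continuous (fun t => Cexp (f t)) x.
Proof.
intros Hf.
pose proof (continuous_C_fst _ _ _ Hf) as H1. pose proof (continuous_C_snd _ _ _ Hf) as H2.
apply continuous_C_pair; cbn [Cexp fst snd];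
  apply (continuous_mult (K := R_AbsRing)).
- apply (continuous_comp (fun t => fst (f t)) exp); [assumption|]. apply continuity_pt_filterlim, derivable_continuous, derivable_exp.
- apply (continuous_comp (fun t => snd (f t)) cos); [assumption|]. apply continuity_pt_filterlim, derivable_continuous, derivable_cos.
- apply (continuous_comp (fun t => fst (f t)) exp); [assumption|]. apply continuity_pt_filterlim, derivable_continuous, derivable_exp.
- apply (continuous_comp (fun t => snd (f t)) sin); [assumption|]. apply continuity_pt_filterlim, derivable_continuous, derivable_sin.
Qed.

(** * Componentwise derivatives and analytic functions *)

Definition derC (f : R -> C) (x : R) (l : C) : Prop :=
  is_derive (fun s => fst (f s)) x (fst l) /\ is_derive (fun s => snd (f s)) x (snd l).

Lemma derC_const (c : C) (x : R) : derC (fun _ => c) x 0.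
Proof. split; apply (is_derive_const (V := R_NormedModule)). Qed.

Lemma derC_plus (f g : R -> C) (x : R) (lf lg : C) :
  derC f x lf -> derC g x lg -> derC (fun s => (f s + g s)%C) x (lf + lg)%C.
Proof. intros [] []; split; cbn; now apply (is_derive_plus (V := R_NormedModule)). Qed.

Lemma derC_mult (f g : R -> C) (x : R) (lf lg : C) :
  derC f x lf -> derC g x lg ->
  derC (fun s => (f s * g s)%C) x (lf * g x + f x * lg)%C.
Proof.
intros [H1 H2] [H3 H4]; split; cbn.
- evar_last.
  + apply (is_derive_minus (V := R_NormedModule));
    apply (is_derive_mult (K := R_AbsRing)); try eassumption; apply Rmult_comm.
  + unfold minus, plus, mult, opp; cbn; ring.
- evar_last.
  + apply (is_derive_plus (V := R_NormedModule));
    apply (is_derive_mult (K := R_AbsRing)); try eassumption; apply Rmult_comm.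
  + unfold minus, plus, mult, opp; cbn; ring.
Qed.

(** With l = a + i b, the right-hand sides are the two components of - l (1/f)^2, left in the
    unreduced shape to which [Cinv] and [Cmult] compute, so that [derC_inv] follows by
    conversion. *)
Lemma is_derive_Cinv_parts (u v : R -> R) (x a b : R) :
  is_derive u x a -> is_derive v x b -> u x ^ 2 + v x ^ 2 <> 0 ->
  is_derive (fun s => u s / (u s ^ 2 + v s ^ 2)) x
    (- (a * (u x / (u x ^ 2 + v x ^ 2) * (u x / (u x ^ 2 + v x ^ 2)) -
      - v x / (u x ^ 2 + v x ^ 2) * (- v x / (u x ^ 2 + v x ^ 2))) -
      b * (u x / (u x ^ 2 + v x ^ 2) * (- v x / (u x ^ 2 + v x ^ 2)) +
      - v x / (u x ^ 2 + v x ^ 2) * (u x / (u x ^ 2 + v x ^ 2))))) /\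
  is_derive (fun s => - v s / (u s ^ 2 + v s ^ 2)) x
    (- (a * (u x / (u x ^ 2 + v x ^ 2) * (- v x / (u x ^ 2 + v x ^ 2)) +
      - v x / (u x ^ 2 + v x ^ 2) * (u x / (u x ^ 2 + v x ^ 2))) +
      b * (u x / (u x ^ 2 + v x ^ 2) * (u x / (u x ^ 2 + v x ^ 2)) -
      - v x / (u x ^ 2 + v x ^ 2) * (- v x / (u x ^ 2 + v x ^ 2))))).
Proof.
intros H1 H2 Hn.
assert (Hd : is_derive (fun s => u s ^ 2 + v s ^ 2) x (2 * (u x * a + v x * b))).
{ evar_last.
  - apply (is_derive_plus (V := R_NormedModule)); apply is_derive_pow; eassumption.
  - unfold plus; cbn; ring. }
assert (Hv : is_derive (fun s => - v s) x (- b))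
  by exact (is_derive_opp (V := R_NormedModule) v x _ H2).
split; (evar_last; [apply is_derive_div; eassumption|]);
  match goal with |- @eq _ ?a ?b => change (@eq R a b) end; cbv beta; field; exact Hn.
Qed.

Lemma derC_inv (f : R -> C) (x : R) (l : C) :
  derC f x l -> f x <> 0%C -> derC (fun s => (/ f s)%C) x (- (l * (/ f x * / f x)))%C.
Proof.
intros [H1 H2] Hn. apply Csqr_nonzero in Hn.
destruct (is_derive_Cinv_parts _ _ _ _ _ H1 H2 Hn) as [K1 K2].
split; [exact K1|exact K2].
Qed.

Lemma derC_Cexp (f : R -> C) (x : R) (l : C) :
  derC f x l -> derC (fun s => Cexp (f s)) x (Cexp (f x) * l)%C.
Proof.
intros [H1 H2]. unfold derC; cbn [Cexp fst snd Cmult].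
set (u := fun s => fst (f s)) in *. set (v := fun s => snd (f s)) in *.
change (fst (f x)) with (u x). change (snd (f x)) with (v x). 
assert (He : is_derive (fun s => exp (u s)) x (fst l * exp (u x)))
  by (apply (is_derive_comp exp u); [apply is_derive_exp|exact H1]).
assert (Hc : is_derive (fun s => cos (v s)) x (snd l * - sin (v x)))
  by (apply (is_derive_comp cos v); [apply is_derive_cos|exact H2]).
assert (Hs : is_derive (fun s => sin (v s)) x (snd l * cos (v x)))
  by (apply (is_derive_comp sin v); [apply is_derive_sin|exact H2]).
split.
- change (is_derive (fun s => exp (u s) * cos (v s)) x
    (exp (u x) * cos (v x) * fst l - exp (u x) * sin (v x) * snd l)).
  evar_last; [apply (is_derive_mult (K := R_AbsRing)); try eassumption; apply Rmult_comm|].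
  unfold plus, mult; cbn; ring.
- change (is_derive (fun s => exp (u s) * sin (v s)) x
    (exp (u x) * cos (v x) * snd l + exp (u x) * sin (v x) * fst l)).
  evar_last; [apply (is_derive_mult (K := R_AbsRing)); try eassumption; apply Rmult_comm|].
  unfold plus, mult; cbn; ring.
Qed.

(** The partial derivatives are taken in the whole plane, so that [D] need not
    be open. *)
Definition analytic_on (D : C -> Prop) (F : C -> C) : Prop :=
  exists dF : C -> C, forall x y : R, D (x, y) ->
    derC (fun s => F (s, y)) x (dF (x, y)) /\
    derC (fun s => F (x, s)) y (Ci * dF (x, y))%C /\
    continuousCC F (x, y) /\
    continuousCC dF (x, y).

Lemma analytic_on_subset (D D' : C -> Prop) (F : C -> C) :
  (forall z, D' z -> D z) -> analytic_on D F -> analytic_on D' F.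
Proof. intros H [dF HF]. exists dF. intros x y Hz. apply HF, H, Hz. Qed.

Lemma analytic_on_ext (D : C -> Prop) (F G : C -> C) :
  (forall z, F z = G z) -> analytic_on D F -> analytic_on D G.
Proof.
intros H [dF HF]. exists dF. intros x y Hz. destruct (HF x y Hz) as (H1 & H2 & H3 & H4).
split; [|split; [|split]].
- destruct H1; split; (eapply is_derive_ext; [|eassumption]); intros; cbn; now rewrite H.
- destruct H2; split; (eapply is_derive_ext; [|eassumption]); intros; cbn; now rewrite H.
- eapply continuous_ext; [|exact H3]. exact H.
- exact H4.
Qed.

Lemma analytic_on_const (D : C -> Prop) (c : C) : analytic_on D (fun _ => c).
Proof.
exists (fun _ => RtoC 0). intros x y _. split; [apply derC_const|split].
- replace (Ci * 0)%C with (RtoC 0) by ring. apply derC_const.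
- split; apply continuous_const.
Qed.

Lemma analytic_on_id (D : C -> Prop) : analytic_on D (fun z => z).
Proof.
exists (fun _ => RtoC 1). intros x y _. split; [|split; [|split]].
- split; cbn; [apply (is_derive_id (K := R_AbsRing))|apply (is_derive_const (V := R_NormedModule))].
- replace (Ci * 1)%C with Ci by ring.
  split; cbn; [apply (is_derive_const (V := R_NormedModule))|apply (is_derive_id (K := R_AbsRing))].
- apply continuous_id.
- apply continuous_const.
Qed.

Lemma analytic_on_plus (D : C -> Prop) (F G : C -> C) :
  analytic_on D F -> analytic_on D G -> analytic_on D (fun z => (F z + G z)%C).
Proof.
intros [dF HF] [dG HG]. exists (fun z => (dF z + dG z)%C). intros x y Hz.
destruct (HF x y Hz) as (F1 & F2 & F3 & F4), (HG x y Hz) as (G1 & G2 & G3 & G4).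
split; [|split; [|split]].
- now apply derC_plus.
- rewrite Cmult_plus_distr_l. now apply derC_plus.
- now apply continuous_Cplus.
- now apply continuous_Cplus.
Qed.

Lemma analytic_on_mult (D : C -> Prop) (F G : C -> C) :
  analytic_on D F -> analytic_on D G -> analytic_on D (fun z => (F z * G z)%C).
Proof.
intros [dF HF] [dG HG]. exists (fun z => (dF z * G z + F z * dG z)%C). intros x y Hz.
destruct (HF x y Hz) as (F1 & F2 & F3 & F4), (HG x y Hz) as (G1 & G2 & G3 & G4).
split; [|split; [|split]].
- apply (derC_mult (fun s => F (s, y)) (fun s => G (s, y))); assumption.
- replace (Ci * (dF (x, y) * G (x, y) + F (x, y) * dG (x, y)))%C
    with (Ci * dF (x, y) * G (x, y) + F (x, y) * (Ci * dG (x, y)))%C by ring.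
  apply (derC_mult (fun s => F (x, s)) (fun s => G (x, s))); assumption.
- now apply continuous_Cmult.
- apply continuous_Cplus; now apply continuous_Cmult.
Qed.

Lemma analytic_on_opp (D : C -> Prop) (F : C -> C) :
  analytic_on D F -> analytic_on D (fun z => (- F z)%C).
Proof.
intros HF. apply (analytic_on_ext _ (fun z => ((- (1)) * F z)%C)); [intros; ring|].
apply analytic_on_mult; [apply analytic_on_const|exact HF].
Qed.

Lemma analytic_on_minus (D : C -> Prop) (F G : C -> C) :
  analytic_on D F -> analytic_on D G -> analytic_on D (fun z => (F z - G z)%C).
Proof.
intros HF HG. apply (analytic_on_plus _ F (fun z => (- G z)%C)); [exact HF|].
now apply analytic_on_opp.
Qed.

Lemma analytic_on_inv (D : C -> Prop) (F : C -> C) :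
  analytic_on D F -> (forall z, D z -> F z <> 0%C) -> analytic_on D (fun z => (/ F z)%C).
Proof.
intros [dF HF] Hn. exists (fun z => (- (dF z * (/ F z * / F z)))%C). intros x y Hz.
destruct (HF x y Hz) as (F1 & F2 & F3 & F4). specialize (Hn _ Hz).
split; [|split; [|split]].
- apply (derC_inv (fun s => F (s, y))); assumption.
- replace (Ci * - (dF (x, y) * (/ F (x, y) * / F (x, y))))%C
    with (- (Ci * dF (x, y) * (/ F (x, y) * / F (x, y))))%C by ring.
  apply (derC_inv (fun s => F (x, s))); assumption.
- now apply continuous_Cinv.
- apply continuous_Copp, continuous_Cmult; [assumption|].
  apply continuous_Cmult; now apply continuous_Cinv.
Qed.

Lemma analytic_on_Cexp (D : C -> Prop) (F : C -> C) :
  analytic_on D F -> analytic_on D (fun z => Cexp (F z)).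
Proof.
intros [dF HF]. exists (fun z => (Cexp (F z) * dF z)%C). intros x y Hz.
destruct (HF x y Hz) as (F1 & F2 & F3 & F4).
split; [|split; [|split]].
- apply (derC_Cexp (fun s => F (s, y))); assumption.
- replace (Ci * (Cexp (F (x, y)) * dF (x, y)))%C
    with (Cexp (F (x, y)) * (Ci * dF (x, y)))%C by ring.
  apply (derC_Cexp (fun s => F (x, s))); assumption.
- now apply continuous_Cexp.
- apply continuous_Cmult; [now apply continuous_Cexp|assumption].
Qed.

Lemma analytic_on_continuous (D : C -> Prop) (F : C -> C) (z : C) :
  analytic_on D F -> D z -> continuousCC F z.
Proof. intros [dF HF] Hz. destruct z as [x y]. apply (HF x y Hz). Qed.

(** * Integrals of complex functions and Cauchy's theorem *)

Definition CRInt (f : R -> C) (a b : R) : C := RInt (V := CV) f a b.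
Notation is_CRInt := (is_RInt (V := CN)).
Notation ex_CRInt := (ex_RInt (V := CN)).

Lemma is_CRInt_pair (f : R -> C) (a b : R) (l : C) :
  is_RInt (fun t => fst (f t)) a b (fst l) -> is_RInt (fun t => snd (f t)) a b (snd l) ->
  is_CRInt f a b l.
Proof.
intros H1 H2. destruct l as [l1 l2].
exact (is_RInt_fct_extend_pair (U := R_NormedModule) (V := R_NormedModule) f a b l1 l2 H1 H2).
Qed.

Lemma is_CRInt_fst (f : R -> C) (a b : R) (l : C) :
  is_CRInt f a b l -> is_RInt (fun t => fst (f t)) a b (fst l).
Proof. exact (is_RInt_fct_extend_fst (U := R_NormedModule) (V := R_NormedModule) f a b l). Qed.

Lemma is_CRInt_snd (f : R -> C) (a b : R) (l : C) :
  is_CRInt f a b l -> is_RInt (fun t => snd (f t)) a b (snd l).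
Proof. exact (is_RInt_fct_extend_snd (U := R_NormedModule) (V := R_NormedModule) f a b l). Qed.

Lemma is_CRInt_plus (f g : R -> C) (a b : R) (l m : C) :
  is_CRInt f a b l -> is_CRInt g a b m -> is_CRInt (fun t => (f t + g t)%C) a b (l + m)%C.
Proof. exact (is_RInt_plus (V := CN) f g a b l m). Qed.

Lemma is_CRInt_opp (f : R -> C) (a b : R) (l : C) :
  is_CRInt f a b l -> is_CRInt (fun t => (- f t)%C) a b (- l)%C.
Proof. exact (is_RInt_opp (V := CN) f a b l). Qed.

Lemma is_CRInt_minus (f g : R -> C) (a b : R) (l m : C) :
  is_CRInt f a b l -> is_CRInt g a b m -> is_CRInt (fun t => (f t - g t)%C) a b (l - m)%C.
Proof. exact (is_RInt_minus (V := CN) f g a b l m). Qed.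

Lemma is_CRInt_mult_l (c : C) (f : R -> C) (a b : R) (l : C) :
  is_CRInt f a b l -> is_CRInt (fun t => (c * f t)%C) a b (c * l)%C.
Proof.
intros H. pose proof (is_CRInt_fst _ _ _ _ H) as H1. pose proof (is_CRInt_snd _ _ _ _ H) as H2.
apply is_CRInt_pair.
- exact (is_RInt_minus (V := R_NormedModule) _ _ _ _ _ _
    (is_RInt_scal (V := R_NormedModule) _ _ _ (fst c) _ H1)
    (is_RInt_scal (V := R_NormedModule) _ _ _ (snd c) _ H2)).
- exact (is_RInt_plus (V := R_NormedModule) _ _ _ _ _ _
    (is_RInt_scal (V := R_NormedModule) _ _ _ (fst c) _ H2)
    (is_RInt_scal (V := R_NormedModule) _ _ _ (snd c) _ H1)).
Qed.

Lemma is_CRInt_Chasles (f : R -> C) (a b c : R) (l m : C) :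
  is_CRInt f a b l -> is_CRInt f b c m -> is_CRInt f a c (l + m)%C.
Proof. exact (is_RInt_Chasles (V := CN) f a b c l m). Qed.

Lemma is_CRInt_swap (f : R -> C) (a b : R) (l : C) :
  is_CRInt f a b l -> is_CRInt f b a (- l)%C.
Proof. exact (is_RInt_swap (V := CN) f b a l). Qed.

Lemma is_CRInt_reflect (f : R -> C) (c a b : R) (l : C) :
  is_CRInt f (c - a) (c - b) l -> is_CRInt (fun t => f (c - t)) a b (- l)%C.
Proof.
intros H.
assert (H1 : is_CRInt f (-1 * a + c) (-1 * b + c) l)
  by (replace (-1 * a + c) with (c - a) by ring; replace (-1 * b + c) with (c - b) by ring; exact H).
apply (is_RInt_comp_lin (V := CN)) in H1. apply is_CRInt_opp in H1.
eapply is_RInt_ext; [|exact H1]. intros x _. cbv beta.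
replace (c - x) with (-1 * x + c) by ring. apply C_ext; unfold scal; cbn; unfold mult; cbn; ring.
Qed.

Lemma is_CRInt_translate (f : R -> C) (c a b : R) (l : C) :
  is_CRInt f (a + c) (b + c) l -> is_CRInt (fun t => f (t + c)) a b l.
Proof.
intros H.
assert (H1 : is_CRInt f (1 * a + c) (1 * b + c) l) by now rewrite !Rmult_1_l.
apply (is_RInt_comp_lin (V := CN)) in H1.
eapply is_RInt_ext; [|exact H1]. intros x _. cbv beta. rewrite Rmult_1_l.
apply C_ext; unfold scal; cbn; unfold mult; cbn; ring.
Qed.

Lemma ex_CRInt_continuous (f : R -> C) (a b : R) :
  (forall x, Rmin a b <= x <= Rmax a b -> continuousRC f x) ->
  ex_CRInt f a b.
Proof. exact (ex_RInt_continuous (V := CV) f a b). Qed.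

Lemma ex_CRInt_on (f : R -> C) (a b : R) :
  a <= b -> (forall x, a <= x <= b -> continuousRC f x) -> ex_CRInt f a b.
Proof.
intros Hab H. apply ex_CRInt_continuous. intros x Hx. rewrite Rmin_left, Rmax_right in Hx by lra. now apply H.
Qed.

Lemma CRInt_correct (f : R -> C) (a b : R) : ex_CRInt f a b -> is_CRInt f a b (CRInt f a b).
Proof. exact (RInt_correct (V := CV) f a b). Qed.

Lemma is_CRInt_unique (f : R -> C) (a b : R) (l : C) : is_CRInt f a b l -> CRInt f a b = l.
Proof. exact (is_RInt_unique (V := CV) f a b l). Qed.

Lemma is_CRInt_bound (f : R -> C) (g : R -> R) (a b : R) (l : C) (m : R) :
  a <= b -> (forall x, a <= x <= b -> Cmod (f x) <= g x) ->
  is_CRInt f a b l -> is_RInt g a b m -> Cmod l <= m.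
Proof.
intros Hab H H1 H2. rewrite <- norm_CN.
apply (norm_RInt_le (V := CN) f g a b l m Hab); try assumption.
intros x Hx. rewrite norm_CN. now apply H.
Qed.

(** The field (P, Q) is closed: [D] is both cross derivatives. Differentiating the integral of P
    over [a, b] in y gives the integral of D in x, which is Q b y - Q a y by the fundamental
    theorem; integrating this in y concludes. The margins around the rectangle supply the
    neighbourhoods that differentiation under the integral asks for. *)
Lemma green_rectangle (P Q D : R -> R -> R) (a0 a b b0 c0 c d d0 : R) :
  a0 < a -> a <= b -> b < b0 -> c0 < c -> c <= d -> d < d0 ->
  (forall x y, a0 < x < b0 -> c0 < y < d0 ->
     is_derive (fun t => P x t) y (D x y) /\ is_derive (fun t => Q t y) x (D x y) /\
     continuity_2d_pt D x y /\ continuous (fun t => P t y) x /\ continuous (fun t => Q x t) y) ->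
  RInt (fun x => P x d) a b - RInt (fun x => P x c) a b = RInt (fun y => Q b y - Q a y) c d.
Proof.
intros Ha Hab Hb Hc Hcd Hd H.
assert (Hphi : forall y, c <= y <= d ->
  is_derive (fun y => RInt (fun x => P x y) a b) y (Q b y - Q a y)).
{ intros y Hy.
  assert (Hl : locally y (fun y' => c0 < y' < d0)).
  { apply (open_and (fun y => c0 < y) (fun y => y < d0)); [apply open_gt|apply open_lt|lra]. }
  evar_last.
  - apply (is_derive_RInt_param (fun u t => P t u) a b y).
    + revert Hl. apply filter_imp. intros y' Hy' t Ht.
      rewrite Rmin_left, Rmax_right in Ht by lra.
      exists (D t y'). apply H; lra.
    + intros t Ht. rewrite Rmin_left, Rmax_right in Ht by lra.
      apply (continuity_2d_pt_ext_loc (fun u v => D v u)).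
      * assert (Hl2 : locally_2d (fun u v => (c0 < u < d0) /\ (a0 < v < b0)) y t).
        { apply (locally_2d_locally (fun u v => (c0 < u < d0) /\ (a0 < v < b0))).
          destruct Hl as [e1 He1].
          assert (Hl3 : locally t (fun y' => a0 < y' < b0))
            by (apply (open_and (fun y => a0 < y) (fun y => y < b0)); [apply open_gt|apply open_lt|lra]).
          destruct Hl3 as [e2 He2].
          exists (mkposreal _ (Rmin_stable_in_posreal e1 e2)).
          intros [u v] [B1 B2]. cbn [fst snd] in *. split.
          - apply He1. eapply ball_le; [|exact B1]. apply Rmin_l.
          - apply He2. eapply ball_le; [|exact B2]. apply Rmin_r. }
        revert Hl2. apply locally_2d_impl. apply locally_2d_forall. intros u v [Hu Hv].
        symmetry. apply is_derive_unique. apply H; lra.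
      * destruct (H t y) as (_ & _ & HR & _); [lra|lra|].
        intros eps. destruct (HR eps) as [del Hdel]. exists del. intros u v Hu Hv. now apply Hdel.
    + revert Hl. apply filter_imp. intros y' Hy'.
      apply (ex_RInt_continuous (V := R_CompleteNormedModule)). intros x Hx.
      rewrite Rmin_left, Rmax_right in Hx by lra. apply H; lra.
  - transitivity (RInt (fun t => D t y) a b).
    + apply RInt_ext. intros t Ht. rewrite Rmin_left, Rmax_right in Ht by lra.
      apply is_derive_unique. apply H; lra.
    + apply is_RInt_unique. apply (is_RInt_derive (V := R_CompleteNormedModule) (fun t => Q t y)).
      * intros x Hx. rewrite Rmin_left, Rmax_right in Hx by lra. apply H; lra.
      * intros x Hx. rewrite Rmin_left, Rmax_right in Hx by lra.
        destruct (H x y) as (_ & _ & HR & _); [lra|lra|].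
        intros T [eps HT]. destruct (HR eps) as [del Hdel]. exists del.
        intros z Hz. apply HT. apply Hdel; [exact Hz|].
        rewrite Rminus_diag, Rabs_R0. apply cond_pos. }
symmetry. apply is_RInt_unique.
apply (is_RInt_derive (V := R_CompleteNormedModule) (fun y => RInt (fun x => P x y) a b)).
- intros y Hy. rewrite Rmin_left, Rmax_right in Hy by lra. now apply Hphi.
- intros y Hy. rewrite Rmin_left, Rmax_right in Hy by lra.
  apply (continuous_minus (V := R_NormedModule)); apply H; lra.
Qed.

Lemma continuous_horizontal (F : C -> C) (x y : R) :
  continuousCC F (x, y) ->
  continuousRC (fun t => F (t, y)) x.
Proof.
intros H. apply (continuous_comp (V := C_UniformSpace) (fun t => (t, y) : C) F); [|exact H].
apply continuous_C_pair; [apply continuous_id|apply continuous_const].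
Qed.

Lemma continuous_vertical (F : C -> C) (x y : R) :
  continuousCC F (x, y) ->
  continuousRC (fun t => F (x, t)) y.
Proof.
intros H. apply (continuous_comp (V := C_UniformSpace) (fun t => (x, t) : C) F); [|exact H].
apply continuous_C_pair; [apply continuous_const|apply continuous_id].
Qed.

Lemma continuous_C_2d (f : C -> C) (x y : R) :
  continuousCC f (x, y) ->
  continuity_2d_pt (fun u v => fst (f (u, v))) x y /\
  continuity_2d_pt (fun u v => snd (f (u, v))) x y.
Proof.
intros H; split; apply continuity_2d_pt_filterlim.
- apply (filterlim_ext (fun z : C => fst (f z))); [now intros []|].
  exact (continuous_C_fst _ _ _ H).
- apply (filterlim_ext (fun z : C => snd (f z))); [now intros []|].
  exact (continuous_C_snd _ _ _ H).
Qed.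

Definition open_rect (a b c d : R) (z : C) : Prop := a < fst z < b /\ c < snd z < d.

(** By the Cauchy-Riemann equations, encoded in the factor [Ci] of [analytic_on], the fields (Re F,
    - Im F) and (Im F, Re F) are closed, with cross derivatives - Im F' and Re F'. Green's formula
    for each gives one component of the identity. *)
Lemma cauchy_rectangle (F : C -> C) (a0 a b b0 c0 c d d0 : R) :
  a0 < a -> a <= b -> b < b0 -> c0 < c -> c <= d -> d < d0 ->
  analytic_on (open_rect a0 b0 c0 d0) F ->
  (CRInt (fun x => F (x, d)) a b - CRInt (fun x => F (x, c)) a b =
   Ci * (CRInt (fun y => F (b, y)) c d - CRInt (fun y => F (a, y)) c d))%C.
Proof.
intros Ha Hab Hb Hc Hcd Hd HF.
assert (Hcx : forall y, c <= y <= d -> ex_CRInt (fun x => F (x, y)) a b).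
{ intros y Hy. apply ex_CRInt_on; [lra|]. intros x Hx.
  apply continuous_horizontal, (analytic_on_continuous _ _ _ HF). split; cbn; lra. }
assert (Hcy : forall x, a <= x <= b -> ex_CRInt (fun y => F (x, y)) c d).
{ intros x Hx. apply ex_CRInt_on; [lra|]. intros y Hy.
  apply continuous_vertical, (analytic_on_continuous _ _ _ HF). split; cbn; lra. }
pose proof (CRInt_correct _ _ _ (Hcx c (conj (Rle_refl c) Hcd))) as I1.
pose proof (CRInt_correct _ _ _ (Hcx d (conj Hcd (Rle_refl d)))) as I2.
pose proof (CRInt_correct _ _ _ (Hcy a (conj (Rle_refl a) Hab))) as I3.
pose proof (CRInt_correct _ _ _ (Hcy b (conj Hab (Rle_refl b)))) as I4.
set (A := CRInt (fun x => F (x, c)) a b) in *. set (B := CRInt (fun x => F (x, d)) a b) in *.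
set (L := CRInt (fun y => F (a, y)) c d) in *. set (M := CRInt (fun y => F (b, y)) c d) in *.
destruct HF as [dF HF].
pose proof (green_rectangle (fun x y => fst (F (x, y))) (fun x y => - snd (F (x, y)))
  (fun x y => - snd (dF (x, y))) a0 a b b0 c0 c d d0 Ha Hab Hb Hc Hcd Hd) as G1.
pose proof (green_rectangle (fun x y => snd (F (x, y))) (fun x y => fst (F (x, y)))
  (fun x y => fst (dF (x, y))) a0 a b b0 c0 c d d0 Ha Hab Hb Hc Hcd Hd) as G2.
cbv beta in G1, G2.
rewrite (is_RInt_unique (fun x => fst (F (x, d))) _ _ _ (is_CRInt_fst _ _ _ _ I2)),
  (is_RInt_unique (fun x => fst (F (x, c))) _ _ _ (is_CRInt_fst _ _ _ _ I1)) in G1.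
rewrite (is_RInt_unique (fun x => snd (F (x, d))) _ _ _ (is_CRInt_snd _ _ _ _ I2)),
  (is_RInt_unique (fun x => snd (F (x, c))) _ _ _ (is_CRInt_snd _ _ _ _ I1)) in G2.
assert (E1 : RInt (fun y => - snd (F (b, y)) - - snd (F (a, y))) c d = - snd M - - snd L).
{ apply is_RInt_unique.
  exact (is_RInt_minus (V := R_NormedModule) _ _ _ _ _ _
    (is_RInt_opp (V := R_NormedModule) _ _ _ _ (is_CRInt_snd _ _ _ _ I4))
    (is_RInt_opp (V := R_NormedModule) _ _ _ _ (is_CRInt_snd _ _ _ _ I3))). }
assert (E2 : RInt (fun y => fst (F (b, y)) - fst (F (a, y))) c d = fst M - fst L).
{ apply is_RInt_unique.
  exact (is_RInt_minus (V := R_NormedModule) _ _ _ _ _ _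
    (is_CRInt_fst _ _ _ _ I4) (is_CRInt_fst _ _ _ _ I3)). }
rewrite E1 in G1. rewrite E2 in G2.
assert (K1 : fst B - fst A = - snd M - - snd L).
{ apply G1. intros x y Hx Hy. destruct (HF x y (conj Hx Hy)) as (H1 & H2 & H3 & H4).
  split; [|split; [|split; [|split]]].
  - destruct H2 as [H2 _]. evar_last; [exact H2|]. cbn. ring.
  - exact (is_derive_opp (V := R_NormedModule) _ _ _ (proj2 H1)).
  - apply continuity_2d_pt_opp. exact (proj2 (continuous_C_2d _ _ _ H4)).
  - exact (continuous_C_fst _ _ _ (continuous_horizontal _ _ _ H3)).
  - exact (continuous_opp (V := R_NormedModule) _ _ (continuous_C_snd _ _ _ (continuous_vertical _ _ _ H3))). }
assert (K2 : snd B - snd A = fst M - fst L).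
{ apply G2. intros x y Hx Hy. destruct (HF x y (conj Hx Hy)) as (H1 & H2 & H3 & H4).
  split; [|split; [|split; [|split]]].
  - destruct H2 as [_ H2]. evar_last; [exact H2|]. cbn. ring.
  - exact (proj1 H1).
  - exact (proj1 (continuous_C_2d _ _ _ H4)).
  - exact (continuous_C_snd _ _ _ (continuous_horizontal _ _ _ H3)).
  - exact (continuous_C_fst _ _ _ (continuous_vertical _ _ _ H3)). }
clearbody A B L M. clear - K1 K2. unfold Cminus. apply C_ext; cbn; lra.
Qed.

(** * The integral over the right half of the contour *)

(** A ball of [C] is a square, so membership in a ball of radius e bounds the modulus only by sqrt 2
    e; hence the radius eps/2 in the first direction. *)
Lemma filterlim_C_Cmod (T : Type) (F : (T -> Prop) -> Prop) (FF : Filter F) (f : T -> C) (l : C) :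
  filterlim f F (locallyC l) <->
  (forall eps : R, 0 < eps -> F (fun t => Cmod (f t - l) < eps)).
Proof.
split.
- intros H eps Heps.
  assert (He : 0 < eps / 2) by lra.
  generalize (H _ (locally_ball (T := C_UniformSpace) l (mkposreal _ He))). unfold filtermap.
  apply filter_imp. intros t Ht.
  pose proof (C_NormedModule_mixin_compat2 _ _ _ Ht) as H1. cbn [pos] in H1.
  eapply Rlt_le_trans; [exact H1|].
  assert (sqrt 2 <= 2) by (rewrite <- (sqrt_square 2) at 2 by lra; apply sqrt_le_1_alt; lra). nra.
- intros H P [e He]. unfold filtermap. generalize (H e (cond_pos e)). apply filter_imp.
  intros t Ht. apply He. apply C_NormedModule_mixin_compat1. exact Ht.
Qed.

Lemma Cmod_minus_sym (z w : C) : Cmod (z - w) = Cmod (w - z).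
Proof. rewrite <- Cmod_opp. f_equal. ring. Qed.

Lemma Cmod_minus_le (z w : C) : Cmod z <= Cmod w + Cmod (z - w).
Proof. replace z with (w + (z - w))%C at 1 by ring. apply Cmod_triangle. Qed.

Lemma Cminus_0_r (z : C) : (z - 0)%C = z.
Proof. ring. Qed.

(** * Improper integrals over half-lines *)

Definition is_half (f : R -> C) (a : R) (l : C) : Prop :=
  is_RInt_gen (V := CN) f (at_point a) (Rbar_locally p_infty) l.

Lemma is_half_intro (f : R -> C) (a : R) (l : C) :
  (forall b, a <= b -> ex_CRInt f a b) ->
  filterlim (fun b => CRInt f a b) (Rbar_locally p_infty) (locallyC l) ->
  is_half f a l.
Proof.
intros H1 H2 P HP.
apply (Filter_prod _ _ _ (fun x => x = a) (fun b => a <= b /\ P (CRInt f a b))).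
- reflexivity.
- pose proof (H2 P HP) as H3. unfold filtermap in H3.
  assert (H4 : Rbar_locally p_infty (fun b => a <= b)) by (exists a; intros; lra).
  generalize (filter_and _ _ H3 H4). apply filter_imp. tauto.
- intros x b -> [Hb Hp]. exists (CRInt f a b). split; [|exact Hp].
  now apply CRInt_correct, H1.
Qed.

Lemma is_half_unique (f : R -> C) (a : R) (l : C) :
  is_half f a l -> RInt_gen (V := CV) f (at_point a) (Rbar_locally p_infty) = l.
Proof. exact (fun H => @is_RInt_gen_unique CV _ _ _ _ f l H). Qed.

Lemma is_half_eq (f : R -> C) (a : R) (l m : C) : is_half f a l -> is_half f a m -> l = m.
Proof. intros H1 H2. now rewrite <- (is_half_unique _ _ _ H1), <- (is_half_unique _ _ _ H2). Qed.

Lemma is_half_plus (f g : R -> C) (a : R) (l m : C) :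
  is_half f a l -> is_half g a m -> is_half (fun t => (f t + g t)%C) a (l + m)%C.
Proof. exact (is_RInt_gen_plus (V := CN) f g l m). Qed.

Lemma is_half_ext (f g : R -> C) (a : R) (l : C) :
  (forall x, a < x -> f x = g x) -> is_half f a l -> is_half g a l.
Proof.
intros H H0. refine (@is_RInt_gen_ext CN (at_point a) (Rbar_locally p_infty) _ _ f g l _ H0).
apply (Filter_prod _ _ _ (fun x => x = a) (fun b => a <= b)).
- reflexivity.
- exists a; intros; lra.
- intros x b -> Hb t Ht. cbn [fst snd] in Ht. rewrite Rmin_left in Ht by lra. apply H; lra.
Qed.

Lemma is_half_Chasles (f : R -> C) (a b : R) (l m : C) :
  is_CRInt f a b l -> is_half f b m -> is_half f a (l + m)%C.
Proof.
intros H1 H2. refine (@is_RInt_gen_Chasles CN (at_point a) (Rbar_locally p_infty) _ _ f b l m _ H2).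
now apply (is_RInt_gen_at_point (V := CN)).
Qed.

Lemma exp_eventually_small (K c eps : R) : 0 < c -> 0 < eps ->
  exists N, forall x, N <= x -> K * exp (- c * x) < eps.
Proof.
intros Hc He.
exists ((Rabs K / eps) / c). intros x Hx.
assert (H0 : 0 <= Rabs K / eps) by (apply Rdiv_le_0_compat; [apply Rabs_pos|lra]).
assert (H1 : Rabs K / eps <= c * x).
{ apply (Rmult_le_compat_l c) in Hx; [|lra]. replace (c * (Rabs K / eps / c)) with (Rabs K / eps) in Hx by (field; lra). exact Hx. }
pose proof (exp_ineq1_le (c * x)) as H2.
assert (H3 : Rabs K < eps * exp (c * x)).
{ apply (Rmult_le_compat_l eps) in H1; [|lra].
  replace (eps * (Rabs K / eps)) with (Rabs K) in H1 by (field; lra). nra. }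
replace (- c * x) with (- (c * x)) by ring. rewrite exp_Ropp.
pose proof (exp_pos (c * x)). pose proof (Rle_abs K).
apply (Rmult_lt_reg_r (exp (c * x))); [assumption|]. rewrite Rmult_assoc, Rinv_l; lra.
Qed.

Lemma is_RInt_exp_decay (K c a b : R) : 0 < c ->
  is_RInt (fun x => K * exp (- c * x)) a b (K * exp (- c * a) / c - K * exp (- c * b) / c).
Proof.
intros Hc.
replace (K * exp (- c * a) / c - K * exp (- c * b) / c)
  with (minus (- (K * exp (- c * b) / c)) (- (K * exp (- c * a) / c))) by (unfold minus, plus, opp; cbn; lra).
apply (is_RInt_derive (V := R_CompleteNormedModule) (fun x => - (K * exp (- c * x) / c))).
- intros x _. auto_derive; [trivial|]. field. lra.
- intros x _. apply (ex_derive_continuous (V := R_NormedModule)). auto_derive. trivial.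
Qed.

(** The integral over [u, v] is at most K e^{-cu}/c, so the truncated integrals satisfy the Cauchy
    criterion; the same estimate with u = a bounds the limit. *)
Lemma is_half_dominated (f : R -> C) (a K c : R) :
  0 < c -> (forall b, a <= b -> ex_CRInt f a b) ->
  (forall x, a <= x -> Cmod (f x) <= K * exp (- c * x)) ->
  exists l, is_half f a l /\ Cmod l <= K * exp (- c * a) / c /\
    filterlim (fun b => CRInt f a b) (Rbar_locally p_infty) (locallyC l).
Proof.
intros Hc Hex Hb.
assert (Hsub : forall u v, a <= u -> u <= v ->
  is_CRInt f u v (CRInt f a v - CRInt f a u)%C /\
  Cmod (CRInt f a v - CRInt f a u) <= K * exp (- c * u) / c).
{ intros u v Hu Hv.
  assert (I : is_CRInt f u v (CRInt f a v - CRInt f a u)%C).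
  { replace (CRInt f a v - CRInt f a u)%C with (- CRInt f a u + CRInt f a v)%C by ring.
    apply (is_CRInt_Chasles f u a v).
    - apply is_CRInt_swap, CRInt_correct, Hex, Hu.
    - apply CRInt_correct, Hex. lra. }
  split; [exact I|].
  eapply Rle_trans.
  - apply (is_CRInt_bound f (fun x => K * exp (- c * x)) u v _ _ Hv); [|exact I|now apply is_RInt_exp_decay].
    intros x Hx. apply Hb. lra.
  - assert (0 <= K * exp (- c * v)).
    { eapply Rle_trans; [apply Cmod_ge_0|apply (Hb v); lra]. }
    assert (0 <= K * exp (- c * v) / c) by (apply Rdiv_le_0_compat; lra). lra. }
assert (HL : exists l : C, filterlim (fun b => CRInt f a b) (Rbar_locally p_infty) (locallyC l)).
{ apply (filterlim_locally_cauchy (U := CV)). intros eps.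
  destruct (exp_eventually_small (K / c) c eps Hc (cond_pos eps)) as [N HN].
  exists (fun b => a <= b /\ N <= b). split.
  - exists (Rmax a N). intros x Hx. pose proof (Rmax_l a N). pose proof (Rmax_r a N). lra.
  - assert (W : forall u v, a <= u -> N <= u -> u <= v ->
      Cmod (CRInt f a v - CRInt f a u) < eps).
    { intros u v H1 H2 H3. eapply Rle_lt_trans; [apply Hsub; lra|].
      replace (K * exp (- c * u) / c) with (K / c * exp (- c * u)) by (field; lra). now apply HN. }
    intros u v [H1 H2] [H3 H4]. apply C_NormedModule_mixin_compat1.
    change (Cmod (CRInt f a v - CRInt f a u) < eps).
    destruct (Rle_dec u v); [apply W; lra|]. rewrite Cmod_minus_sym. apply W; lra. }
destruct HL as [l Hl]. exists l. split; [now apply is_half_intro|]. split; [|exact Hl].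
apply Rle_plus_epsilon. intros eps Heps.
pose proof (proj1 (filterlim_C_Cmod _ _ _ _ _) Hl eps Heps) as [N HN].
set (b := Rmax (N + 1) a).
assert (Hba : a <= b) by apply Rmax_r.
assert (HbN : N < b) by (pose proof (Rmax_l (N + 1) a); unfold b; lra).
specialize (HN b HbN).
pose proof (Cmod_minus_le l (CRInt f a b)) as H1. rewrite Cmod_minus_sym in H1.
destruct (Hsub a b (Rle_refl a) Hba) as [I H2].
assert (E0 : CRInt f a a = RtoC 0) by exact (is_CRInt_unique _ _ _ _ (is_RInt_point (V := CN) f a)).
rewrite E0, Cminus_0_r in H2. lra.
Qed.

(** The way back from [RInt_gen] to truncated integrals, on which Cauchy's theorem for bounded
    rectangles can act. *)
Lemma is_half_lim (f : R -> C) (a : R) (l : C) :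
  (forall b, a <= b -> ex_CRInt f a b) -> is_half f a l ->
  filterlim (fun b => CRInt f a b) (Rbar_locally p_infty) (locallyC l).
Proof.
intros Hex H P HP. destruct (H P HP) as [Q S HQ HS HQS]. unfold filtermap.
revert HS. apply filter_imp. intros b Hb.
destruct (HQS a b HQ Hb) as (y & Hy & Py). cbn [fst snd] in Hy.
now rewrite (is_CRInt_unique _ _ _ _ Hy).
Qed.

(** * The right half of the contour *)

Notation y_top := (- (PI / 4)).
Notation y_bot := (- (9 * PI / 4)).

Definition on_path (z : C) : Prop :=
  (1 <= fst z /\ (snd z = y_top \/ snd z = y_bot)) \/ (fst z = 1 /\ y_bot <= snd z <= y_top).

(** Traversed as C_1 + i pi/4: in along the upper half-line, down the side Re z = 1, out along the
    lower half-line. Hence l0 and m, computed in the increasing direction, carry a minus sign; the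
    factor [Ci] is dz = i dy. *)
Definition is_U (F : C -> C) (l : C) : Prop :=
  exists l0 l1 m : C,
    is_half (fun x => F (x, y_top)) 1 l0 /\ is_half (fun x => F (x, y_bot)) 1 l1 /\
    is_CRInt (fun y => F (1, y)) y_bot y_top m /\ l = (l1 - l0 - Ci * m)%C.

(** A total function, so that derivatives of contour integrals with respect to a parameter can be
    stated without carrying convergence proofs. *)
Definition Uint (F : C -> C) : C :=
  (RInt_gen (V := CV) (fun x => F (x, y_bot)) (at_point 1) (Rbar_locally p_infty)
   - RInt_gen (V := CV) (fun x => F (x, y_top)) (at_point 1) (Rbar_locally p_infty)
   - Ci * CRInt (fun y => F (1, y)) y_bot y_top)%C.

Lemma is_U_unique (F : C -> C) (l : C) : is_U F l -> Uint F = l.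
Proof.
intros (l0 & l1 & m & H0 & H1 & Hm & ->). unfold Uint.
now rewrite (is_half_unique _ _ _ H0), (is_half_unique _ _ _ H1), (is_CRInt_unique _ _ _ _ Hm).
Qed.

Lemma is_half_mult_l (c : C) (f : R -> C) (a : R) (l : C) :
  is_half f a l -> is_half (fun t => (c * f t)%C) a (c * l)%C.
Proof.
intros H P HP.
assert (Hc : filterlim (fun z : C => (c * z)%C) (locallyC l) (locallyC (c * l)%C)).
{ apply (continuous_Cmult C_UniformSpace (fun _ => c) (fun z => z)); [apply continuous_const|apply continuous_id]. }
destruct (H _ (Hc P HP)) as [Q S HQ HS HQS].
apply (Filter_prod _ _ _ Q S HQ HS). intros x y Hx Hy.
destruct (HQS x y Hx Hy) as (w & Hw & Pw). exists (c * w)%C. split; [|exact Pw].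
now apply is_CRInt_mult_l.
Qed.

Lemma is_U_plus (F G : C -> C) (l m : C) :
  is_U F l -> is_U G m -> is_U (fun z => (F z + G z)%C) (l + m)%C.
Proof.
intros (l0 & l1 & l2 & H0 & H1 & H2 & ->) (m0 & m1 & m2 & K0 & K1 & K2 & ->).
exists (l0 + m0)%C, (l1 + m1)%C, (l2 + m2)%C. split; [|split; [|split]].
- exact (is_half_plus _ _ _ _ _ H0 K0).
- exact (is_half_plus _ _ _ _ _ H1 K1).
- exact (is_CRInt_plus _ _ _ _ _ _ H2 K2).
- ring.
Qed.

Lemma is_U_mult_l (c : C) (F : C -> C) (l : C) :
  is_U F l -> is_U (fun z => (c * F z)%C) (c * l)%C.
Proof.
intros (l0 & l1 & l2 & H0 & H1 & H2 & ->).
exists (c * l0)%C, (c * l1)%C, (c * l2)%C. split; [|split; [|split]].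
- exact (is_half_mult_l _ _ _ _ H0).
- exact (is_half_mult_l _ _ _ _ H1).
- exact (is_CRInt_mult_l _ _ _ _ _ H2).
- ring.
Qed.

Lemma is_U_ext (F G : C -> C) (l : C) :
  (forall z, on_path z -> F z = G z) -> is_U F l -> is_U G l.
Proof.
intros H (l0 & l1 & l2 & H0 & H1 & H2 & ->). pose proof PI_RGT_0.
exists l0, l1, l2. split; [|split; [|split; [|reflexivity]]].
- eapply is_half_ext; [|exact H0]. intros x Hx. apply H. left; cbn; split; [lra|now left].
- eapply is_half_ext; [|exact H1]. intros x Hx. apply H. left; cbn; split; [lra|now right].
- eapply is_RInt_ext; [|exact H2]. intros y Hy. apply H.
  rewrite Rmin_left, Rmax_right in Hy by lra. right; cbn; split; lra.
Qed.

Definition path_continuous (F : C -> C) : Prop :=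
  forall z, on_path z -> continuousCC F z.

Lemma is_U_dominated (F : C -> C) (K : R) :
  path_continuous F -> (forall z, on_path z -> Cmod (F z) <= K * exp (- fst z)) ->
  exists l, is_U F l /\ Cmod l <= 9 * K.
Proof.
intros Hc HK. pose proof PI_RGT_0 as Hpi. pose proof PI_4 as Hpi4.
assert (HK0 : 0 <= K).
{ assert (P : on_path (1, y_top)) by (left; cbn; split; [lra|now left]).
  pose proof (HK _ P) as H. pose proof (Cmod_ge_0 (F (1, y_top))). cbn [fst] in H. pose proof (exp_pos (-(1))). nra. }
assert (Hhalf : forall y, y = y_top \/ y = y_bot -> exists l, is_half (fun x => F (x, y)) 1 l /\ Cmod l <= K * exp (- (1))).
{ intros y Hy. destruct (is_half_dominated (fun x => F (x, y)) 1 K 1) as (l & Hl & Hb & _).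
  - lra.
  - intros b Hb. apply ex_CRInt_on; [lra|]. intros x Hx.
    apply continuous_horizontal, Hc. left; cbn; split; [lra|exact Hy].
  - intros x Hx. replace (- (1) * x) with (- x) by ring. apply (HK (x, y)). left; cbn; split; [lra|exact Hy].
  - exists l; split; [exact Hl|]. rewrite Rmult_1_r in Hb. lra. }
destruct (Hhalf y_top (or_introl eq_refl)) as (l0 & H0 & B0).
destruct (Hhalf y_bot (or_intror eq_refl)) as (l1 & H1 & B1).
assert (Hv : ex_CRInt (fun y => F (1, y)) y_bot y_top).
{ apply ex_CRInt_on; [lra|]. intros y Hy.
  apply continuous_vertical, Hc. right; cbn; split; lra. }
apply CRInt_correct in Hv. set (m := CRInt (fun y => F (1, y)) y_bot y_top) in *.
assert (Bm : Cmod m <= (y_top - y_bot) * (K * exp (- (1)))).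
{ apply (is_CRInt_bound (fun y => F (1, y)) (fun _ => K * exp (- (1))) y_bot y_top m); [lra| |exact Hv|].
  - intros y Hy. apply (HK (1, y)). right; cbn; split; lra.
  - apply (is_RInt_const (V := R_NormedModule)). }
exists (l1 - l0 - Ci * m)%C. split; [now exists l0, l1, m|].
(* Each half-line contributes at most K/e and the side, of length 2 pi <= 8, at most 8K/e; with 1/e
   <= 1/2 the total stays below 9K. *)
assert (He : exp (- (1)) <= 1 / 2).
{ rewrite exp_Ropp. pose proof (exp_ineq1_le 1). apply (Rmult_le_reg_r (exp 1)); [apply exp_pos|].
  rewrite Rinv_l; lra. }
pose proof (exp_pos (- (1))).
assert (HT : Cmod (l1 - l0 - Ci * m) <= Cmod l1 + Cmod l0 + Cmod m).
{ unfold Cminus. eapply Rle_trans; [apply Cmod_triangle|].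
  rewrite Cmod_opp, Cmod_mult, Cmod_Ci, Rmult_1_l. apply Rplus_le_compat_r.
  eapply Rle_trans; [apply Cmod_triangle|]. rewrite Cmod_opp. lra. }
assert (H2 : K * exp (- (1)) <= K / 2) by nra.
assert (H3 : (y_top - y_bot) * (K * exp (- (1))) <= 8 * (K / 2)).
{ assert (0 <= K * exp (- (1))) by nra. apply Rmult_le_compat; lra. }
lra.
Qed.

(** Cauchy's theorem on [1, b] x [c, d]: the side Re z = b contributes at most (d - c) K e^{-b} and
    disappears as b grows. *)
Lemma half_strip (F : C -> C) (c d K : R) (l m : C) :
  c <= d -> analytic_on (fun z => 0 < fst z) F ->
  (forall x y, 1 <= x -> c <= y <= d -> Cmod (F (x, y)) <= K * exp (- x)) ->
  is_half (fun x => F (x, c)) 1 l -> is_half (fun x => F (x, d)) 1 m ->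
  (m - l = - (Ci * CRInt (fun y => F (1%R, y)) c d))%C.
Proof.
intros Hcd HF HK Hl Hm.
assert (Hx : forall y b, 1 <= b -> ex_CRInt (fun x => F (x, y)) 1 b).
{ intros y b Hb. apply ex_CRInt_continuous. intros x Hx. rewrite Rmin_left in Hx by lra.
  apply continuous_horizontal, (analytic_on_continuous _ _ _ HF). cbn; lra. }
apply is_half_lim in Hl; [|intros; apply Hx; lra]. apply is_half_lim in Hm; [|intros; apply Hx; lra].
pose proof (proj1 (filterlim_C_Cmod _ _ _ _ _) Hl) as Ll.
pose proof (proj1 (filterlim_C_Cmod _ _ _ _ _) Hm) as Lm.
set (M := CRInt (fun y => F (1%R, y)) c d).
assert (HK0 : 0 <= K).
{ assert (H := HK 1 c (Rle_refl 1) (conj (Rle_refl c) Hcd)). pose proof (Cmod_ge_0 (F (1, c))). pose proof (exp_pos (-(1))). nra. }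
assert (Hz : (m - l + Ci * M)%C = RtoC 0).
{ apply Cmod_eq_0. apply Rle_antisym; [|apply Cmod_ge_0].
  apply Rle_plus_epsilon. intros eps Heps. rewrite Rplus_0_l.
  destruct (Ll (eps / 3) ltac:(lra)) as [N1 HN1].
  destruct (Lm (eps / 3) ltac:(lra)) as [N2 HN2].
  destruct (exp_eventually_small ((d - c) * K) 1 (eps / 3) ltac:(lra) ltac:(lra)) as [N3 HN3].
  set (b := Rmax 1 (Rmax (N1 + 1) (Rmax (N2 + 1) N3))).
  assert (Hb : 1 <= b /\ N1 < b /\ N2 < b /\ N3 <= b).
  { unfold b. repeat split.
    - apply Rmax_l.
    - eapply Rlt_le_trans; [|eapply Rle_trans; [|apply Rmax_r]]; [|apply Rmax_l]; lra.
    - eapply Rlt_le_trans; [|eapply Rle_trans; [|apply Rmax_r]]; [|eapply Rle_trans; [|apply Rmax_r]; apply Rmax_l]; lra.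
    - eapply Rle_trans; [|apply Rmax_r]. eapply Rle_trans; [|apply Rmax_r]. apply Rmax_r. }
  destruct Hb as (Hb1 & Hb2 & Hb3 & Hb4).
  specialize (HN1 b Hb2). specialize (HN2 b Hb3). specialize (HN3 b Hb4).
  pose proof (cauchy_rectangle F 0 1 b (b + 1) (c - 1) c d (d + 1)
    ltac:(lra) Hb1 ltac:(lra) ltac:(lra) Hcd ltac:(lra)) as G.
  assert (HF' : analytic_on (open_rect 0 (b + 1) (c - 1) (d + 1)) F).
  { eapply analytic_on_subset; [|exact HF]. intros z [Hz _]. lra. }
  specialize (G HF'). fold M in G.
  set (A := CRInt (fun x => F (x, d)) 1 b) in *. set (B := CRInt (fun x => F (x, c)) 1 b) in *.
  assert (Hv : ex_CRInt (fun y => F (b, y)) c d).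
  { apply ex_CRInt_continuous. intros y Hy. apply continuous_vertical, (analytic_on_continuous _ _ _ HF). cbn; lra. }
  apply CRInt_correct in Hv. set (S := CRInt (fun y => F (b, y)) c d) in *.
  assert (HS : Cmod S <= (d - c) * (K * exp (- b))).
  { apply (is_CRInt_bound (fun y => F (b, y)) (fun _ => K * exp (- b)) c d S _ Hcd); [|exact Hv|].
    - intros y Hy. now apply HK.
    - apply (is_RInt_const (V := R_NormedModule)). }
  replace (- (1) * b) with (- b) in HN3 by ring.
  replace (m - l + Ci * M)%C with (- (A - m) + ((B - l) + Ci * S))%C.
  - eapply Rle_trans; [apply Cmod_triangle|]. rewrite Cmod_opp.
    eapply Rle_trans; [apply Rplus_le_compat_l, Cmod_triangle|].
    rewrite Cmod_mult, Cmod_Ci. lra.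
  - replace (Ci * S)%C with (A - B + Ci * M)%C by (rewrite G; ring). ring. }
replace (m - l)%C with (m - l + Ci * M - Ci * M)%C by ring. rewrite Hz. ring.
Qed.

(** Each horizontal half-line sweeps a half-strip free of poles, which [half_strip] turns into an
    integral over a piece of Re z = 1; these two pieces are what changes the side [y_bot, y_top]
    into [y_bot + d, y_top + d]. Decay is required only in the two swept half-strips: between them
    the exponential is allowed to grow. *)
Lemma is_U_translate_pos (F : C -> C) (d K : R) (l : C) :
  0 <= d -> analytic_on (fun z => 0 < fst z) F ->
  (forall x y, 1 <= x -> y_top <= y <= y_top + d \/ y_bot <= y <= y_bot + d ->
     Cmod (F (x, y)) <= K * exp (- x)) ->
  is_U F l -> is_U (fun z => F (fst z, snd z + d)) l.
Proof.
intros Hd HF HK (l0 & l1 & m & H0 & H1 & Hm & ->).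
assert (Hhalf : forall y, y = y_top \/ y = y_bot -> exists l, is_half (fun x => F (x, y + d)) 1 l).
{ intros y Hy. destruct (is_half_dominated (fun x => F (x, y + d)) 1 K 1) as (l & Hl & Hb & _).
  - lra.
  - intros b Hb. apply ex_CRInt_on; [lra|]. intros x Hx.
    apply continuous_horizontal, (analytic_on_continuous _ _ _ HF). cbn; lra.
  - intros x Hx. replace (- (1) * x) with (- x) by ring. apply HK; [lra|].
    destruct Hy as [-> | ->]; [left|right]; lra.
  - now exists l. }
destruct (Hhalf y_top (or_introl eq_refl)) as (k0 & K0).
destruct (Hhalf y_bot (or_intror eq_refl)) as (k1 & K1).
assert (E0 : (k0 - l0 = - (Ci * CRInt (fun y => F (1%R, y)) y_top (y_top + d)))%C).
{ apply (half_strip F _ _ K); try assumption; [lra|]. intros x y Hx Hy. apply HK; [exact Hx|now left]. }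
assert (E1 : (k1 - l1 = - (Ci * CRInt (fun y => F (1%R, y)) y_bot (y_bot + d)))%C).
{ apply (half_strip F _ _ K); try assumption; [lra|]. intros x y Hx Hy. apply HK; [exact Hx|now right]. }
assert (Hv : forall a b, is_CRInt (fun y => F (1%R, y)) a b (CRInt (fun y => F (1%R, y)) a b)).
{ intros a b. apply CRInt_correct, ex_CRInt_continuous. intros y _.
  apply continuous_vertical, (analytic_on_continuous _ _ _ HF). cbn; lra. }
pose proof (Hv y_top (y_top + d)) as V0. pose proof (Hv y_bot (y_bot + d)) as V1.
set (s0 := CRInt (fun y => F (1%R, y)) y_top (y_top + d)) in *.
set (s1 := CRInt (fun y => F (1%R, y)) y_bot (y_bot + d)) in *.
exists k0, k1, (- s1 + (m + s0))%C. split; [exact K0|split; [exact K1|split]].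
- cbn [fst snd]. apply (is_CRInt_translate (fun y => F (1%R, y)) d).
  apply (is_CRInt_Chasles _ _ y_bot); [now apply is_CRInt_swap|].
  now apply (is_CRInt_Chasles _ _ y_top).
- replace k0 with (l0 + (k0 - l0))%C by ring. replace k1 with (l1 + (k1 - l1))%C by ring.
  rewrite E0, E1. ring.
Qed.

(** * Differentiation under the integral *)

Lemma Cexp_plus (z w : C) : Cexp (z + w) = (Cexp z * Cexp w)%C.
Proof.
destruct z as [a b], w as [c d]. unfold Cexp. apply C_ext; cbn;
  rewrite exp_plus, ?cos_plus, ?sin_plus; ring.
Qed.

Lemma Cexp_0 : Cexp 0 = 1%C.
Proof. unfold Cexp. cbn. rewrite exp_0, cos_0, sin_0. apply C_ext; cbn; ring. Qed.

Lemma Cmod_Cexp (z : C) : Cmod (Cexp z) = exp (fst z).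
Proof.
destruct z as [a b]. unfold Cexp, Cmod. cbn [fst snd].
replace ((exp a * cos b) ^ 2 + (exp a * sin b) ^ 2) with (exp a * exp a * (Rsqr (sin b) + Rsqr (cos b)))
  by (unfold Rsqr; ring).
rewrite sin2_cos2, Rmult_1_r. apply sqrt_square. left; apply exp_pos.
Qed.

Lemma fst_le_Cmod (z : C) : fst z <= Cmod z.
Proof. eapply Rle_trans; [apply Rle_abs|]. apply (re_le_Cmod z). Qed.

Lemma exp_le (x y : R) : x <= y -> exp x <= exp y.
Proof. intros [H| ->]; [left; now apply exp_increasing|right; reflexivity]. Qed.

Lemma is_CRInt_derC (f df : R -> C) (a b : R) :
  (forall x, Rmin a b <= x <= Rmax a b -> derC f x (df x)) ->
  (forall x, Rmin a b <= x <= Rmax a b -> continuousRC df x) ->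
  is_CRInt df a b (f b - f a)%C.
Proof.
intros H1 H2. apply is_CRInt_pair.
- apply (is_RInt_derive (V := R_CompleteNormedModule) (fun t => fst (f t))).
  + intros x Hx. apply H1, Hx.
  + intros x Hx. apply continuous_C_fst, H2, Hx.
- apply (is_RInt_derive (V := R_CompleteNormedModule) (fun t => snd (f t))).
  + intros x Hx. apply H1, Hx.
  + intros x Hx. apply continuous_C_snd, H2, Hx.
Qed.

Lemma is_CRInt_Cexp (w : C) (b : R) : is_CRInt (fun t => (Cexp (t * w) * w)%C) 0 b (Cexp (b * w) - 1)%C.
Proof.
replace (Cexp (b * w) - 1)%C with (Cexp (b * w) - Cexp (0 * w))%C
  by (rewrite Cmult_0_l, Cexp_0; reflexivity).
apply (is_CRInt_derC (fun t => Cexp (t * w))).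
- intros x _. apply (derC_Cexp (fun t => (t * w)%C)).
  split; cbn; auto_derive; trivial; ring.
- intros x _. apply continuous_Cmult; [apply continuous_Cexp|apply continuous_const].
  apply continuous_Cmult; [|apply continuous_const].
  apply continuous_C_pair; [apply continuous_id|apply continuous_const].
Qed.

Lemma exp_Cmod_bound (w : C) (t : R) : 0 <= t <= 1 -> Cmod (Cexp (t * w)) <= exp (Cmod w).
Proof.
intros Ht. rewrite Cmod_Cexp. apply exp_le.
cbn. pose proof (fst_le_Cmod w). pose proof (Cmod_ge_0 w). nra.
Qed.

Lemma Cexp_minus_1_bound (w : C) (t : R) : 0 <= t <= 1 ->
  Cmod (Cexp (t * w) - 1) <= Cmod w * exp (Cmod w).
Proof.
intros Ht.
assert (H : Cmod (Cexp (t * w) - 1) <= (t - 0) * (Cmod w * exp (Cmod w))).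
{ eapply (is_CRInt_bound (fun s => (Cexp (s * w) * w)%C) (fun _ => Cmod w * exp (Cmod w)) 0 t); [lra| |apply is_CRInt_Cexp|].
  - intros s Hs. rewrite Cmod_mult, Rmult_comm. apply Rmult_le_compat_l; [apply Cmod_ge_0|].
    apply exp_Cmod_bound. lra.
  - apply (is_RInt_const (V := R_NormedModule)). }
assert (0 <= Cmod w * exp (Cmod w)) by (apply Rmult_le_pos; [apply Cmod_ge_0|left; apply exp_pos]).
nra.
Qed.

(** e^w - 1 - w is the integral of (e^{tw} - 1) w over [0, 1], and e^{tw} - 1 is in turn the
    integral of w e^{sw} over [0, t]. *)
Lemma Cexp_remainder_bound (w : C) : Cmod (Cexp w - 1 - w) <= Cmod w * Cmod w * exp (Cmod w).
Proof.
assert (I : is_CRInt (fun t => (Cexp (t * w) * w - w)%C) 0 1 (Cexp (1 * w) - 1 - w)%C).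
{ apply is_CRInt_minus; [apply is_CRInt_Cexp|].
  evar_last; [apply (is_RInt_const (V := CN))|].
  apply C_ext; unfold scal; cbn; unfold mult; cbn; ring. }
rewrite Cmult_1_l in I.
assert (H : Cmod (Cexp w - 1 - w) <= (1 - 0) * (Cmod w * Cmod w * exp (Cmod w))).
{ eapply (is_CRInt_bound (fun t => (Cexp (t * w) * w - w)%C) (fun _ => Cmod w * Cmod w * exp (Cmod w)) 0 1); [lra| |exact I|].
  - intros t Ht. replace (Cexp (t * w) * w - w)%C with ((Cexp (t * w) - 1) * w)%C by ring.
    rewrite Cmod_mult. pose proof (Cexp_minus_1_bound w t Ht). pose proof (Cmod_ge_0 w). nra.
  - apply (is_RInt_const (V := R_NormedModule)). }
lra.
Qed.

Lemma exp_exp_dominated (c k : R) : 0 < c ->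
  exists K, 0 < K /\ forall x, 0 <= x -> exp (k * x - c * exp x) <= K * exp (- x).
Proof.
intros Hc. exists (exp ((k + 1) ^ 2 / c)). split; [apply exp_pos|].
intros x Hx. rewrite <- exp_plus. apply exp_le.
assert (He : x ^ 2 / 4 <= exp x).
{ replace (exp x) with (exp (x / 2) * exp (x / 2)) by (rewrite <- exp_plus; f_equal; lra).
  pose proof (exp_ineq1_le (x / 2)). assert (x / 2 <= exp (x / 2)) by lra. nra. }
(* Completing the square. This is the origin of the constant exp((k + 1)^2 / c); e^x >= x^2/4 pays
   for the quadratic term. *)
assert (Hs : (k + 1) * x <= (k + 1) ^ 2 / c + c * (x ^ 2 / 4)).
{ assert (H0 : 0 <= ((k + 1) - c * x / 2) ^ 2 / c) by (apply Rdiv_le_0_compat; [apply pow2_ge_0|lra]).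
  replace (((k + 1) - c * x / 2) ^ 2 / c) with ((k + 1) ^ 2 / c + c * (x ^ 2 / 4) - (k + 1) * x) in H0 by (field; lra).
  lra. }
nra.
Qed.

(** * Weights, differentiation factors and exponents on the contour *)

Definition tame (w : C -> C) : Prop :=
  path_continuous w /\ exists M k, forall z, on_path z -> Cmod (w z) <= M * exp (k * fst z).

(** Linear in e^{Re z}, the same order as the decay in [decaying]: a small multiple of such a factor
    can be added to an exponent without destroying its decay. *)
Definition linear_growth (d : C -> C) : Prop :=
  path_continuous d /\ exists k, 0 < k /\ forall z, on_path z -> Cmod (d z) <= k * exp (fst z).

Definition decaying (p : C -> C) : Prop :=
  path_continuous p /\ exists c B, 0 < c /\ forall z, on_path z -> fst (p z) <= B - c * exp (fst z).

Lemma on_path_ge1 (z : C) : on_path z -> 1 <= fst z.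
Proof. intros [[H _]|[H _]]; lra. Qed.

Lemma tame_mult (v w : C -> C) : tame v -> tame w -> tame (fun z => (v z * w z)%C).
Proof.
intros [Hv (M & k & HM)] [Hw (N & j & HN)]. split.
- intros z Hz. apply continuous_Cmult; [now apply Hv|now apply Hw].
- exists (M * N), (k + j). intros z Hz. rewrite Cmod_mult, Rmult_plus_distr_r, exp_plus.
  replace (M * N * (exp (k * fst z) * exp (j * fst z)))
    with ((M * exp (k * fst z)) * (N * exp (j * fst z))) by ring.
  apply Rmult_le_compat; auto using Cmod_ge_0.
Qed.

Lemma tame_linear_growth (d : C -> C) : linear_growth d -> tame d.
Proof.
intros [Hc (k & Hk & H)]. split; [exact Hc|]. exists k, 1. intros z Hz. rewrite Rmult_1_l. now apply H.
Qed.

Lemma decaying_perturb (p d : C -> C) : decaying p -> linear_growth d ->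
  exists delta, 0 < delta /\ forall s, Rabs s <= delta -> decaying (fun z => (p z + s * d z)%C).
Proof.
intros [Hp (c & B & Hc & HB)] [Hd (k & Hk & HK)].
(* With this radius the perturbation s d costs at most half of the decay rate c. *)
exists (c / (2 * k)). split; [apply Rdiv_lt_0_compat; lra|]. intros s Hs. split.
- intros z Hz. apply continuous_Cplus; [now apply Hp|].
  apply continuous_Cmult; [apply continuous_const|now apply Hd].
- exists (c / 2), B. split; [lra|]. intros z Hz.
  assert (H1 : fst (s * d z)%C <= c / 2 * exp (fst z)).
  { eapply Rle_trans; [apply fst_le_Cmod|]. rewrite Cmod_mult, Cmod_R.
    apply (Rle_trans _ (c / (2 * k) * (k * exp (fst z)))).
    - apply Rmult_le_compat; [apply Rabs_pos|apply Cmod_ge_0|exact Hs|now apply HK].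
    - right; field; lra. }
  specialize (HB z Hz). change (fst (p z) + fst (s * d z)%C <= B - c / 2 * exp (fst z)). lra.
Qed.

Lemma decaying_tame_dominated (p w : C -> C) : decaying p -> tame w ->
  path_continuous (fun z => (Cexp (p z) * w z)%C) /\
  exists K, 0 <= K /\ forall z, on_path z -> Cmod (Cexp (p z) * w z) <= K * exp (- fst z).
Proof.
intros [Hp (c & B & Hc & HB)] [Hw (M & k & HM)]. split.
- intros z Hz. apply continuous_Cmult; [apply continuous_Cexp; now apply Hp|now apply Hw].
- destruct (exp_exp_dominated c k Hc) as (K & HK0 & HK).
  exists (exp B * Rabs M * K). split.
  { apply Rmult_le_pos; [|lra]. apply Rmult_le_pos; [left; apply exp_pos|apply Rabs_pos]. }
  intros z Hz. rewrite Cmod_mult, Cmod_Cexp.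
  apply (Rle_trans _ (exp (B - c * exp (fst z)) * (Rabs M * exp (k * fst z)))).
  + apply Rmult_le_compat; [left; apply exp_pos|apply Cmod_ge_0|apply exp_le; now apply HB|].
    eapply Rle_trans; [now apply HM|]. apply Rmult_le_compat_r; [left; apply exp_pos|apply Rle_abs].
  + replace (exp (B - c * exp (fst z)) * (Rabs M * exp (k * fst z)))
      with (exp B * Rabs M * exp (k * fst z - c * exp (fst z))).
    * rewrite (Rmult_assoc _ K). apply Rmult_le_compat_l.
      { apply Rmult_le_pos; [left; apply exp_pos|apply Rabs_pos]. }
      apply HK. pose proof (on_path_ge1 z Hz). lra.
    * unfold Rminus. rewrite !exp_plus. ring.
Qed.

Lemma is_U_exp (p w : C -> C) : decaying p -> tame w ->
  is_U (fun z => (Cexp (p z) * w z)%C) (Uint (fun z => (Cexp (p z) * w z)%C)).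
Proof.
intros Hp Hw. destruct (decaying_tame_dominated p w Hp Hw) as [Hc (K & _ & HK)].
destruct (is_U_dominated _ K Hc HK) as (l & Hl & _). now rewrite (is_U_unique _ _ Hl).
Qed.

(** The remainder has the integrand e^p w (e^{hd} - 1 - hd), of modulus at most h^2 |d|^2 |w| e^{Re
    p} e^{|hd|}. Since |hd| <= (c/2) e^{Re z} for |h| <= c/(2k), the last factor uses up half of the
    decay of e^p and leaves an integrable bound independent of h. *)
Lemma Uint_exp_remainder (p d w : C -> C) : decaying p -> linear_growth d -> tame w ->
  exists K delta, 0 < delta /\ forall h, Rabs h <= delta ->
    Cmod (Uint (fun z => (Cexp (p z + h * d z) * w z)%C) - Uint (fun z => (Cexp (p z) * w z)%C)
          - h * Uint (fun z => (Cexp (p z) * (d z * w z))%C)) <= K * h ^ 2.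
Proof.
intros Hp Hd Hw.
destruct (decaying_perturb p d Hp Hd) as (delta & Hdelta & Hpert).
pose proof Hp as [Hpc (c & B & Hc & HB)]. pose proof Hd as [Hdc (k & Hk & HK)].
(* The exponent left once e^{|hd|} has been absorbed; it still decays, at rate c/2. *)
set (q := fun z : C => (p z + RtoC (c / 2 * exp (fst z)))%C).
assert (Hq : decaying q).
{ split.
  - intros z Hz. apply continuous_Cplus; [now apply Hpc|].
    apply continuous_C_pair; cbn [RtoC fst snd]; [|apply continuous_const].
    apply (continuous_mult (K := R_AbsRing) (fun _ : C => c / 2) (fun z : C => exp (fst z)));
      [apply continuous_const|].
    apply (continuous_comp (fun z : C => fst z) exp); [apply continuous_C_fst, continuous_id|].
    apply continuity_pt_filterlim, derivable_continuous, derivable_exp.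
  - exists (c / 2), B. split; [lra|]. intros z Hz. specialize (HB z Hz). cbn. lra. }
assert (Hdw : tame (fun z => (d z * w z)%C)) by (apply tame_mult; [now apply tame_linear_growth|exact Hw]).
destruct (decaying_tame_dominated q (fun z => (d z * (d z * w z))%C) Hq) as [_ (K & HK0 & HKb)].
{ apply tame_mult; [now apply tame_linear_growth|exact Hdw]. }
exists (9 * K), (Rmin delta (c / (2 * k))). split.
{ apply Rmin_glb_lt; [exact Hdelta|apply Rdiv_lt_0_compat; lra]. }
intros h Hh.
assert (Hh1 : Rabs h <= delta) by (eapply Rle_trans; [exact Hh|apply Rmin_l]).
assert (Hh2 : Rabs h <= c / (2 * k)) by (eapply Rle_trans; [exact Hh|apply Rmin_r]).
pose proof (is_U_exp _ _ (Hpert h Hh1) Hw) as U1.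
pose proof (is_U_exp _ _ Hp Hw) as U0.
pose proof (is_U_exp _ _ Hp Hdw) as U2.
set (L1 := Uint (fun z => (Cexp (p z + h * d z) * w z)%C)) in *.
set (L0 := Uint (fun z => (Cexp (p z) * w z)%C)) in *.
set (L2 := Uint (fun z => (Cexp (p z) * (d z * w z))%C)) in *.
pose proof (is_U_plus _ _ _ _ (is_U_plus _ _ _ _ U1 (is_U_mult_l (- (1)) _ _ U0)) (is_U_mult_l (- RtoC h) _ _ U2)) as U3.
set (G := fun z => (Cexp (p z) * w z * (Cexp (h * d z) - 1 - h * d z))%C).
assert (U4 : is_U G (L1 + - (1) * L0 + - RtoC h * L2)%C).
{ eapply is_U_ext; [|exact U3]. intros z Hz. unfold G. rewrite Cexp_plus. ring. }
destruct (is_U_dominated G (h ^ 2 * K)) as (l & Hl & Hlb).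
- intros z Hz. unfold G. apply continuous_Cmult.
  + apply continuous_Cmult; [apply continuous_Cexp; now apply Hpc|now apply Hw].
  + assert (Hcd : continuousCC (fun z => (h * d z)%C) z)
      by (apply continuous_Cmult; [apply continuous_const|now apply Hdc]).
    apply continuous_Cplus; [apply continuous_Cplus|]; [now apply continuous_Cexp|apply continuous_const|].
    now apply continuous_Copp.
- intros z Hz. unfold G. rewrite !Cmod_mult.
  pose proof (Cexp_remainder_bound (h * d z)%C) as Hr.
  rewrite Cmod_mult, Cmod_R in Hr.
  assert (Hx : exp (Rabs h * Cmod (d z)) <= exp (c / 2 * exp (fst z))).
  { apply exp_le. apply (Rle_trans _ (c / (2 * k) * (k * exp (fst z)))).
    - apply Rmult_le_compat; [apply Rabs_pos|apply Cmod_ge_0|exact Hh2|now apply HK].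
    - right; field; lra. }
  specialize (HKb z Hz). rewrite !Cmod_mult, Cmod_Cexp in HKb. rewrite Cmod_Cexp.
  unfold q in HKb. change (fst (p z + RtoC (c / 2 * exp (fst z)))%C) with (fst (p z) + c / 2 * exp (fst z)) in HKb.
  rewrite exp_plus in HKb.
  assert (E : Rabs h * Rabs h = h ^ 2) by (rewrite <- (pow2_abs h); ring).
  pose proof (Cmod_ge_0 (d z)). pose proof (Cmod_ge_0 (w z)). pose proof (exp_pos (fst (p z))).
  apply (Rle_trans _ (exp (fst (p z)) * Cmod (w z) * (h ^ 2 * (Cmod (d z) * Cmod (d z)) * exp (c / 2 * exp (fst z))))).
  + apply Rmult_le_compat_l; [apply Rmult_le_pos; lra|].
    eapply Rle_trans; [exact Hr|].
    replace (Rabs h * Cmod (d z) * (Rabs h * Cmod (d z))) with (h ^ 2 * (Cmod (d z) * Cmod (d z))) by (rewrite <- E; ring).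
    apply Rmult_le_compat_l; [|exact Hx]. apply Rmult_le_pos; [apply pow2_ge_0|nra].
  + replace (exp (fst (p z)) * Cmod (w z) * (h ^ 2 * (Cmod (d z) * Cmod (d z)) * exp (c / 2 * exp (fst z))))
      with (h ^ 2 * (exp (fst (p z)) * exp (c / 2 * exp (fst z)) * (Cmod (d z) * (Cmod (d z) * Cmod (w z))))) by ring.
    rewrite (Rmult_assoc (h ^ 2) K). apply Rmult_le_compat_l; [apply pow2_ge_0|exact HKb].
- replace (L1 - L0 - h * L2)%C with (L1 + - (1) * L0 + - RtoC h * L2)%C by ring.
  rewrite <- (is_U_unique _ _ U4), (is_U_unique _ _ Hl). lra.
Qed.

Notation is_Cderive := (is_derive (K := R_AbsRing) (V := CN)).

Lemma is_Cderive_spec (T : R -> C) (x : R) (l : C) :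
  is_Cderive T x l <->
  (forall eps, 0 < eps -> exists delta, 0 < delta /\ forall y : R, Rabs (y - x) < delta ->
     Cmod (T y - T x - (y - x)%R * l) <= eps * Rabs (y - x)).
Proof.
split.
- intros [_ H] eps Heps.
  destruct (H x (fun P HP => HP) (mkposreal eps Heps)) as [d Hd].
  exists d. split; [apply cond_pos|]. intros y Hy. specialize (Hd y Hy).
  rewrite norm_CN in Hd.
  match type of Hd with Cmod ?e <= _ => replace e with (T y - T x - (y - x)%R * l)%C in Hd end.
  + exact Hd.
  + apply C_ext; unfold minus, plus, opp, scal; cbn; unfold mult; cbn; ring.
- intros H. split; [apply (is_linear_scal_l (K := R_AbsRing) (V := CN))|].
  intros y Hy. apply (is_filter_lim_locally_unique (K := R_AbsRing) (V := R_NormedModule)) in Hy. subst y.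
  intros eps. destruct (H eps (cond_pos eps)) as (d & Hd & Hb).
  exists (mkposreal d Hd). intros y Hy. specialize (Hb y Hy). rewrite norm_CN.
  match goal with |- Cmod ?e <= _ => replace e with (T y - T x - (y - x)%R * l)%C end.
  + exact Hb.
  + apply C_ext; unfold minus, plus, opp, scal; cbn; unfold mult; cbn; ring.
Qed.

Lemma is_derive_quadratic (T : R -> C) (x : R) (l : C) (K delta : R) :
  0 < delta ->
  (forall h, Rabs h <= delta -> Cmod (T (x + h) - T x - h * l) <= K * h ^ 2) ->
  is_Cderive T x l.
Proof.
intros Hd H. apply is_Cderive_spec. intros eps Heps.
assert (HK : 0 < Rabs K + 1) by (pose proof (Rabs_pos K); lra).
exists (Rmin delta (eps / (Rabs K + 1))). split.
{ apply Rmin_glb_lt; [exact Hd|now apply Rdiv_lt_0_compat]. }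
intros y Hy.
pose proof (Rmin_l delta (eps / (Rabs K + 1))). pose proof (Rmin_r delta (eps / (Rabs K + 1))).
specialize (H (y - x) ltac:(lra)). rewrite Rplus_minus in H.
eapply Rle_trans; [exact H|]. rewrite <- (pow2_abs (y - x)).
assert (H2 : (Rabs K + 1) * Rabs (y - x) <= eps).
{ apply (Rle_trans _ ((Rabs K + 1) * (eps / (Rabs K + 1)))); [apply Rmult_le_compat_l; lra|right; field; lra]. }
pose proof (Rle_abs K). pose proof (Rabs_pos (y - x)). nra.
Qed.

Lemma is_derive_Uint (p d w : C -> C) (s : R) :
  decaying (fun z => (p z + s * d z)%C) -> linear_growth d -> tame w ->
  is_Cderive (fun t : R => Uint (fun z => (Cexp (p z + t * d z) * w z)%C)) s
    (Uint (fun z => (Cexp (p z + s * d z) * (d z * w z))%C)).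
Proof.
intros Hp Hd Hw. destruct (Uint_exp_remainder _ d w Hp Hd Hw) as (K & delta & Hdelta & H).
apply (is_derive_quadratic _ _ _ K delta Hdelta). intros h Hh.
replace (fun z => (Cexp (p z + (s + h)%R * d z) * w z)%C)
  with (fun z => (Cexp (p z + s * d z + h * d z) * w z)%C); [now apply H|].
extensionality z. f_equal. f_equal. rewrite RtoC_plus. ring.
Qed.

(** The first derivative has the same form with the weight d w, which is again tame, so the
    first-order result applies to it. Stability of the decay under small perturbations gives the
    neighbourhood of s on which the first derivative is known. *)
Lemma is_second_derive_Uint (p d w : C -> C) (s : R) :
  decaying (fun z => (p z + s * d z)%C) -> linear_growth d -> tame w ->
  is_second_derive (fun t : R => Uint (fun z => (Cexp (p z + t * d z) * w z)%C)) s
    (Uint (fun z => (Cexp (p z + s * d z) * (d z * (d z * w z)))%C)).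
Proof.
intros Hp Hd Hw.
exists (fun t => Uint (fun z => (Cexp (p z + t * d z) * (d z * w z))%C)). split.
- destruct (decaying_perturb _ d Hp Hd) as (delta & Hdelta & H).
  exists (mkposreal _ Hdelta). intros t Ht. apply is_derive_Uint; try assumption.
  assert (Hb : Rabs (t - s) <= delta) by (left; exact Ht).
  specialize (H (t - s) Hb).
  replace (fun z => (p z + t * d z)%C) with (fun z => (p z + s * d z + (t - s)%R * d z)%C); [exact H|].
  extensionality z. rewrite RtoC_minus. ring.
- apply is_derive_Uint; try assumption. apply tame_mult; [now apply tame_linear_growth|assumption].
Qed.

(** * Hyperbolic functions *)

Lemma C2_neq_0 : RtoC 2 <> 0%C.
Proof. intros H. apply RtoC_inj in H. lra. Qed.

Lemma Csinh_pair (x y : R) : Csinh (x, y) = (sinh x * cos y, cosh x * sin y).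
Proof.
unfold Csinh, Cexp, sinh, cosh, Cdiv. apply C_ext; cbn; rewrite cos_neg, sin_neg; field.
Qed.

Lemma Ccosh_pair (x y : R) : Ccosh (x, y) = (cosh x * cos y, sinh x * sin y).
Proof.
unfold Ccosh, Cexp, sinh, cosh, Cdiv. apply C_ext; cbn; rewrite cos_neg, sin_neg; field.
Qed.

Lemma cosh_sqr (x : R) : cosh x ^ 2 = 1 + sinh x ^ 2.
Proof.
unfold cosh, sinh. pose proof (exp_plus x (- x)) as H. rewrite Rplus_opp_r, exp_0 in H. nra.
Qed.

Lemma cosh_pos (x : R) : 0 < cosh x.
Proof. unfold cosh. pose proof (exp_pos x). pose proof (exp_pos (- x)). lra. Qed.

Lemma sinh_pos (x : R) : 0 < x -> 0 < sinh x.
Proof. intros H. rewrite <- sinh_0. now apply sinh_lt. Qed.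

Lemma sinh_neg (x : R) : sinh (- x) = - sinh x.
Proof. unfold sinh. rewrite Ropp_involutive. lra. Qed.

Lemma cosh_neg (x : R) : cosh (- x) = cosh x.
Proof. unfold cosh. rewrite Ropp_involutive. lra. Qed.

Lemma sin2_cos2_pow (x : R) : sin x ^ 2 + cos x ^ 2 = 1.
Proof. pose proof (sin2_cos2 x) as H. unfold Rsqr in H. lra. Qed.

Lemma Cmod_Csinh (x y : R) : Cmod (Csinh (x, y)) ^ 2 = sinh x ^ 2 + sin y ^ 2.
Proof.
rewrite Csinh_pair, Cmod2_alt. cbn [fst snd Re Im]. rewrite !Rpow_mult_distr, cosh_sqr.
pose proof (sin2_cos2_pow y). nra.
Qed.

Lemma Cmod_Ccosh (x y : R) : Cmod (Ccosh (x, y)) ^ 2 = sinh x ^ 2 + cos y ^ 2.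
Proof.
rewrite Ccosh_pair, Cmod2_alt. cbn [fst snd Re Im]. rewrite !Rpow_mult_distr, cosh_sqr.
pose proof (sin2_cos2_pow y). nra.
Qed.

Lemma pow2_le (a b : R) : 0 <= b -> a ^ 2 <= b ^ 2 -> a <= b.
Proof. intros. nra. Qed.

Lemma sinh_le_Cmod (x y : R) : sinh x <= Cmod (Csinh (x, y)).
Proof.
apply pow2_le; [apply Cmod_ge_0|]. rewrite Cmod_Csinh. pose proof (pow2_ge_0 (sin y)). lra.
Qed.

Lemma Cmod_Csinh_le (x y : R) : Cmod (Csinh (x, y)) <= cosh x.
Proof.
apply pow2_le; [left; apply cosh_pos|]. rewrite Cmod_Csinh, cosh_sqr.
pose proof (sin2_cos2_pow y). pose proof (pow2_ge_0 (cos y)). lra.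
Qed.

Lemma Cmod_Ccosh_le (x y : R) : Cmod (Ccosh (x, y)) <= cosh x.
Proof.
apply pow2_le; [left; apply cosh_pos|]. rewrite Cmod_Ccosh, cosh_sqr.
pose proof (sin2_cos2_pow y). pose proof (pow2_ge_0 (sin y)). lra.
Qed.

Lemma Csinh_neq_0 (x y : R) : x <> 0 \/ sin y <> 0 -> Csinh (x, y) <> 0%C.
Proof.
intros H E. pose proof (Cmod_Csinh x y) as H1. rewrite E, Cmod_0 in H1.
pose proof (pow2_ge_0 (sinh x)). pose proof (pow2_ge_0 (sin y)).
destruct H as [H|H].
- assert (sinh x <> 0).
  { destruct (Rtotal_order x 0) as [h|[h|h]]; [|lra|].
    - pose proof (sinh_lt x 0 h). rewrite sinh_0 in *. lra.
    - pose proof (sinh_pos x h). lra. }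
  assert (0 < sinh x ^ 2) by (apply pow2_gt_0; assumption). lra.
- assert (0 < sin y ^ 2) by (apply pow2_gt_0; assumption). lra.
Qed.

Lemma Csinh_opp (z : C) : Csinh (- z) = (- Csinh z)%C.
Proof. unfold Csinh. replace (- - z)%C with z by ring. unfold Cdiv. ring. Qed.

Lemma Ccosh_opp (z : C) : Ccosh (- z) = Ccosh z.
Proof. unfold Ccosh. replace (- - z)%C with z by ring. unfold Cdiv. ring. Qed.

Lemma Cinv_opp (z : C) : (/ - z)%C = (- / z)%C.
Proof.
unfold Cinv. destruct z as [a b]; cbn [fst snd Copp].
replace ((- a) ^ 2 + (- b) ^ 2) with (a ^ 2 + b ^ 2) by ring.
apply C_ext; cbn; unfold Rdiv; ring.
Qed.

Lemma Ccoth_opp (z : C) : Ccoth (- z) = (- Ccoth z)%C.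
Proof. unfold Ccoth, Cdiv. rewrite Csinh_opp, Ccosh_opp, Cinv_opp. ring. Qed.

Lemma Ccoth_shift_pi (x y : R) : Ccoth (x, y + PI) = Ccoth (x, y).
Proof.
unfold Ccoth, Cdiv. rewrite !Csinh_pair, !Ccosh_pair, neg_cos, neg_sin.
replace (sinh x * - cos y, cosh x * - sin y) with (Copp (sinh x * cos y, cosh x * sin y))
  by (apply C_ext; cbn; ring).
replace (cosh x * - cos y, sinh x * - sin y) with (Copp (cosh x * cos y, sinh x * sin y))
  by (apply C_ext; cbn; ring).
rewrite Cinv_opp. ring.
Qed.

(** sinh is odd and changes sign under translation by 3 i pi. This makes the exponential factor
    invariant under the reflection that exchanges the two halves of the contour. *)
Lemma Csinh_shift_3pi (x y : R) : Csinh (- x, - y - 3 * PI) = Csinh (x, y).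
Proof.
rewrite !Csinh_pair, sinh_neg, cosh_neg.
replace (- y - 3 * PI) with (- (y + 2 * INR 1 * PI + PI)) by (cbn; ring).
rewrite cos_neg, sin_neg, neg_cos, neg_sin, cos_period, sin_period.
apply C_ext; cbn; ring.
Qed.

(** cosh x <= sinh x + 1 for x >= 0, and |sinh(x + iy)| >= sinh x, |cosh(x + iy)| <= cosh x whatever
    the height y. *)
Lemma Ccoth_bound (q x y : R) : 0 < q -> q <= x -> Cmod (Ccoth (x, y)) <= 1 + / sinh q.
Proof.
intros Hq Hx. unfold Ccoth.
assert (Hs : 0 < sinh x) by (apply sinh_pos; lra).
rewrite Cmod_div by (apply Csinh_neq_0; left; lra).
pose proof (sinh_le_Cmod x y). pose proof (Cmod_Ccosh_le x y).
assert (H1 : cosh x <= sinh x + 1).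
{ unfold cosh, sinh. assert (exp (- x) <= 1) by (rewrite <- exp_0; apply exp_le; lra). lra. }
assert (H2 : sinh q <= sinh x) by (destruct Hx as [Hx| ->]; [left; now apply sinh_lt|lra]).
assert (H3 : 0 < sinh q) by now apply sinh_pos.
apply (Rle_trans _ ((sinh x + 1) / sinh x)).
- unfold Rdiv. apply Rmult_le_compat; [apply Cmod_ge_0|left; apply Rinv_0_lt_compat; lra|lra|].
  apply Rinv_le_contravar; lra.
- replace ((sinh x + 1) / sinh x) with (1 + / sinh x) by (field; lra).
  apply Rplus_le_compat_l, Rinv_le_contravar; lra.
Qed.

(** coth z - 1 = e^{-z} / sinh z, and |sinh z| >= sinh x >= (1 - e^{-2q}) e^x / 2. *)
Lemma Ccoth_minus_1_bound (q x y : R) : 0 < q -> q <= x ->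
  Cmod (Ccoth (x, y) - 1) <= 2 / (1 - exp (- 2 * q)) * exp (- 2 * x).
Proof.
intros Hq Hx.
assert (Hn : Csinh (x, y) <> 0%C) by (apply Csinh_neq_0; left; lra).
assert (E : (Ccoth (x, y) - 1)%C = (Cexp (- (x, y)) / Csinh (x, y))%C).
{ unfold Ccoth. replace (Ccosh (x, y)) with (Csinh (x, y) + Cexp (- (x, y)))%C
    by (unfold Csinh, Ccosh; field; exact C2_neq_0).
  field. exact Hn. }
rewrite E, Cmod_div, Cmod_Cexp by exact Hn. cbn [fst Copp].
pose proof (sinh_le_Cmod x y) as H1. pose proof (sinh_pos x ltac:(lra)) as H2.
assert (H3 : exp (- 2 * x) <= exp (- 2 * q)) by (apply exp_le; lra).
assert (H4 : exp (- 2 * q) < 1) by (rewrite <- exp_0; apply exp_increasing; lra).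
assert (H5 : exp x * (1 - exp (- 2 * q)) / 2 <= sinh x).
{ unfold sinh. replace (exp (- x)) with (exp x * exp (- 2 * x)) by (rewrite <- exp_plus; f_equal; lra).
  pose proof (exp_pos x). nra. }
pose proof (exp_pos x) as H6.
replace (2 / (1 - exp (- 2 * q)) * exp (- 2 * x)) with (exp (- x) / (exp x * (1 - exp (- 2 * q)) / 2)).
- unfold Rdiv at 1 2. apply Rmult_le_compat_l; [left; apply exp_pos|].
  apply Rinv_le_contravar; [|lra]. apply Rdiv_lt_0_compat; [|lra]. apply Rmult_lt_0_compat; lra.
- replace (exp (- 2 * x)) with (exp (- x) / exp x).
  + field. split; lra.
  + unfold Rdiv. rewrite <- exp_Ropp, <- exp_plus. f_equal. lra.
Qed.

(** This is coth(q (z - i c)) by components, with poles at i c + i (pi/q) k for integers k. [H_N] is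
    a sum of two such kernels, and imaginary translations and periods act on c alone. *)
Definition kc (q c : R) (z : C) : C := Ccoth (q * fst z, q * (snd z - c)).

Lemma H_N_kc (phi alpha : R) (z : C) :
  H_N phi alpha z = (kc (qq phi) (alpha - PI / 2) z + kc (qq phi) (3 * PI / 2 - alpha) z)%C.
Proof.
unfold H_N, kc. f_equal; f_equal; apply C_ext; cbn; field.
Qed.

Lemma analytic_on_Csinh (D : C -> Prop) (F : C -> C) :
  analytic_on D F -> analytic_on D (fun z => Csinh (F z)).
Proof.
intros H. unfold Csinh, Cdiv. apply analytic_on_mult; [|apply analytic_on_const].
apply analytic_on_minus; apply analytic_on_Cexp; [exact H|now apply analytic_on_opp].
Qed.

Lemma analytic_on_Ccosh (D : C -> Prop) (F : C -> C) :
  analytic_on D F -> analytic_on D (fun z => Ccosh (F z)).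
Proof.
intros H. unfold Ccosh, Cdiv. apply analytic_on_mult; [|apply analytic_on_const].
apply analytic_on_plus; apply analytic_on_Cexp; [exact H|now apply analytic_on_opp].
Qed.

Lemma analytic_on_affine (D : C -> Prop) (q c : R) :
  analytic_on D (fun z => (q * fst z, q * (snd z - c))).
Proof.
apply (analytic_on_ext _ (fun z => (q * (z + (0, - c)%R))%C)).
- intros z. apply C_ext; cbn; ring.
- apply analytic_on_mult; [apply analytic_on_const|].
  apply analytic_on_plus; [apply analytic_on_id|apply analytic_on_const].
Qed.

Lemma analytic_on_kc (D : C -> Prop) (q c : R) :
  (forall z, D z -> q * fst z <> 0 \/ sin (q * (snd z - c)) <> 0) ->
  analytic_on D (kc q c).
Proof.
intros H. unfold kc, Ccoth, Cdiv. apply analytic_on_mult.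
- apply analytic_on_Ccosh, analytic_on_affine.
- apply analytic_on_inv; [apply analytic_on_Csinh, analytic_on_affine|].
  intros z Hz. apply Csinh_neq_0, H, Hz.
Qed.

Lemma kc_bound (q c : R) (z : C) : 0 < q -> 1 <= fst z -> Cmod (kc q c z) <= 1 + / sinh q.
Proof. intros Hq Hz. apply Ccoth_bound; [exact Hq|nra]. Qed.

Lemma kc_opp (q c : R) (z : C) : kc q c (- z) = (- kc q (- c) z)%C.
Proof.
unfold kc. rewrite <- Ccoth_opp. f_equal. apply C_ext; cbn; ring.
Qed.

Lemma kc_translate (q c d x y : R) : kc q c (x, y + d) = kc q (c - d) (x, y).
Proof. unfold kc. cbn [fst snd]. do 2 f_equal. ring. Qed.

Lemma kc_period (q c p : R) (z : C) : q * p = PI -> kc q (c + p) z = kc q c z.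
Proof.
intros H. unfold kc. rewrite <- (Ccoth_shift_pi _ (q * (snd z - (c + p)))). do 2 f_equal.
rewrite <- H. ring.
Qed.

(** * Residues *)

(** Counterclockwise. *)
Definition boundary_int (F : C -> C) (a b c d : R) : C :=
  (CRInt (fun x => F (x, c)) a b - CRInt (fun x => F (x, d)) a b
   + Ci * (CRInt (fun y => F (b, y)) c d - CRInt (fun y => F (a, y)) c d))%C.

(** The puncture is on the imaginary axis, where all the poles of [kc] lie. *)
Definition punctured_rect (b0 c0 d0 a : R) (z : C) : Prop :=
  open_rect (- b0) b0 c0 d0 z /\ (fst z <> 0 \/ snd z <> a).

Lemma CRInt_Chasles (f : R -> C) (a b c : R) :
  ex_CRInt f a b -> ex_CRInt f b c -> CRInt f a c = (CRInt f a b + CRInt f b c)%C.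
Proof.
intros H1 H2. apply is_CRInt_unique. apply (is_CRInt_Chasles f a b c); now apply CRInt_correct.
Qed.

(** The region between the two boundaries is cut into four rectangles that avoid the puncture: left
    and right columns of full height and, between them, the pieces below and above the small
    square. *)
Lemma boundary_int_shrink (F : C -> C) (b0 b c0 c d d0 a e : R) :
  b < b0 -> c0 < c -> d < d0 -> 0 < e -> e <= b -> c <= a - e -> a + e <= d ->
  analytic_on (punctured_rect b0 c0 d0 a) F ->
  boundary_int F (- b) b c d = boundary_int F (- e) e (a - e) (a + e).
Proof.
intros Hb Hc Hd He Heb Hca Had HF.
assert (Hx : forall y u v, c <= y <= d -> - b <= u -> u <= v -> v <= b ->
  (y <> a \/ 0 < u \/ v < 0) -> ex_CRInt (fun x => F (x, y)) u v).
{ intros y u v Hy Hu Huv Hv Hn. apply ex_CRInt_on; [lra|]. intros x Hx.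
  apply continuous_horizontal, (analytic_on_continuous _ _ _ HF). split; [split; cbn; lra|].
  cbn. destruct Hn as [Hn|[Hn|Hn]]; [now right|left; lra|left; lra]. }
assert (Hy : forall x u v, - b <= x <= b -> c <= u -> u <= v -> v <= d -> x <> 0 ->
  ex_CRInt (fun y => F (x, y)) u v).
{ intros x u v Hx' Hu Huv Hv Hn. apply ex_CRInt_on; [lra|]. intros y Hy.
  apply continuous_vertical, (analytic_on_continuous _ _ _ HF). split; [split; cbn; lra|now left]. }
assert (L := cauchy_rectangle F (- b0) (- b) (- e) 0 c0 c d d0 ltac:(lra) ltac:(lra) ltac:(lra) Hc ltac:(lra) Hd).
assert (R := cauchy_rectangle F 0 e b b0 c0 c d d0 ltac:(lra) ltac:(lra) ltac:(lra) Hc ltac:(lra) Hd).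
assert (T := cauchy_rectangle F (- b0) (- e) e b0 a (a + e) d d0 ltac:(lra) ltac:(lra) ltac:(lra) ltac:(lra) ltac:(lra) Hd).
assert (B := cauchy_rectangle F (- b0) (- e) e b0 c0 c (a - e) a ltac:(lra) ltac:(lra) ltac:(lra) Hc ltac:(lra) ltac:(lra)).
specialize (L ltac:(eapply analytic_on_subset; [|exact HF]; intros z [H1 H2]; split; [split; lra|left; lra])).
specialize (R ltac:(eapply analytic_on_subset; [|exact HF]; intros z [H1 H2]; split; [split; lra|left; lra])).
specialize (T ltac:(eapply analytic_on_subset; [|exact HF]; intros z [H1 H2]; split; [split; lra|right; lra])).
specialize (B ltac:(eapply analytic_on_subset; [|exact HF]; intros z [H1 H2]; split; [split; lra|right; lra])).
unfold boundary_int.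
assert (Sx : forall y, (y = c \/ y = d) -> CRInt (fun x => F (x, y)) (- b) b =
  (CRInt (fun x => F (x, y)) (- b) (- e) + (CRInt (fun x => F (x, y)) (- e) e + CRInt (fun x => F (x, y)) e b))%C).
{ intros y Hyy. rewrite (CRInt_Chasles _ (- b) (- e) b), (CRInt_Chasles _ (- e) e b); [reflexivity| | | |];
    apply Hx; try (destruct Hyy; lra). }
assert (Sy : forall x, (x = - e \/ x = e) -> CRInt (fun y => F (x, y)) c d =
  (CRInt (fun y => F (x, y)) c (a - e) + (CRInt (fun y => F (x, y)) (a - e) (a + e) + CRInt (fun y => F (x, y)) (a + e) d))%C).
{ intros x Hxx. rewrite (CRInt_Chasles _ c (a - e) d), (CRInt_Chasles _ (a - e) (a + e) d); [reflexivity| | | |];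
    apply Hy; try (destruct Hxx; lra). }
rewrite (Sx c), (Sx d) by tauto.
rewrite (Sy (- e)) in L by tauto. rewrite (Sy e) in R by tauto.
set (x1 := CRInt (fun x => F (x, d)) (- b) (- e)) in *. set (x2 := CRInt (fun x => F (x, c)) (- b) (- e)) in *.
set (x3 := CRInt (fun x => F (x, d)) e b) in *. set (x4 := CRInt (fun x => F (x, c)) e b) in *.
set (x5 := CRInt (fun x => F (x, d)) (- e) e) in *. set (x6 := CRInt (fun x => F (x, c)) (- e) e) in *.
set (x7 := CRInt (fun x => F (x, a - e)) (- e) e) in *. set (x8 := CRInt (fun x => F (x, a + e)) (- e) e) in *.
clearbody x1 x2 x3 x4 x5 x6 x7 x8.
assert (E1 : x1 = (x2 + (x1 - x2))%C) by ring. rewrite L in E1.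
assert (E3 : x3 = (x4 + (x3 - x4))%C) by ring. rewrite R in E3.
assert (E5 : x5 = (x8 + (x5 - x8))%C) by ring. rewrite T in E5.
assert (E6 : x7 = (x6 + (x7 - x6))%C) by ring. rewrite B in E6.
rewrite E1, E3, E5, E6. ring.
Qed.

Lemma sqr_plus_sqr_pos (t e : R) : 0 < e -> 0 < t ^ 2 + e ^ 2.
Proof. intros He. pose proof (pow2_ge_0 t). pose proof (pow_lt e 2 He). lra. Qed.

(** Together with [is_RInt_odd_kernel], this gives the two parts of 1/z on a side of the square of
    half-side e: each side contributes an angle pi/2, and the four of them 2 pi. *)
Lemma is_RInt_atan_kernel (a e : R) : 0 < e ->
  is_RInt (fun t => e / ((t - a) ^ 2 + e ^ 2)) (a - e) (a + e) (PI / 2).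
Proof.
intros He.
assert (E : PI / 2 = minus (atan ((a + e - a) / e)) (atan ((a - e - a) / e))).
{ unfold minus, plus, opp; cbn.
  replace ((a + e - a) / e) with 1 by (field; lra). replace ((a - e - a) / e) with (-1) by (field; lra).
  replace (atan (-1)) with (- atan 1) by (rewrite <- atan_opp; reflexivity). rewrite atan_1. lra. }
rewrite E.
apply (is_RInt_derive (V := R_CompleteNormedModule) (fun t => atan ((t - a) / e))).
- intros t _. pose proof (sqr_plus_sqr_pos (t - a) e He).
  auto_derive; [trivial|]. unfold Rsqr. field. split; [|lra]. nra.
- intros t _. apply (ex_derive_continuous (V := R_NormedModule)). auto_derive.
  pose proof (sqr_plus_sqr_pos (t + - a) e He) as H. cbn in H. lra.
Qed.

Lemma is_RInt_odd_kernel (a e : R) : 0 < e ->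
  is_RInt (fun t => (t - a) / ((t - a) ^ 2 + e ^ 2)) (a - e) (a + e) 0.
Proof.
intros He.
assert (E : 0 = minus (ln ((a + e - a) ^ 2 + e ^ 2) / 2) (ln ((a - e - a) ^ 2 + e ^ 2) / 2)).
{ unfold minus, plus, opp; cbn [AbelianMonoid.plus]. cbn -[pow].
  replace ((a + e - a) ^ 2 + e ^ 2) with (2 * e ^ 2) by ring.
  replace ((a - e - a) ^ 2 + e ^ 2) with (2 * e ^ 2) by ring. ring. }
rewrite E.
apply (is_RInt_derive (V := R_CompleteNormedModule) (fun t => ln ((t - a) ^ 2 + e ^ 2) / 2)).
- intros t _. pose proof (sqr_plus_sqr_pos (t - a) e He).
  auto_derive; [nra|]. field. nra.
- intros t _. apply (ex_derive_continuous (V := R_NormedModule)). auto_derive.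
  pose proof (sqr_plus_sqr_pos (t + - a) e He) as H. cbn in H. lra.
Qed.

Lemma is_CRInt_horizontal_inv (e s : R) : 0 < e -> s = e \/ s = - e ->
  is_CRInt (fun x => (/ (x, s))%C) (- e) e (0, - (s / e) * (PI / 2))%R.
Proof.
intros He Hs.
pose proof (is_RInt_atan_kernel 0 e He) as H1. pose proof (is_RInt_odd_kernel 0 e He) as H2.
rewrite Rminus_0_l, Rplus_0_l in H1, H2.
apply is_CRInt_pair; cbn [fst snd Cinv].
- eapply is_RInt_ext; [|exact H2]. intros x _. cbv beta. rewrite Rminus_0_r. destruct Hs as [-> | ->]; [reflexivity|].
  now replace ((- e) ^ 2) with (e ^ 2) by ring.
- eapply is_RInt_ext; [|exact (is_RInt_scal (V := R_NormedModule) _ _ _ (- (s / e)) _ H1)].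
  intros x _. unfold scal; cbn -[pow Rminus]; unfold mult; cbn -[pow Rminus]. rewrite Rminus_0_r.
  pose proof (sqr_plus_sqr_pos x e He).
  destruct Hs as [-> | ->]; field; nra.
Qed.

Lemma is_CRInt_vertical_inv (a e s : R) : 0 < e -> s = e \/ s = - e ->
  is_CRInt (fun y => (/ (s, y - a)%R)%C) (a - e) (a + e) (s / e * (PI / 2), 0).
Proof.
intros He Hs.
pose proof (is_RInt_atan_kernel a e He) as H1. pose proof (is_RInt_odd_kernel a e He) as H2.
apply is_CRInt_pair; cbn [fst snd Cinv].
- eapply is_RInt_ext; [|exact (is_RInt_scal (V := R_NormedModule) _ _ _ (s / e) _ H1)].
  intros x _. unfold scal; cbn -[pow]; unfold mult; cbn -[pow].
  pose proof (sqr_plus_sqr_pos (x - a) e He).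
  destruct Hs as [-> | ->]; field; nra.
- pose proof (is_RInt_opp (V := R_NormedModule) _ _ _ _ H2) as H3.
  evar_last; [eapply is_RInt_ext; [|exact H3]|unfold opp; cbn; ring].
  intros x _. cbv beta. unfold opp; cbn -[pow Rminus]. pose proof (sqr_plus_sqr_pos (x - a) e He).
  destruct Hs as [-> | ->]; field; nra.
Qed.

Lemma is_CRInt_bound_const (f : R -> C) (a b M : R) (l : C) :
  a <= b -> (forall x, a <= x <= b -> Cmod (f x) <= M) -> is_CRInt f a b l -> Cmod l <= (b - a) * M.
Proof.
intros Hab H I. apply (is_CRInt_bound f (fun _ => M) a b l _ Hab H I).
apply (is_RInt_const (V := R_NormedModule)).
Qed.

(** Boundedness of F minus its principal part is enough: on the square of half-side m around the
    puncture the principal part gives exactly 2 pi i r, and the rest at most 8 m B, perimeter times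
    bound, which vanishes with m. *)
Lemma residue_rectangle (F : C -> C) (b0 b c0 c d d0 a B r0 : R) (r : C) :
  0 < b -> b < b0 -> c0 < c -> c < a -> a < d -> d < d0 -> 0 < r0 ->
  analytic_on (punctured_rect b0 c0 d0 a) F ->
  (forall x y, Rabs x <= r0 -> Rabs (y - a) <= r0 -> (x <> 0 \/ y <> a) ->
     Cmod (F (x, y) - r * / (x, y - a)%R) <= B) ->
  boundary_int F (- b) b c d = (2 * PI * Ci * r)%C.
Proof.
intros Hb Hb0 Hc Hca Had Hd Hr0 HF HB.
assert (Hz : (boundary_int F (- b) b c d - 2 * PI * Ci * r)%C = RtoC 0).
{ apply Cmod_eq_0, Rle_antisym; [|apply Cmod_ge_0].
  apply Rle_plus_epsilon. intros eps Heps. rewrite Rplus_0_l.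
  set (m := Rmin (Rmin b r0) (Rmin (Rmin (a - c) (d - a)) (eps / (8 * (Rabs B + 1))))).
  assert (HB1 : 0 < Rabs B + 1) by (pose proof (Rabs_pos B); lra).
  assert (Hm : 0 < m).
  { unfold m. repeat apply Rmin_glb_lt; try lra. apply Rdiv_lt_0_compat; lra. }
  assert (Hm1 : m <= Rmin b r0) by apply Rmin_l.
  assert (Hm2 : m <= Rmin (Rmin (a - c) (d - a)) (eps / (8 * (Rabs B + 1)))) by apply Rmin_r.
  pose proof (Rmin_l b r0). pose proof (Rmin_r b r0).
  pose proof (Rmin_l (Rmin (a - c) (d - a)) (eps / (8 * (Rabs B + 1)))).
  pose proof (Rmin_r (Rmin (a - c) (d - a)) (eps / (8 * (Rabs B + 1)))).
  pose proof (Rmin_l (a - c) (d - a)). pose proof (Rmin_r (a - c) (d - a)).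
  rewrite (boundary_int_shrink F b0 b c0 c d d0 a m); try lra; [|exact HF].
  assert (Hh : forall s, s = m \/ s = - m ->
    Cmod (CRInt (fun x => F (x, a + s)) (- m) m - r * (0, - (s / m) * (PI / 2))%R) <= 2 * m * B).
  { intros s Hs. replace (2 * m * B) with ((m - - m) * B) by ring.
    apply (is_CRInt_bound_const (fun x => (F (x, a + s)%R - r * / (x, s)%R)%C)); [lra| |].
    - intros x Hx. replace s with (a + s - a) at 2 by ring. apply HB.
      + apply Rabs_le; lra.
      + replace (a + s - a) with s by ring. apply Rabs_le; destruct Hs; lra.
      + right. destruct Hs; lra.
    - apply is_CRInt_minus; [|apply is_CRInt_mult_l, is_CRInt_horizontal_inv; assumption].
      apply CRInt_correct, ex_CRInt_on; [lra|]. intros x Hx.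
      apply continuous_horizontal, (analytic_on_continuous _ _ _ HF).
      split; [split; cbn; destruct Hs; lra|right; cbn; destruct Hs; lra]. }
  assert (Hv : forall s, s = m \/ s = - m ->
    Cmod (CRInt (fun y => F (s, y)) (a - m) (a + m) - r * (s / m * (PI / 2), 0)%R) <= 2 * m * B).
  { intros s Hs. replace (2 * m * B) with ((a + m - (a - m)) * B) by ring.
    apply (is_CRInt_bound_const (fun y => (F (s, y) - r * / (s, y - a)%R)%C)); [lra| |].
    - intros y Hy. apply HB; [apply Rabs_le; destruct Hs; lra|apply Rabs_le; lra|left; destruct Hs; lra].
    - apply is_CRInt_minus; [|apply is_CRInt_mult_l, is_CRInt_vertical_inv; assumption].
      apply CRInt_correct, ex_CRInt_on; [lra|]. intros y Hy.
      apply continuous_vertical, (analytic_on_continuous _ _ _ HF).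
      split; [split; cbn; destruct Hs; lra|left; cbn; destruct Hs; lra]. }
  pose proof (Hh (- m) (or_intror eq_refl)) as E1. pose proof (Hh m (or_introl eq_refl)) as E2.
  pose proof (Hv (- m) (or_intror eq_refl)) as E3. pose proof (Hv m (or_introl eq_refl)) as E4.
  change (a + - m) with (a - m) in E1. unfold boundary_int.
  set (i1 := CRInt (fun x => F (x, a - m)) (- m) m) in *. set (i2 := CRInt (fun x => F (x, a + m)) (- m) m) in *.
  set (i3 := CRInt (fun y => F (- m, y)) (a - m) (a + m)) in *. set (i4 := CRInt (fun y => F (m, y)) (a - m) (a + m)) in *.
  assert (Q1 : m / m = 1) by (field; lra). assert (Q2 : - m / m = -1) by (field; lra).
  rewrite Q2 in E1, E3. rewrite Q1 in E2, E4.
  replace (i1 - i2 + Ci * (i4 - i3) - 2 * PI * Ci * r)%C with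
    ((i1 - r * (0, - (-1) * (PI / 2))%R) + (- (i2 - r * (0, - (1) * (PI / 2))%R)
     + Ci * ((i4 - r * (1 * (PI / 2), 0)%R) + - (i3 - r * (-1 * (PI / 2), 0)%R))))%C.
  - eapply Rle_trans; [apply Cmod_triangle|].
    eapply Rle_trans; [apply Rplus_le_compat_l, Cmod_triangle|].
    rewrite Cmod_mult, Cmod_Ci, Rmult_1_l, Cmod_opp.
    eapply Rle_trans; [apply Rplus_le_compat_l, Rplus_le_compat_l, Cmod_triangle|].
    rewrite Cmod_opp.
    assert (HmB : m * (8 * B) <= eps).
    { assert (8 * B <= 8 * (Rabs B + 1)) by (pose proof (Rle_abs B); lra).
      apply (Rle_trans _ (eps / (8 * (Rabs B + 1)) * (8 * (Rabs B + 1)))); [nra|right; field; lra]. }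
    lra.
  - destruct r as [r1 r2], i1, i2, i3, i4. apply C_ext; cbn; field. }
replace (boundary_int F (- b) b c d) with (boundary_int F (- b) b c d - 2 * PI * Ci * r + 2 * PI * Ci * r)%C by ring.
rewrite Hz. ring.
Qed.

(** * The simple poles of the coth kernel *)

Lemma derC_increment_bound (f df : R -> C) (a b M : R) :
  (forall x, Rmin a b <= x <= Rmax a b -> derC f x (df x)) ->
  (forall x, Rmin a b <= x <= Rmax a b -> continuousRC df x) ->
  (forall x, Rmin a b <= x <= Rmax a b -> Cmod (df x) <= M) ->
  Cmod (f b - f a) <= M * Rabs (b - a).
Proof.
intros H1 H2 H3. pose proof (is_CRInt_derC f df a b H1 H2) as I.
destruct (Rle_dec a b) as [Hab|Hab].
- rewrite Rmin_left, Rmax_right in H3 by lra.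
  rewrite Rabs_pos_eq, Rmult_comm by lra. now apply (is_CRInt_bound_const df).
- rewrite Rmin_right, Rmax_left in H3 by lra.
  apply is_CRInt_swap in I. rewrite <- Cmod_opp, Rabs_left, Rmult_comm by lra.
  replace (- (b - a)) with (a - b) by ring. apply (is_CRInt_bound_const df); [lra|exact H3|exact I].
Qed.

Lemma Rabs_between (a b x e : R) : Rmin a b <= x <= Rmax a b -> Rabs (b - a) <= e -> Rabs (x - a) <= e.
Proof.
intros Hx He. apply Rabs_le. apply Rabs_le_between in He.
destruct (Rle_dec a b).
- rewrite Rmin_left, Rmax_right in Hx by lra. lra.
- rewrite Rmin_right, Rmax_left in Hx by lra. lra.
Qed.

(** The path goes along Re z = 0 and then horizontally, so that only partial derivatives are
    integrated; continuity of [dN] at the point bounds them nearby. *)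
Lemma analytic_lipschitz_at (N : C -> C) (a : R) :
  analytic_on (fun _ => True) N ->
  exists M e, 0 <= M /\ 0 < e /\ forall x y, Rabs x <= e -> Rabs (y - a) <= e ->
    Cmod (N (x, y) - N (0, a)) <= M * (Rabs x + Rabs (y - a)).
Proof.
intros [dN H].
destruct (H 0 a I) as (_ & _ & _ & Hc).
destruct (proj1 (filterlim_C_Cmod _ _ _ _ _) Hc 1 ltac:(lra)) as [e He].
assert (Hb : forall x y, Rabs x < e -> Rabs (y - a) < e -> Cmod (dN (x, y)) <= Cmod (dN (0, a)) + 1).
{ intros x y Hx Hy. eapply Rle_trans; [apply (Cmod_minus_le _ (dN (0, a)))|].
  apply Rplus_le_compat_l. left. apply He. split; [|exact Hy].
  change (Rabs (x - 0) < e). now rewrite Rminus_0_r. }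
pose proof (cond_pos e) as He0.
exists (Cmod (dN (0, a)) + 1), (e / 2). pose proof (Cmod_ge_0 (dN (0, a))). split; [lra|split; [lra|]].
intros x y Hx Hy.
assert (H1 : Cmod (N (x, y) - N (0, y)) <= (Cmod (dN (0, a)) + 1) * Rabs (x - 0)).
{ apply (derC_increment_bound (fun s => N (s, y)) (fun s => dN (s, y))).
  - intros s _. apply (H s y I).
  - intros s _. apply continuous_horizontal. apply (H s y I).
  - intros s Hs. apply Hb; [|lra]. rewrite <- (Rminus_0_r s).
    apply (Rle_lt_trans _ (e / 2)); [|lra]. apply (Rabs_between 0 x); [exact Hs|]. now rewrite Rminus_0_r. }
assert (H2 : Cmod (N (0, y) - N (0, a)) <= (Cmod (dN (0, a)) + 1) * Rabs (y - a)).
{ apply (derC_increment_bound (fun s => N (0, s)) (fun s => (Ci * dN (0%R, s))%C)).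
  - intros s _. apply (H 0 s I).
  - intros s _. apply continuous_Cmult; [apply continuous_const|]. apply continuous_vertical. apply (H 0 s I).
  - intros s Hs. rewrite Cmod_mult, Cmod_Ci, Rmult_1_l. apply Hb; [rewrite Rabs_R0; lra|].
    apply (Rle_lt_trans _ (e / 2)); [|lra]. now apply (Rabs_between a y). }
rewrite Rminus_0_r in H1.
replace (N (x, y) - N (0, a))%C with ((N (x, y) - N (0, y)) + (N (0, y) - N (0, a)))%C by ring.
eapply Rle_trans; [apply Cmod_triangle|]. lra.
Qed.

Lemma Rabs_fst_le_Cmod (z : C) : Rabs (fst z) <= Cmod z.
Proof. eapply Rle_trans; [|apply Rmax_Cmod]. apply Rmax_l. Qed.

Lemma Rabs_snd_le_Cmod (z : C) : Rabs (snd z) <= Cmod z.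
Proof. eapply Rle_trans; [|apply Rmax_Cmod]. apply Rmax_r. Qed.

Lemma Cmod_le_Rabs (z : C) : Cmod z <= Rabs (fst z) + Rabs (snd z).
Proof.
destruct z as [x y]. replace (x, y) with (RtoC x + Ci * RtoC y)%C by (apply C_ext; cbn; ring).
eapply Rle_trans; [apply Cmod_triangle|]. rewrite Cmod_mult, Cmod_Ci, !Cmod_R. cbn [fst snd].
right. f_equal; [f_equal|rewrite Rmult_1_l; f_equal]; cbn; ring.
Qed.

(** sinh w - w is half the difference of the Taylor remainders of exp at w and at - w. For |w| <=
    1/8 this quadratic error is below |w|/2, hence the lower bound. *)
Lemma Csinh_linear_bound (w : C) : Cmod w <= 1 / 8 ->
  Cmod (Csinh w - w) <= 2 * Cmod w ^ 2 /\ Cmod w / 2 <= Cmod (Csinh w).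
Proof.
intros Hw.
assert (H : Cmod (Csinh w - w) <= 2 * Cmod w ^ 2).
{ replace (Csinh w - w)%C with (/ 2 * ((Cexp w - 1 - w) + - (Cexp (- w) - 1 - - w)))%C
    by (unfold Csinh; field; exact C2_neq_0).
  rewrite Cmod_mult, Cmod_inv by exact C2_neq_0. rewrite Cmod_R, Rabs_pos_eq by lra.
  pose proof (Cexp_remainder_bound w) as H1. pose proof (Cexp_remainder_bound (- w)) as H2.
  rewrite Cmod_opp in H2.
  assert (He : exp (Cmod w) <= 2).
  { apply (Rle_trans _ (exp (1 / 8))); [apply exp_le; lra|].
    pose proof (exp_ineq1_le (- (1 / 8))) as H3. rewrite exp_Ropp in H3.
    pose proof (exp_pos (1 / 8)). apply (Rmult_le_compat_r (exp (1 / 8))) in H3; [|lra].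
    rewrite Rinv_l in H3 by lra. lra. }
  pose proof (Cmod_triangle (Cexp w - 1 - w) (- (Cexp (- w) - 1 - - w))) as H4.
  rewrite Cmod_opp in H4. pose proof (Cmod_ge_0 w).
  assert (Cmod w * Cmod w * exp (Cmod w) <= Cmod w * Cmod w * 2) by (apply Rmult_le_compat_l; nra).
  cbn [pow]. lra. }
split; [exact H|].
pose proof (Cmod_minus_le w (Csinh w)) as H1. rewrite Cmod_minus_sym in H1.
pose proof (Cmod_ge_0 w). nra.
Qed.

(** With w = z - i a, e = E(i a) and N = E cosh(q w), the difference equals ((N - e) q w - e (sinh(q
    w) - q w)) / (q w sinh(q w)). The numerator is O(|w|^2), by the Lipschitz estimate for N and the
    expansion of sinh; the denominator is at least |q w|^2 / 2. The radius 1/(16 q) ensures |q w| <=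
    1/8. *)
Lemma kc_simple_pole (E : C -> C) (q a : R) :
  0 < q -> analytic_on (fun _ => True) E ->
  exists B r0, 0 < r0 /\ forall x y, Rabs x <= r0 -> Rabs (y - a) <= r0 -> (x <> 0 \/ y <> a) ->
    Cmod (E (x, y) * kc q a (x, y) - E (0, a)%R / q * / (x, y - a)%R) <= B.
Proof.
intros Hq HE.
set (N := fun z => (E z * Ccosh (q * fst z, q * (snd z - a))%R)%C).
assert (HN : analytic_on (fun _ => True) N).
{ apply analytic_on_mult; [exact HE|]. apply analytic_on_Ccosh, analytic_on_affine. }
destruct (analytic_lipschitz_at N a HN) as (M & e & HM & He & HL).
assert (HN0 : N (0, a) = E (0, a)).
{ unfold N. cbn [fst snd]. replace (q * 0) with 0 by ring. replace (q * (a - a)) with 0 by ring.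
  rewrite Ccosh_pair. unfold cosh, sinh. rewrite Ropp_0, exp_0, cos_0, sin_0.
  replace ((1 + 1) / 2 * 1, (1 - 1) / 2 * 0) with (RtoC 1) by (apply C_ext; cbn; field). ring. }
exists (4 * M / q + 4 * Cmod (E (0, a))), (Rmin e (1 / (16 * q))). split.
{ apply Rmin_glb_lt; [exact He|apply Rdiv_lt_0_compat; lra]. }
intros x y Hx Hy Hn.
assert (Hx1 : Rabs x <= e) by (eapply Rle_trans; [exact Hx|apply Rmin_l]).
assert (Hy1 : Rabs (y - a) <= e) by (eapply Rle_trans; [exact Hy|apply Rmin_l]).
assert (Hx2 : Rabs x <= 1 / (16 * q)) by (eapply Rle_trans; [exact Hx|apply Rmin_r]).
assert (Hy2 : Rabs (y - a) <= 1 / (16 * q)) by (eapply Rle_trans; [exact Hy|apply Rmin_r]).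
specialize (HL x y Hx1 Hy1). rewrite HN0 in HL.
set (w := (x, y - a) : C).
assert (Hw0 : w <> 0%C).
{ intros Hw. injection Hw. intros. destruct Hn; lra. }
assert (Hwpos : 0 < Cmod w) by now apply Cmod_gt_0.
pose proof (Rabs_fst_le_Cmod w) as W1. pose proof (Rabs_snd_le_Cmod w) as W2.
pose proof (Cmod_le_Rabs w) as W3. cbn [fst snd w] in W1, W2, W3.
assert (Eqw : (q * x, q * (y - a)) = (q * w)%C) by (apply C_ext; cbn; ring).
assert (Hqw : Cmod (q * w) = q * Cmod w) by (rewrite Cmod_mult, Cmod_R, Rabs_pos_eq; lra).
assert (Hsmall : Cmod (q * w) <= 1 / 8).
{ rewrite Hqw. apply (Rle_trans _ (q * (1 / (16 * q) + 1 / (16 * q)))); [|right; field; lra].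
  apply Rmult_le_compat_l; lra. }
destruct (Csinh_linear_bound _ Hsmall) as [S1 S2]. rewrite Hqw in S1, S2.
assert (Hsn : Csinh (q * w) <> 0%C) by (apply Cmod_gt_0; nra).
assert (Hq0 : RtoC q <> 0%C) by (intros H; apply RtoC_inj in H; lra).
replace (E (x, y) * kc q a (x, y) - E (0, a)%R / q * / w)%C with
  (((N (x, y) - E (0, a)%R) * (q * w) + - (E (0, a)%R * (Csinh (q * w) - q * w))) / ((q * w) * Csinh (q * w)))%C.
2:{ unfold kc, Ccoth, N. cbn [fst snd]. rewrite Eqw. field. auto. }
assert (Hprod : ((q * w) * Csinh (q * w))%C <> 0%C).
{ apply Cmult_neq_0; [apply Cmult_neq_0|]; assumption. }
rewrite Cmod_div, (Cmod_mult (q * w)), Hqw by exact Hprod.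
assert (Hwq : 0 < q * Cmod w) by (apply Rmult_lt_0_compat; lra).
assert (Hdp : 0 < q * Cmod w * Cmod (Csinh (q * w))).
{ apply Rmult_lt_0_compat; [exact Hwq|lra]. }
assert (Hden : q ^ 2 * Cmod w ^ 2 / 2 <= q * Cmod w * Cmod (Csinh (q * w))) by nra.
assert (Hnum : Cmod ((N (x, y) - E (0, a)%R) * (q * w) + - (E (0, a)%R * (Csinh (q * w) - q * w)))
   <= (4 * M / q + 4 * Cmod (E (0, a))) * (q ^ 2 * Cmod w ^ 2 / 2)).
{ eapply Rle_trans; [apply Cmod_triangle|]. rewrite Cmod_opp, !(Cmod_mult (_ - _)), Hqw, (Cmod_mult (E (0, a))).
  assert (A1 : Cmod (N (x, y) - E (0, a)) * (q * Cmod w) <= M * (2 * Cmod w) * (q * Cmod w)).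
  { apply Rmult_le_compat_r; [nra|]. eapply Rle_trans; [exact HL|]. apply Rmult_le_compat_l; lra. }
  assert (A2 : Cmod (E (0, a)) * Cmod (Csinh (q * w) - q * w) <= Cmod (E (0, a)) * (2 * (q * Cmod w) ^ 2)).
  { apply Rmult_le_compat_l; [apply Cmod_ge_0|exact S1]. }
  replace ((4 * M / q + 4 * Cmod (E (0, a))) * (q ^ 2 * Cmod w ^ 2 / 2))
    with (M * (2 * Cmod w) * (q * Cmod w) + Cmod (E (0, a)) * (2 * (q * Cmod w) ^ 2)) by (field; lra).
  lra. }
apply (Rmult_le_reg_r (q * Cmod w * Cmod (Csinh (q * w)))); [exact Hdp|].
unfold Rdiv at 1. rewrite Rmult_assoc, Rinv_l, Rmult_1_r by lra.
eapply Rle_trans; [exact Hnum|]. apply Rmult_le_compat_l; [|exact Hden].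
pose proof (Cmod_ge_0 (E (0, a))). assert (0 <= 4 * M / q) by (apply Rdiv_le_0_compat; lra). lra.
Qed.

Lemma sin_neq_0_small (t : R) : - PI < t < PI -> t <> 0 -> sin t <> 0.
Proof.
intros Ht Hn. destruct (Rtotal_order t 0) as [H|[H|H]]; [|lra|].
- pose proof (sin_gt_0 (- t) ltac:(lra) ltac:(lra)) as H1. rewrite sin_neg in H1. lra.
- pose proof (sin_gt_0 t ltac:(lra) ltac:(lra)). lra.
Qed.

(** The rectangle is lower than pi/q, the distance between consecutive poles, so i a is the only
    pole in it. *)
Lemma boundary_int_kc_pole (E : C -> C) (q a b c d : R) :
  0 < q -> 0 < b -> c < a -> a < d -> q * (d - c) < PI -> analytic_on (fun _ => True) E ->
  boundary_int (fun z => (E z * kc q a z)%C) (- b) b c d = (2 * PI * Ci * (E (0, a)%R / q))%C.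
Proof.
intros Hq Hb Hc Hd Hp HE.
destruct (kc_simple_pole E q a Hq HE) as (B & r0 & Hr0 & HB).
assert (Hpq : d - c < PI / q).
{ apply (Rmult_lt_reg_l q); [lra|]. replace (q * (PI / q)) with PI by (field; lra). exact Hp. }
refine (residue_rectangle (fun z => (E z * kc q a z)%C) (b + 1) b (a - PI / q) c d (a + PI / q) a B r0 _ _ _ _ _ _ _ _ _ HB); try lra.
apply analytic_on_mult; [eapply analytic_on_subset; [|exact HE]; easy|].
apply (analytic_on_kc _ q a). intros z [[H1 H2] H3].
assert (H4 : - PI < q * (snd z - a) < PI).
{ replace PI with (q * (PI / q)) by (field; lra). split; nra. }
destruct (Req_dec (fst z) 0) as [Hz|Hz].
- right. apply sin_neq_0_small; [exact H4|]. destruct H3 as [H3|H3]; [lra|nra].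
- left. nra.
Qed.

(** The rectangle fits between the consecutive poles i a and i (a + pi/q). *)
Lemma boundary_int_kc_no_pole (E : C -> C) (q a b c d : R) :
  0 < q -> 0 < b -> a < c -> c <= d -> q * (d - a) < PI -> analytic_on (fun _ => True) E ->
  boundary_int (fun z => (E z * kc q a z)%C) (- b) b c d = 0%C.
Proof.
intros Hq Hb Hc Hd Hp HE.
assert (Hpq : d - a < PI / q).
{ apply (Rmult_lt_reg_l q); [lra|]. replace (q * (PI / q)) with PI by (field; lra). exact Hp. }
unfold boundary_int.
pose proof (cauchy_rectangle (fun z => (E z * kc q a z)%C) (- b - 1) (- b) b (b + 1) a c d (a + PI / q)
  ltac:(lra) ltac:(lra) ltac:(lra) ltac:(lra) ltac:(lra) ltac:(lra)) as G.
rewrite <- G; [ring|].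
apply analytic_on_mult; [eapply analytic_on_subset; [|exact HE]; easy|].
apply (analytic_on_kc _ q a). intros z [H1 H2].
right. apply sin_neq_0_small.
- replace PI with (q * (PI / q)) by (field; lra). split; nra.
- nra.
Qed.

(** * Plane waves *)

Definition Hs (phi alpha theta : R) (z : C) : C := H_N phi alpha (z + Ci * theta)%C.

Lemma qq_pos (phi : R) : 0 < phi < PI -> 0 < qq phi.
Proof. intros H. unfold qq, Phi. apply Rdiv_lt_0_compat; lra. Qed.

Lemma qq_Phi (phi : R) : 0 < phi < PI -> qq phi * (2 * Phi phi) = PI.
Proof. intros H. unfold qq, Phi. field. lra. Qed.

Lemma Hs_kc (phi alpha theta : R) (z : C) :
  Hs phi alpha theta z =
  (kc (qq phi) (alpha - PI / 2 - theta) z + kc (qq phi) (3 * PI / 2 - alpha - theta) z)%C.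
Proof.
unfold Hs. rewrite H_N_kc. destruct z as [x y].
replace ((x, y) + Ci * theta)%C with (x, y + theta) by (apply C_ext; cbn; ring).
now rewrite !kc_translate.
Qed.

Lemma Hs_translate (phi alpha theta d x y : R) :
  Hs phi alpha theta (x, y + d) = Hs phi alpha (theta + d) (x, y).
Proof. unfold Hs. f_equal. apply C_ext; cbn; ring. Qed.

Lemma Hs_period (phi alpha theta : R) (z : C) : 0 < phi < PI ->
  Hs phi alpha (theta + 2 * Phi phi) z = Hs phi alpha theta z.
Proof.
intros H. rewrite !Hs_kc.
rewrite <- (kc_period _ (alpha - PI / 2 - (theta + 2 * Phi phi)) (2 * Phi phi)) by now apply qq_Phi.
rewrite <- (kc_period _ (3 * PI / 2 - alpha - (theta + 2 * Phi phi)) (2 * Phi phi)) by now apply qq_Phi.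
f_equal; f_equal; ring.
Qed.

(** - z - 3 i pi + i theta = i pi - (z + i (4 pi - theta)), and the symmetry about i pi/2 exchanges
    the poles i (alpha - pi/2) and i (3 pi/2 - alpha) of the two terms of [H_N]; coth being odd, a
    sign comes out. *)
Lemma Hs_reflect (phi alpha theta x y : R) :
  (- Hs phi alpha theta ((- x)%R, (- y - 3 * PI)%R))%C = Hs phi alpha (4 * PI - theta) (x, y).
Proof.
rewrite !Hs_kc.
replace ((- x)%R, (- y - 3 * PI)%R) with ((- x)%R, (- y + (- (3 * PI)))%R) by (f_equal; ring).
rewrite !kc_translate.
change ((- x)%R, (- y)%R) with (Copp (x, y)). rewrite !kc_opp.
replace (- (alpha - PI / 2 - theta - - (3 * PI))) with (3 * PI / 2 - alpha - (4 * PI - theta)) by field.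
replace (- (3 * PI / 2 - alpha - theta - - (3 * PI))) with (alpha - PI / 2 - (4 * PI - theta)) by field.
ring.
Qed.

Lemma analytic_on_Hs (phi alpha theta : R) : 0 < phi < PI ->
  analytic_on (fun z => 0 < fst z) (Hs phi alpha theta).
Proof.
intros H. pose proof (qq_pos phi H) as Hq.
apply (analytic_on_ext _ (fun z => (kc (qq phi) (alpha - PI / 2 - theta) z + kc (qq phi) (3 * PI / 2 - alpha - theta) z)%C)).
- intros z. now rewrite Hs_kc.
- apply analytic_on_plus.
  + apply (analytic_on_kc _ (qq phi)). intros z Hz. left. nra.
  + apply (analytic_on_kc _ (qq phi)). intros z Hz. left. nra.
Qed.

Lemma Hs_bound (phi alpha theta : R) (z : C) : 0 < phi < PI -> 1 <= fst z ->
  Cmod (Hs phi alpha theta z) <= 2 * (1 + / sinh (qq phi)).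
Proof.
intros H Hz. pose proof (qq_pos phi H) as Hq. rewrite Hs_kc.
eapply Rle_trans; [apply Cmod_triangle|].
pose proof (kc_bound (qq phi) (alpha - PI / 2 - theta) z Hq Hz).
pose proof (kc_bound (qq phi) (3 * PI / 2 - alpha - theta) z Hq Hz). lra.
Qed.

Lemma tame_Hs (phi alpha theta : R) : 0 < phi < PI -> tame (Hs phi alpha theta).
Proof.
intros H. split.
- intros z Hz. apply (analytic_on_continuous _ _ _ (analytic_on_Hs phi alpha theta H)).
  pose proof (on_path_ge1 z Hz). lra.
- exists (2 * (1 + / sinh (qq phi))), 0. intros z Hz. rewrite Rmult_0_l, exp_0, Rmult_1_r.
  apply Hs_bound; [exact H|now apply on_path_ge1].
Qed.

(** With X = r cos d and Y = r sin d this is - omega0 r sinh (z - i d). *)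
Definition pw (omega0 X Y : R) (z : C) : C :=
  (- (omega0 * (X * Csinh z - Ci * Y * Ccosh z)))%C.

Lemma pw_fst (omega0 X Y x y : R) :
  fst (pw omega0 X Y (x, y)) = - (omega0 * sinh x * (X * cos y + Y * sin y)).
Proof. unfold pw. rewrite Csinh_pair, Ccosh_pair. cbn. ring. Qed.

Lemma pw_rotate (omega0 r d x y : R) :
  pw omega0 (r * cos d) (r * sin d) (x, y + d) = pw omega0 r 0 (x, y).
Proof.
unfold pw. rewrite !Csinh_pair, !Ccosh_pair, sin_plus, cos_plus.
pose proof (sin2_cos2_pow d) as H.
apply C_ext; cbn -[pow] in *.
- transitivity (- (omega0 * (r * (sinh x * cos y)) * (sin d ^ 2 + cos d ^ 2))); [ring|rewrite H; ring].
- transitivity (- (omega0 * (r * (cosh x * sin y)) * (sin d ^ 2 + cos d ^ 2))); [ring|rewrite H; ring].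
Qed.

Lemma pw_line (omega0 X Y a b s : R) (z : C) :
  pw omega0 (X + s * a) (Y + s * b) z = (pw omega0 X Y z + s * pw omega0 a b z)%C.
Proof. unfold pw. rewrite !RtoC_plus, !RtoC_mult. ring. Qed.

Lemma analytic_on_pw (D : C -> Prop) (omega0 X Y : R) : analytic_on D (pw omega0 X Y).
Proof.
unfold pw. apply (analytic_on_opp _ (fun z => (omega0 * (X * Csinh z - Ci * Y * Ccosh z))%C)).
apply (analytic_on_mult _ (fun _ => RtoC omega0) (fun z => (X * Csinh z - Ci * Y * Ccosh z)%C));
  [apply analytic_on_const|].
apply (analytic_on_minus _ (fun z => (X * Csinh z)%C) (fun z => (Ci * Y * Ccosh z)%C)).
- apply (analytic_on_mult _ (fun _ => RtoC X)); [apply analytic_on_const|].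
  apply (analytic_on_Csinh _ (fun z => z)), analytic_on_id.
- apply (analytic_on_mult _ (fun _ => (Ci * Y)%C)); [apply analytic_on_const|].
  apply (analytic_on_Ccosh _ (fun z => z)), analytic_on_id.
Qed.

Lemma pw_continuous (omega0 X Y : R) (z : C) :
  continuousCC (pw omega0 X Y) z.
Proof. apply (analytic_on_continuous (fun _ => True)); [apply analytic_on_pw|trivial]. Qed.

Lemma cosh_le_exp (x : R) : 0 <= x -> cosh x <= exp x.
Proof. intros H. unfold cosh. assert (exp (- x) <= exp x) by (apply exp_le; lra). lra. Qed.

Lemma sinh_ge_exp (x : R) : 0 <= x -> exp x / 2 - 1 / 2 <= sinh x.
Proof.
intros H. unfold sinh. assert (exp (- x) <= 1) by (rewrite <- exp_0; apply exp_le; lra). lra.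
Qed.

Lemma linear_growth_pw (omega0 a b : R) : linear_growth (pw omega0 a b).
Proof.
split; [intros z _; apply pw_continuous|].
exists (Rabs omega0 * (Rabs a + Rabs b) + 1). split.
{ pose proof (Rabs_pos omega0). pose proof (Rabs_pos a). pose proof (Rabs_pos b). nra. }
intros z Hz. pose proof (on_path_ge1 z Hz) as H1. destruct z as [x y]. cbn [fst] in *.
unfold pw. rewrite Cmod_opp, Cmod_mult, Cmod_R.
pose proof (Cmod_Csinh_le x y). pose proof (Cmod_Ccosh_le x y). pose proof (cosh_le_exp x ltac:(lra)).
assert (Hn : Cmod (a * Csinh (x, y) - Ci * b * Ccosh (x, y)) <= (Rabs a + Rabs b) * exp x).
{ unfold Cminus. eapply Rle_trans; [apply Cmod_triangle|].
  rewrite Cmod_opp, !Cmod_mult, Cmod_Ci, !Cmod_R, Rmult_1_l, Rmult_plus_distr_r.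
  apply Rplus_le_compat; apply Rmult_le_compat_l; try apply Rabs_pos; lra. }
apply (Rmult_le_compat_l (Rabs omega0)) in Hn; [|apply Rabs_pos].
pose proof (exp_pos x). nra.
Qed.

Lemma cos_PI4_pos : 1 / 2 <= cos (PI / 4).
Proof.
rewrite cos_PI4. pose proof (sqrt_lt_R0 2 ltac:(lra)) as H0.
assert (sqrt 2 <= 2) by (rewrite <- (sqrt_square 2) at 2 by lra; apply sqrt_le_1_alt; lra).
apply (Rmult_le_reg_r (2 * sqrt 2)); [lra|].
replace (1 / sqrt 2 * (2 * sqrt 2)) with 2 by (field; lra). lra.
Qed.

Lemma cos_path (y : R) : y = y_top \/ y = y_bot -> 1 / 2 <= cos y /\ sin y = - cos y.
Proof.
pose proof cos_PI4_pos as H. assert (E : sin (PI / 4) = cos (PI / 4)) by (now rewrite sin_PI4, cos_PI4).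
intros [-> | ->].
- rewrite cos_neg, sin_neg, E. lra.
- rewrite cos_neg, sin_neg. replace (9 * PI / 4) with (PI / 4 + 2 * INR 1 * PI) by (cbn; field).
  rewrite cos_period, sin_period, E. lra.
Qed.

(** On both half-lines sin y = - cos y with cos y >= 1/2, so X cos y + Y sin y = (X - Y) cos y: the
    sign of X - Y decides. *)
Lemma decaying_pw (omega0 X Y : R) : 0 < omega0 -> Y < X -> decaying (pw omega0 X Y).
Proof.
intros Hw HX. split; [intros z _; apply pw_continuous|].
set (k := omega0 * (X - Y)). assert (Hk : 0 < k) by (unfold k; nra).
set (m := omega0 * (Rabs X + Rabs Y)).
assert (Hm : 0 <= m) by (unfold m; pose proof (Rabs_pos X); pose proof (Rabs_pos Y); nra).
(* The rate k/4 comes from cos y >= 1/2 and sinh x >= (e^x - 1)/2. The additive constant also covers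
   the side Re z = 1, where the exponent may be positive. *)
exists (k / 4), (m * cosh 1 + k * exp 1). split; [lra|].
pose proof (cosh_pos 1) as Hc1. pose proof (exp_pos 1) as He1.
assert (He2 : 1 <= exp 1) by (pose proof (exp_ineq1_le 1); lra).
assert (Hmc : 0 <= m * cosh 1) by nra.
intros z Hz. destruct z as [x y]. rewrite pw_fst.
destruct Hz as [[H1 H2]|[H1 H2]]; cbn [fst snd] in *.
- destruct (cos_path y H2) as [C1 C2]. rewrite C2.
  replace (- (omega0 * sinh x * (X * cos y + Y * - cos y))) with (- (k * (sinh x * cos y))) by (unfold k; ring).
  pose proof (sinh_ge_exp x ltac:(lra)). pose proof (sinh_pos x ltac:(lra)).
  assert (sinh x * (1 / 2) <= sinh x * cos y) by (apply Rmult_le_compat_l; lra).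
  assert (exp x / 4 - 1 / 4 <= sinh x * cos y) by lra.
  assert (k * (exp x / 4 - 1 / 4) <= k * (sinh x * cos y)) by (apply Rmult_le_compat_l; lra).
  assert (k * 1 <= k * exp 1) by (apply Rmult_le_compat_l; lra). lra.
- subst x.
  assert (Hb : Rabs (omega0 * sinh 1 * (X * cos y + Y * sin y)) <= m * cosh 1).
  { pose proof (sinh_pos 1 ltac:(lra)) as S1.
    assert (S2 : sinh 1 <= cosh 1) by (unfold sinh, cosh; pose proof (exp_pos (- (1))); lra).
    rewrite !Rabs_mult, (Rabs_pos_eq omega0), (Rabs_pos_eq (sinh 1)) by lra.
    assert (T : Rabs (X * cos y + Y * sin y) <= Rabs X + Rabs Y).
    { eapply Rle_trans; [apply Rabs_triang|]. rewrite !Rabs_mult.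
      assert (Rabs (cos y) <= 1) by (apply Rabs_le, COS_bound).
      assert (Rabs (sin y) <= 1) by (apply Rabs_le, SIN_bound).
      pose proof (Rabs_pos X). pose proof (Rabs_pos Y). nra. }
    unfold m. rewrite Rmult_assoc, (Rmult_assoc omega0). apply Rmult_le_compat_l; [lra|].
    rewrite Rmult_comm. apply Rmult_le_compat; try lra. apply Rabs_pos. }
  pose proof (Rle_abs (- (omega0 * sinh 1 * (X * cos y + Y * sin y)))) as Ha. rewrite Rabs_Ropp in Ha.
  assert (k / 4 * exp 1 <= k * exp 1) by nra. lra.
Qed.

(** (X, Y) are Cartesian coordinates in the frame whose first axis has direction theta: the weight
    depends on the frame only, the exponent on the point only. At the point (rho, 0) of the frame
    this is w(theta) at radius rho. *)
Definition wave (omega0 phi alpha theta X Y : R) : C :=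
  Uint (fun z => (Cexp (pw omega0 X Y z) * Hs phi alpha theta z)%C).

Lemma is_U_wave (omega0 phi alpha theta X : R) : 0 < omega0 -> 0 < phi < PI -> 0 < X ->
  is_U (fun z => (Cexp (pw omega0 X 0 z) * Hs phi alpha theta z)%C) (wave omega0 phi alpha theta X 0).
Proof. intros. apply is_U_exp; [apply decaying_pw; lra|now apply tame_Hs]. Qed.

Lemma exp_sinh_dominated (k M : R) : 0 < k -> 0 <= M ->
  exists K, forall x s, 1 <= x -> k <= s -> exp (- (sinh x * s)) * M <= K * exp (- x).
Proof.
intros Hk HM. destruct (exp_exp_dominated (k / 2) 0 ltac:(lra)) as (K & HK & H).
exists (exp (k / 2) * K * M). intros x s Hx Hs. specialize (H x ltac:(lra)).
assert (H1 : exp (- (sinh x * s)) <= exp (k / 2 + (0 * x - k / 2 * exp x))).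
{ apply exp_le. pose proof (sinh_ge_exp x ltac:(lra)). pose proof (sinh_pos x ltac:(lra)). nra. }
rewrite exp_plus in H1. pose proof (exp_pos (k / 2)).
assert (H2 : exp (k / 2) * exp (0 * x - k / 2 * exp x) <= exp (k / 2) * (K * exp (- x)))
  by (apply Rmult_le_compat_l; lra).
replace (exp (k / 2) * K * M * exp (- x)) with (exp (k / 2) * (K * exp (- x)) * M) by ring.
apply Rmult_le_compat_r; lra.
Qed.

(** These strips are swept by the lines Im z = - pi/4 and Im z = - 9 pi/4 under translations by at
    most pi/8. *)
Lemma cos_strip (y : R) :
  - (3 * PI / 8) <= y <= - (PI / 8) \/ - (3 * PI / 8) - 2 * PI <= y <= - (PI / 8) - 2 * PI ->
  cos (3 * PI / 8) <= cos y.
Proof.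
pose proof PI_RGT_0 as Hpi. intros [Hy|Hy].
- rewrite <- (cos_neg y). apply cos_decr_1; lra.
- rewrite <- (cos_neg y). replace (- y) with ((- y - 2 * PI) + 2 * INR 1 * PI) by (cbn; ring).
  rewrite cos_period. apply cos_decr_1; lra.
Qed.

(** K is chosen before d because the bound of [Hs] is uniform in the height; so one constant serves
    the original and the translated integrand. *)
Lemma wave_integrand_bound (omega0 phi alpha theta r : R) : 0 < omega0 -> 0 < phi < PI -> 0 < r ->
  exists K, forall x y, 1 <= x ->
    - (3 * PI / 8) <= y <= - (PI / 8) \/ - (3 * PI / 8) - 2 * PI <= y <= - (PI / 8) - 2 * PI ->
    forall d, Cmod (Cexp (pw omega0 r 0 (x, y)) * Hs phi alpha theta (x, y + d)) <= K * exp (- x).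
Proof.
intros Hw Hphi Hr. pose proof PI_RGT_0 as Hpi.
assert (Hc : 0 < cos (3 * PI / 8)) by (apply cos_gt_0; lra).
assert (HM : 0 <= 2 * (1 + / sinh (qq phi))).
{ pose proof (sinh_pos _ (qq_pos phi Hphi)) as Hs. apply Rinv_0_lt_compat in Hs. lra. }
destruct (exp_sinh_dominated (omega0 * r * cos (3 * PI / 8)) _ ltac:(apply Rmult_lt_0_compat; nra) HM) as (K & HK).
exists K. intros x y Hx Hy d. apply cos_strip in Hy.
rewrite Cmod_mult, Cmod_Cexp, pw_fst.
eapply Rle_trans; [|apply (HK x (omega0 * r * cos y) Hx)].
- replace (- (omega0 * sinh x * (r * cos y + 0 * sin y))) with (- (sinh x * (omega0 * r * cos y))) by ring.
  apply Rmult_le_compat_l; [left; apply exp_pos|]. apply Hs_bound; [exact Hphi|exact Hx].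
- apply Rmult_le_compat_l; [nra|exact Hy].
Qed.

(** Translation of the contour by i d; for |d| <= pi/8 the exponential still
    decays on all the horizontal lines that are crossed. *)
Lemma wave_rotate (omega0 phi alpha theta r d : R) :
  0 < omega0 -> 0 < phi < PI -> 0 < r -> Rabs d <= PI / 8 ->
  wave omega0 phi alpha (theta + d) r 0 = wave omega0 phi alpha theta (r * cos d) (r * sin d).
Proof.
intros Hw Hphi Hr Hd. pose proof PI_RGT_0 as Hpi. apply Rabs_le_between in Hd.
pose proof (is_U_wave omega0 phi alpha (theta + d) r Hw Hphi Hr) as H1.
destruct (wave_integrand_bound omega0 phi alpha theta r Hw Hphi Hr) as (K & HK).
set (F := fun z => (Cexp (pw omega0 (r * cos d) (r * sin d) z) * Hs phi alpha theta z)%C).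
set (G := fun z => (Cexp (pw omega0 r 0 z) * Hs phi alpha (theta + d) z)%C) in *.
assert (EFG : forall x y, F (x, y + d) = G (x, y)).
{ intros x y. unfold F, G. now rewrite pw_rotate, Hs_translate. }
assert (EG : forall x y, G (x, y) = (Cexp (pw omega0 r 0 (x, y)) * Hs phi alpha theta (x, (y + d)%R))%C).
{ intros x y. unfold G. now rewrite Hs_translate. }
assert (HF : analytic_on (fun z => 0 < fst z) F).
{ apply analytic_on_mult; [apply analytic_on_Cexp, analytic_on_pw|now apply analytic_on_Hs]. }
assert (HG : analytic_on (fun z => 0 < fst z) G).
{ apply analytic_on_mult; [apply analytic_on_Cexp, analytic_on_pw|now apply analytic_on_Hs]. }
(* This is the condition Y < X of [decaying_pw] for the rotated point. *)
assert (Hcs : sin d < cos d).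
{ destruct (Rle_dec d 0) as [Hd0|Hd0].
  - pose proof (cos_gt_0 d ltac:(lra) ltac:(lra)). pose proof (sin_le_0 (d + 2 * INR 1 * PI)) as Hs.
    rewrite sin_period in Hs. cbn [INR] in Hs. specialize (Hs ltac:(lra) ltac:(lra)). lra.
  - rewrite <- cos_shift. apply cos_decreasing_1; lra. }
assert (H2 : is_U F (wave omega0 phi alpha theta (r * cos d) (r * sin d))).
{ apply is_U_exp; [apply decaying_pw; [exact Hw|now apply Rmult_lt_compat_l]|now apply tame_Hs]. }
(* [is_U_translate_pos] only moves upwards: for d <= 0 it is applied to G, whose translate by - d is
   F. *)
destruct (Rle_dec d 0) as [Hd0|Hd0].
- rewrite <- (is_U_unique _ _ H2). symmetry. apply is_U_unique.
  apply (is_U_ext (fun z => G (fst z, snd z + - d))).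
  { intros [x y] _. cbn [fst snd]. rewrite <- EFG. do 2 f_equal. ring. }
  apply (is_U_translate_pos G (- d) K); [lra|exact HG| |exact H1].
  intros x y Hx Hy. rewrite EG. apply HK; [exact Hx|]. lra.
- rewrite <- (is_U_unique _ _ H1). apply is_U_unique.
  apply (is_U_ext (fun z => F (fst z, snd z + d))).
  { intros [x y] _. apply EFG. }
  apply (is_U_translate_pos F d K); [lra|exact HF| |exact H2].
  intros x y Hx Hy. replace y with (y - d + d) by ring. rewrite EFG, EG. apply HK; [exact Hx|]. lra.
Qed.

(** * The Helmholtz equation and the boundary condition *)

Lemma is_Cderive_mult_l (c : C) (T : R -> C) (x : R) (l : C) :
  is_Cderive T x l -> is_Cderive (fun t => (c * T t)%C) x (c * l)%C.
Proof.
intros H. apply is_Cderive_spec. intros eps Heps.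
pose proof (Cmod_ge_0 c) as Hc.
destruct (proj1 (is_Cderive_spec T x l) H (eps / (Cmod c + 1)) ltac:(apply Rdiv_lt_0_compat; lra)) as (d & Hd & Hb).
exists d. split; [exact Hd|]. intros y Hy. specialize (Hb y Hy).
replace (c * T y - c * T x - (y - x)%R * (c * l))%C with (c * (T y - T x - (y - x)%R * l))%C by ring.
rewrite Cmod_mult. pose proof (Rabs_pos (y - x)).
apply (Rle_trans _ ((Cmod c + 1) * (eps / (Cmod c + 1) * Rabs (y - x)))).
- apply Rmult_le_compat; [exact Hc|apply Cmod_ge_0|lra|exact Hb].
- right. field. lra.
Qed.

Lemma is_second_derive_plus (f g : R -> C) (x : R) (l m : C) :
  is_second_derive f x l -> is_second_derive g x m ->
  is_second_derive (fun t => (f t + g t)%C) x (l + m)%C.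
Proof.
intros (f' & Hf & Hf') (g' & Hg & Hg'). exists (fun t => (f' t + g' t)%C). split.
- generalize (filter_and _ _ Hf Hg). apply filter_imp. intros t [H1 H2].
  exact (is_derive_plus (K := R_AbsRing) (V := CN) f g t _ _ H1 H2).
- exact (is_derive_plus (K := R_AbsRing) (V := CN) f' g' x _ _ Hf' Hg').
Qed.

Lemma is_second_derive_mult_l (c : C) (f : R -> C) (x : R) (l : C) :
  is_second_derive f x l -> is_second_derive (fun t => (c * f t)%C) x (c * l)%C.
Proof.
intros (f' & Hf & Hf'). exists (fun t => (c * f' t)%C). split.
- revert Hf. apply filter_imp. intros t. apply is_Cderive_mult_l.
- now apply is_Cderive_mult_l.
Qed.

Lemma is_second_derive_ext_loc (f g : R -> C) (x : R) (l : C) :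
  locally x (fun t => f t = g t) -> is_second_derive f x l -> is_second_derive g x l.
Proof.
intros H (f' & Hf & Hf'). exists f'. split; [|exact Hf'].
apply locally_locally in H. generalize (filter_and _ _ H Hf). apply filter_imp.
intros t [H1 H2]. now apply (is_derive_ext_loc f).
Qed.

Lemma wave_line (omega0 phi alpha theta X a b s t : R) :
  wave omega0 phi alpha theta (X + (t - s) * a) ((t - s) * b) =
  Uint (fun z => (Cexp (pw omega0 (X - s * a) (- (s * b)) z + t * pw omega0 a b z) * Hs phi alpha theta z)%C).
Proof.
unfold wave. f_equal. extensionality z.
rewrite <- pw_line. do 3 f_equal; ring.
Qed.

Lemma pw_line_decaying (omega0 X a b s : R) : 0 < omega0 -> 0 < X ->
  (fun z => (pw omega0 (X - s * a) (- (s * b)) z + s * pw omega0 a b z)%C) = pw omega0 X 0.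
Proof.
intros Hw HX. extensionality z. rewrite <- pw_line. f_equal; ring.
Qed.

Lemma is_derive_wave (omega0 phi alpha theta X a b s : R) :
  0 < omega0 -> 0 < phi < PI -> 0 < X ->
  is_Cderive (fun t => wave omega0 phi alpha theta (X + (t - s) * a) ((t - s) * b)) s
    (Uint (fun z => (Cexp (pw omega0 X 0 z) * (pw omega0 a b z * Hs phi alpha theta z))%C)).
Proof.
intros Hw Hphi HX. pose proof (pw_line_decaying omega0 X a b s Hw HX) as E.
eapply (is_derive_ext (K := R_AbsRing) (V := CN)); [intros t; symmetry; apply wave_line|].
rewrite <- E. apply is_derive_Uint.
- rewrite E. now apply decaying_pw.
- apply linear_growth_pw.
- now apply tame_Hs.
Qed.

Lemma is_second_derive_wave (omega0 phi alpha theta X a b s : R) :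
  0 < omega0 -> 0 < phi < PI -> 0 < X ->
  is_second_derive (fun t => wave omega0 phi alpha theta (X + (t - s) * a) ((t - s) * b)) s
    (Uint (fun z => (Cexp (pw omega0 X 0 z) *
       (pw omega0 a b z * (pw omega0 a b z * Hs phi alpha theta z)))%C)).
Proof.
intros Hw Hphi HX. pose proof (pw_line_decaying omega0 X a b s Hw HX) as E.
eapply is_second_derive_ext_loc.
- apply filter_forall. intros t. symmetry. apply wave_line.
- rewrite <- E. apply is_second_derive_Uint.
  + rewrite E. now apply decaying_pw.
  + apply linear_growth_pw.
  + now apply tame_Hs.
Qed.

Lemma Ccosh_sqr (z : C) : (Ccosh z * Ccosh z = 1 + Csinh z * Csinh z)%C.
Proof.
assert (H : (Cexp z * Cexp (- z) = 1)%C).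
{ rewrite <- Cexp_plus. replace (z + - z)%C with (RtoC 0) by ring. apply Cexp_0. }
unfold Ccosh, Csinh.
transitivity (Cexp z * Cexp (- z) + (Cexp z - Cexp (- z)) / 2 * ((Cexp z - Cexp (- z)) / 2))%C.
- field.
- now rewrite H.
Qed.

(** [pw] is linear in (X, Y), and the hypotheses make the matrix with rows (a, b) and (a', b')
    orthogonal. Hence the squares of the two factors add up to omega0^2 (sinh^2 - cosh^2) = -
    omega0^2. The rows will be the two axes of the plane expressed in the rotated frame. *)
Lemma wave_helmholtz (omega0 phi alpha theta X a b a' b' : R) :
  0 < omega0 -> 0 < phi < PI -> 0 < X ->
  a * a + a' * a' = 1 -> b * b + b' * b' = 1 -> a * b + a' * b' = 0 ->
  (Uint (fun z => (Cexp (pw omega0 X 0 z) * (pw omega0 a b z * (pw omega0 a b z * Hs phi alpha theta z)))%C)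
   + Uint (fun z => (Cexp (pw omega0 X 0 z) * (pw omega0 a' b' z * (pw omega0 a' b' z * Hs phi alpha theta z)))%C)
   = - (omega0 ^ 2)%R * wave omega0 phi alpha theta X 0)%C.
Proof.
intros Hw Hphi HX H1 H2 H3.
assert (Hp : decaying (pw omega0 X 0)) by now apply decaying_pw.
assert (Ht : forall a b, tame (fun z => (pw omega0 a b z * (pw omega0 a b z * Hs phi alpha theta z))%C)).
{ intros c d. apply tame_mult; [apply tame_linear_growth, linear_growth_pw|].
  apply tame_mult; [apply tame_linear_growth, linear_growth_pw|now apply tame_Hs]. }
pose proof (is_U_plus _ _ _ _ (is_U_exp _ _ Hp (Ht a b)) (is_U_exp _ _ Hp (Ht a' b'))) as U1.
rewrite <- (is_U_unique _ _ U1). apply is_U_unique.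
eapply is_U_ext; [|apply is_U_mult_l, (is_U_wave omega0 phi alpha theta X Hw Hphi HX)].
intros z _. cbv beta.
assert (E : (pw omega0 a b z * pw omega0 a b z + pw omega0 a' b' z * pw omega0 a' b' z = - (omega0 ^ 2)%R)%C).
{ unfold pw.
  transitivity (omega0 * omega0 * ((a * a + a' * a')%R * (Csinh z * Csinh z) - (b * b + b' * b')%R * (Ccosh z * Ccosh z)
     - 2 * Ci * (a * b + a' * b')%R * Csinh z * Ccosh z))%C.
  - rewrite !RtoC_plus, !RtoC_mult.
    assert (Ei : (Ci * Ci = - (1))%C) by (apply C_ext; cbn; ring).
    transitivity (omega0 * omega0 * ((a * a + a' * a') * (Csinh z * Csinh z) + Ci * Ci * (b * b + b' * b') * (Ccosh z * Ccosh z)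
     - 2 * Ci * (a * b + a' * b') * Csinh z * Ccosh z))%C; [ring|rewrite Ei; ring].
  - rewrite H1, H2, H3, Ccosh_sqr. cbn [pow]. rewrite !RtoC_mult. ring. }
transitivity ((pw omega0 a b z * pw omega0 a b z + pw omega0 a' b' z * pw omega0 a' b' z) *
  (Cexp (pw omega0 X 0 z) * Hs phi alpha theta z))%C; [rewrite E; reflexivity|ring].
Qed.

(** * Polar coordinates and rotated frames *)

Lemma polar_angle (y : R * R) : y <> (0, 0) ->
  0 < radius y /\ 0 < angle y <= 2 * PI /\ y = polar (radius y) (angle y).
Proof.
intros Hy. destruct y as [u v].
assert (Hp : 0 < u ^ 2 + v ^ 2).
{ pose proof (pow2_ge_0 u). pose proof (pow2_ge_0 v).
  destruct (Req_dec u 0) as [-> |Hu]; [|pose proof (pow2_gt_0 u Hu); lra].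
  destruct (Req_dec v 0) as [-> |Hv]; [now contradict Hy|pose proof (pow2_gt_0 v Hv); lra]. }
assert (Hr : 0 < radius (u, v)) by (apply sqrt_lt_R0; exact Hp).
assert (Hr2 : radius (u, v) * radius (u, v) = u ^ 2 + v ^ 2) by (apply sqrt_sqrt; cbn [fst snd]; lra).
unfold angle. cbn [fst snd]. set (r := radius (u, v)) in *.
assert (Hc : -1 <= u / r <= 1).
{ assert (Hur : - r <= u <= r) by (pose proof (pow2_ge_0 v); split; nra).
  split; apply (Rmult_le_reg_r r); try exact Hr; unfold Rdiv; rewrite Rmult_assoc, Rinv_l by lra; lra. }
assert (Hs : sqrt (1 - (u / r)²) = Rabs v / r).
{ replace (1 - (u / r)²) with ((v / r)²).
  - rewrite sqrt_Rsqr_abs. unfold Rdiv. rewrite Rabs_mult, Rabs_inv, (Rabs_pos_eq r) by lra. reflexivity.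
  - unfold Rsqr. replace 1 with ((r * r) / (r * r)) by (field; lra). rewrite Hr2 at 1. field. lra. }
pose proof (acos_bound (u / r)) as Hb. pose proof PI_RGT_0 as Hpi.
split; [exact Hr|]. unfold polar. destruct (Rlt_dec 0 v) as [Hv|Hv].
- split.
  + split; [|lra]. destruct (proj1 Hb) as [H0|H0]; [exact H0|exfalso].
    pose proof (cos_acos _ Hc) as H1. pose proof (sin_acos _ Hc) as H2. rewrite <- H0, sin_0, Hs in H2.
    rewrite Rabs_pos_eq in H2 by lra. assert (0 < v / r) by (apply Rdiv_lt_0_compat; lra). lra.
  + rewrite cos_acos, sin_acos, Hs, Rabs_pos_eq by (try exact Hc; lra). f_equal; field; lra.
- split; [lra|].
  rewrite cos_minus, sin_minus, cos_2PI, sin_2PI, cos_acos, sin_acos, Hs by exact Hc.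
  rewrite Rabs_left1 by lra. f_equal; field; lra.
Qed.

Lemma Qdom_polar (phi : R) (y : R * R) : 0 < phi < PI -> Qdom phi y ->
  exists r theta, 0 < r /\ phi < theta < 2 * PI /\ y = polar r theta.
Proof.
intros Hphi HQ. pose proof PI_RGT_0 as Hpi.
assert (H0 : y <> (0, 0)).
{ intros ->. apply HQ. exists 0, 0. split; [lra|split; [lra|]]. unfold polar. f_equal; ring. }
destruct (polar_angle y H0) as (Hr & Ha & Hy). exists (radius y), (angle y).
split; [exact Hr|split; [|exact Hy]]. split.
- destruct (Rlt_dec phi (angle y)) as [H|H]; [exact H|exfalso]. apply HQ.
  exists (radius y), (angle y). split; [lra|split; [lra|exact Hy]].
(* The value 2 pi of [angle] is the edge theta = 0 of the wedge. *)
- destruct (proj2 Ha) as [H|H]; [exact H|exfalso]. apply HQ.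
  exists (radius y), 0. split; [lra|split; [lra|]]. rewrite Hy at 1. rewrite H.
  unfold polar. now rewrite cos_2PI, sin_2PI, cos_0, sin_0.
Qed.

Definition rotated (theta X Y : R) : R * R :=
  (X * cos theta - Y * sin theta, X * sin theta + Y * cos theta).

Lemma rotated_polar (theta X Y : R) : 0 < X ->
  exists r, 0 < r /\ r * cos (atan (Y / X)) = X /\ r * sin (atan (Y / X)) = Y /\
    rotated theta X Y = polar r (theta + atan (Y / X)).
Proof.
intros HX. pose proof (atan_bound (Y / X)) as Hb.
assert (Hc : 0 < cos (atan (Y / X))) by (apply cos_gt_0; lra).
assert (Ht : sin (atan (Y / X)) = Y / X * cos (atan (Y / X))).
{ rewrite <- (tan_atan (Y / X)) at 2. unfold tan. field. lra. }
exists (X / cos (atan (Y / X))).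
assert (E1 : X / cos (atan (Y / X)) * cos (atan (Y / X)) = X) by (field; lra).
assert (E2 : X / cos (atan (Y / X)) * sin (atan (Y / X)) = Y) by (rewrite Ht; field; lra).
split; [apply Rdiv_lt_0_compat; lra|split; [exact E1|split; [exact E2|]]].
unfold rotated, polar. rewrite cos_plus, sin_plus.
set (d := atan (Y / X)) in *. set (r := X / cos d) in *.
f_equal; rewrite <- E1 at 1; rewrite <- E2 at 1; ring.
Qed.

(** Along a line through the point (X, 0) of the frame the angular deviation stays small near that
    point: small enough for the rotation of the contour, and for the angle to remain between phi and
    2 pi. *)
Lemma atan_near (X a b s eta : R) : 0 < X -> 0 < eta ->
  locally s (fun t => 0 < X + (t - s) * a /\ Rabs (atan ((t - s) * b / (X + (t - s) * a))) < eta).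
Proof.
intros HX He. apply filter_and.
- assert (Hc : continuous (fun t => X + (t - s) * a) s).
  { apply (ex_derive_continuous (V := R_NormedModule)). auto_derive. trivial. }
  apply (Hc (fun u => 0 < u)). apply open_gt. rewrite Rminus_diag. lra.
- assert (Hc : continuous (fun t => atan ((t - s) * b / (X + (t - s) * a))) s).
  { apply (ex_derive_continuous (V := R_NormedModule)). auto_derive.
    rewrite Rplus_opp_r. lra. }
  apply (Hc (fun u => Rabs u < eta)).
  exists (mkposreal _ He). intros u Hu. change (Rabs (u - atan ((s - s) * b / (X + (s - s) * a))) < eta) in Hu.
  rewrite Rminus_diag, Rmult_0_l in Hu. unfold Rdiv in Hu. rewrite Rmult_0_l, atan_0, Rminus_0_r in Hu. exact Hu.
Qed.

(** The only fact about the amplitude that the stationary problem uses. It includes the critical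
    rays, so that neither equation needs a case distinction there. *)
Definition has_wave_representation (omega0 phi alpha : R) : Prop :=
  forall rho theta, 0 < rho -> phi <= theta <= 2 * PI ->
    A_inf omega0 phi alpha rho theta =
    (Ci / (4 * Phi phi)%R * (wave omega0 phi alpha theta rho 0
       + wave omega0 phi alpha (4 * PI - theta) rho 0))%C.

Lemma A_inf_at_local (omega0 phi alpha theta X Y : R) :
  0 < omega0 -> 0 < phi < PI -> has_wave_representation omega0 phi alpha ->
  0 < X -> Rabs (atan (Y / X)) <= PI / 8 -> phi <= theta + atan (Y / X) <= 2 * PI ->
  A_inf_at omega0 phi alpha (rotated theta X Y) =
  (Ci / (4 * Phi phi)%R * (wave omega0 phi alpha theta X Y
     + wave omega0 phi alpha (4 * PI - theta) X (- Y)))%C.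
Proof.
intros Hw Hphi Hrep HX Hd Hth.
destruct (rotated_polar theta X Y HX) as (r & Hr & E1 & E2 & ->).
set (d := atan (Y / X)) in *.
unfold A_inf_at. rewrite radius_polar, angle_polar by lra. rewrite Hrep by lra.
f_equal. f_equal.
- rewrite wave_rotate by assumption. now rewrite E1, E2.
(* When theta increases, 4 pi - theta decreases: the second wave rotates backwards, hence the
   coordinate - Y. *)
- replace (4 * PI - (theta + d)) with (4 * PI - theta + - d) by ring.
  rewrite wave_rotate by (try assumption; now rewrite Rabs_Ropp).
  rewrite cos_neg, sin_neg, E1. f_equal. rewrite <- E2. ring.
Qed.

Lemma A_inf_at_line (omega0 phi alpha theta X a b s : R) :
  0 < omega0 -> 0 < phi < PI -> has_wave_representation omega0 phi alpha ->
  0 < X -> phi < theta < 2 * PI ->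
  locally s (fun t => A_inf_at omega0 phi alpha (rotated theta (X + (t - s) * a) ((t - s) * b)) =
    (Ci / (4 * Phi phi)%R * (wave omega0 phi alpha theta (X + (t - s) * a) ((t - s) * b)
     + wave omega0 phi alpha (4 * PI - theta) (X + (t - s) * a) ((t - s) * - b)))%C).
Proof.
intros Hw Hphi Hrep HX Hth. pose proof PI_RGT_0 as Hpi.
set (eta := Rmin (PI / 8) (Rmin (theta - phi) (2 * PI - theta))).
assert (He : 0 < eta) by (repeat apply Rmin_glb_lt; lra).
assert (H1 : eta <= PI / 8) by apply Rmin_l.
assert (H2 : eta <= Rmin (theta - phi) (2 * PI - theta)) by apply Rmin_r.
pose proof (Rmin_l (theta - phi) (2 * PI - theta)). pose proof (Rmin_r (theta - phi) (2 * PI - theta)).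
generalize (atan_near X a b s eta HX He). apply filter_imp. intros t [Ht1 Ht2].
pose proof (Rabs_def2 _ _ Ht2) as Ht3.
rewrite A_inf_at_local; try assumption; try lra.
now rewrite <- Ropp_mult_distr_r.
Qed.

Lemma is_second_derive_A_inf_at (omega0 phi alpha theta X a b s : R) (v : R -> R * R) :
  0 < omega0 -> 0 < phi < PI -> has_wave_representation omega0 phi alpha ->
  0 < X -> phi < theta < 2 * PI ->
  (forall t, v t = rotated theta (X + (t - s) * a) ((t - s) * b)) ->
  is_second_derive (fun t => A_inf_at omega0 phi alpha (v t)) s
    (Ci / (4 * Phi phi)%R *
      (Uint (fun z => (Cexp (pw omega0 X 0 z) *
         (pw omega0 a b z * (pw omega0 a b z * Hs phi alpha theta z)))%C) +
       Uint (fun z => (Cexp (pw omega0 X 0 z) *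
         (pw omega0 a (- b) z * (pw omega0 a (- b) z * Hs phi alpha (4 * PI - theta) z)))%C)))%C.
Proof.
intros Hw Hphi Hrep HX Hth Hv.
apply (is_second_derive_ext_loc
  (fun t => (Ci / (4 * Phi phi)%R * (wave omega0 phi alpha theta (X + (t - s) * a) ((t - s) * b)
     + wave omega0 phi alpha (4 * PI - theta) (X + (t - s) * a) ((t - s) * - b)))%C)).
- generalize (A_inf_at_line omega0 phi alpha theta X a b s Hw Hphi Hrep HX Hth).
  apply filter_imp. intros t Ht. rewrite Hv. now symmetry.
- apply is_second_derive_mult_l, is_second_derive_plus; now apply is_second_derive_wave.
Qed.

Lemma helmholtz_A_inf (omega0 phi alpha : R) (y : R * R) :
  0 < omega0 -> 0 < phi < PI -> has_wave_representation omega0 phi alpha -> Qdom phi y ->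
  exists L : C, is_laplacian (A_inf_at omega0 phi alpha) y L /\
    (L + (omega0 ^ 2)%R * A_inf_at omega0 phi alpha y)%C = 0%C.
Proof.
intros Hw Hphi Hrep HQ. destruct (Qdom_polar phi y Hphi HQ) as (r & theta & Hr & Hth & ->).
pose proof (sin2_cos2_pow theta) as Hsc.
(* The coordinate axes have components (cos theta, - sin theta) and (sin theta, cos theta) in the
   frame of direction theta, where the point itself is (r, 0). *)
pose proof (is_second_derive_A_inf_at omega0 phi alpha theta r (cos theta) (- sin theta) (r * cos theta)
  (fun t => (t, r * sin theta)) Hw Hphi Hrep Hr Hth) as D1.
pose proof (is_second_derive_A_inf_at omega0 phi alpha theta r (sin theta) (cos theta) (r * sin theta)
  (fun t => (r * cos theta, t)) Hw Hphi Hrep Hr Hth) as D2.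
eexists. split.
- eexists. eexists. split; [apply D1|split; [apply D2|reflexivity]].
  + intros t. unfold rotated. f_equal.
    * transitivity (r * cos theta + (t - r * cos theta) * (sin theta ^ 2 + cos theta ^ 2)); [rewrite Hsc; ring|ring].
    * ring.
  + intros t. unfold rotated. f_equal.
    * ring.
    * transitivity (r * sin theta + (t - r * sin theta) * (sin theta ^ 2 + cos theta ^ 2)); [rewrite Hsc; ring|ring].
- pose proof (wave_helmholtz omega0 phi alpha theta r (cos theta) (- sin theta) (sin theta) (cos theta)
    Hw Hphi Hr ltac:(lra) ltac:(lra) ltac:(lra)) as W1.
  pose proof (wave_helmholtz omega0 phi alpha (4 * PI - theta) r (cos theta) (- - sin theta) (sin theta) (- cos theta)
    Hw Hphi Hr ltac:(lra) ltac:(lra) ltac:(lra)) as W2.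
  unfold A_inf_at. rewrite radius_polar, angle_polar by lra. rewrite Hrep by lra.
  match type of W1 with (?a + ?b)%C = _ => set (a1 := a) in *; set (b1 := b) in * end.
  match type of W2 with (?a + ?b)%C = _ => set (a2 := a) in *; set (b2 := b) in * end.
  transitivity (Ci / (4 * Phi phi)%R * ((a1 + b1) + (a2 + b2)
    + (omega0 ^ 2)%R * (wave omega0 phi alpha theta r 0 + wave omega0 phi alpha (4 * PI - theta) r 0)))%C; [ring|].
  rewrite W1, W2. ring.
Qed.

(** The two waves coincide on the boundary rays, so that their sum is even in the normal coordinate [Y]. *)
Lemma even_wave_derive (omega0 phi alpha theta X : R) :
  0 < omega0 -> 0 < phi < PI -> 0 < X ->
  is_Cderive (fun t => (wave omega0 phi alpha theta X t + wave omega0 phi alpha theta X (- t))%C) 0 (RtoC 0).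
Proof.
intros Hw Hphi HX.
assert (Hp : decaying (pw omega0 X 0)) by now apply decaying_pw.
assert (Ht : forall a b, tame (fun z => (pw omega0 a b z * Hs phi alpha theta z)%C)).
{ intros c d. apply tame_mult; [apply tame_linear_growth, linear_growth_pw|now apply tame_Hs]. }
pose proof (is_U_exp _ _ Hp (Ht 0 1)) as U1.
assert (E : Uint (fun z => (Cexp (pw omega0 X 0 z) * (pw omega0 0 (-1) z * Hs phi alpha theta z))%C) =
  (- (1) * Uint (fun z => (Cexp (pw omega0 X 0 z) * (pw omega0 0 1 z * Hs phi alpha theta z))%C))%C).
{ apply is_U_unique. eapply is_U_ext; [|apply is_U_mult_l, U1]. intros z _. cbv beta. unfold pw.
  replace (RtoC (-1)) with (- (1))%C by (apply C_ext; cbn; ring). ring. }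
pose proof (is_derive_wave omega0 phi alpha theta X 0 1 0 Hw Hphi HX) as D1.
pose proof (is_derive_wave omega0 phi alpha theta X 0 (-1) 0 Hw Hphi HX) as D2.
rewrite E in D2.
pose proof (is_derive_plus (K := R_AbsRing) (V := CN) _ _ _ _ _ D1 D2) as D.
evar_last.
- eapply (is_derive_ext (K := R_AbsRing) (V := CN)); [|exact D]. intros t. cbv beta.
  rewrite !Rminus_0_r, !Rmult_0_r, !Rplus_0_r, Rmult_1_r.
  replace (t * -1) with (- t) by ring. reflexivity.
- set (u := Uint _). clearbody u. apply C_ext; unfold plus; cbn; ring.
Qed.

(** V extends the amplitude evenly across the ray. It is differentiable at 0 from both sides, with
    V'(0) = 0 by parity, and the one-sided quotient of the amplitude is a quotient of V. The sign sg
    tells on which side of the ray Q lies: 1 at theta = phi, - 1 at theta = 2 pi. *)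
Lemma normal_derive_boundary (omega0 phi alpha theta sg X : R) (n : R * R) :
  0 < omega0 -> 0 < phi < PI -> has_wave_representation omega0 phi alpha -> 0 < X ->
  (forall z, Hs phi alpha (4 * PI - theta) z = Hs phi alpha theta z) ->
  sg = 1 \/ sg = -1 ->
  (forall d, 0 <= d <= 2 * PI - phi -> phi <= theta + sg * d <= 2 * PI) ->
  (forall h, (fst (polar X theta) - h * fst n, snd (polar X theta) - h * snd n) = rotated theta X (sg * h)) ->
  is_normal_derive (A_inf_at omega0 phi alpha) (polar X theta) n 0%C.
Proof.
intros Hw Hphi Hrep HX Hsym Hsg Hin Hn. pose proof PI_RGT_0 as Hpi.
set (V := fun t => (Ci / (4 * Phi phi)%R * (wave omega0 phi alpha theta X t + wave omega0 phi alpha theta X (- t)))%C).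
assert (HV : is_Cderive V 0 (RtoC 0)).
{ replace (RtoC 0) with (Ci / (4 * Phi phi)%R * 0)%C by ring.
  apply is_Cderive_mult_l. now apply even_wave_derive. }
assert (Hloc : at_right 0 (fun h => 0 < h /\
  A_inf_at omega0 phi alpha (fst (polar X theta) - h * fst n, snd (polar X theta) - h * snd n) = V h)).
{ assert (He : 0 < PI / 8) by lra.
  pose proof (atan_near X 0 1 0 (PI / 8) HX He) as [e Hl]. exists e. intros h Hh Hpos. split; [exact Hpos|].
  specialize (Hl h Hh). rewrite !Rminus_0_r, Rmult_0_r, Rplus_0_r, Rmult_1_r in Hl. destruct Hl as [_ Hl].
  assert (Ha : 0 < atan (h / X)).
  { rewrite <- atan_0. apply atan_increasing. apply Rdiv_lt_0_compat; assumption. }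
  rewrite Rabs_pos_eq in Hl by lra.
  assert (Ea : atan (sg * h / X) = sg * atan (h / X)).
  { destruct Hsg as [-> | ->].
    - now rewrite !Rmult_1_l.
    - replace (-1 * h / X) with (- (h / X)) by (field; lra). rewrite atan_opp. ring. }
  rewrite Hn, A_inf_at_local; try assumption.
  - assert (Ew : forall X Y, wave omega0 phi alpha (4 * PI - theta) X Y = wave omega0 phi alpha theta X Y).
    { intros X' Y'. unfold wave. f_equal. extensionality z. now rewrite Hsym. }
    rewrite Ew. unfold V. destruct Hsg as [-> | ->].
    + now rewrite Rmult_1_l.
    + replace (-1 * h) with (- h) by ring. rewrite Ropp_involutive. now rewrite (Cplus_comm (wave _ _ _ _ _ (- h))).
  - rewrite Ea, Rabs_mult. rewrite (Rabs_pos_eq (atan _)) by lra.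
    destruct Hsg as [-> | ->]; [rewrite Rabs_R1|replace (-1) with (- (1)) by ring; rewrite Rabs_Ropp, Rabs_R1]; lra.
  - rewrite Ea. apply Hin. lra. }
assert (H0 : A_inf_at omega0 phi alpha (polar X theta) = V 0).
{ replace (polar X theta) with (rotated theta X 0) by (unfold rotated, polar; f_equal; ring).
  assert (E0 : atan (0 / X) = 0) by (unfold Rdiv; rewrite Rmult_0_l; apply atan_0).
  rewrite A_inf_at_local; try assumption.
  - unfold V. assert (Ew : wave omega0 phi alpha (4 * PI - theta) X (- 0) = wave omega0 phi alpha theta X (- 0)).
    { unfold wave. f_equal. extensionality z. now rewrite Hsym. }
    now rewrite Ew.
  - rewrite E0, Rabs_R0. lra.
  - rewrite E0. specialize (Hin 0 ltac:(lra)). lra. }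
unfold is_normal_derive. apply filterlim_C_Cmod; [apply at_right_proper_filter|].
intros eps Heps.
destruct (proj1 (is_Cderive_spec V 0 (RtoC 0)) HV (eps / 2) ltac:(lra)) as (d & Hd & Hb).
assert (Hr : at_right 0 (fun h => 0 < h < d)).
{ exists (mkposreal d Hd). intros h Hh Hpos. split; [exact Hpos|].
  change (Rabs (h - 0) < d) in Hh. rewrite Rminus_0_r, Rabs_pos_eq in Hh; lra. }
generalize (filter_and _ _ Hloc Hr). apply filter_imp. intros h [[Hpos Eh] [_ Hlt]].
rewrite Eh, H0. specialize (Hb h ltac:(rewrite Rminus_0_r, Rabs_pos_eq; lra)).
rewrite Rminus_0_r, Rabs_pos_eq in Hb by lra.
assert (Hh0 : RtoC h <> 0%C) by (intros E; apply RtoC_inj in E; lra).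
replace ((V 0 - V h) / h - 0)%C with (- (V h - V 0 - h * 0) / h)%C by (field; exact Hh0).
rewrite Cmod_div, Cmod_opp, Cmod_R, (Rabs_pos_eq h) by (try exact Hh0; lra).
apply (Rle_lt_trans _ (eps / 2 * h / h)); [|replace (eps / 2 * h / h) with (eps / 2) by (field; lra); lra].
unfold Rdiv at 1 2. apply Rmult_le_compat_r; [left; now apply Rinv_0_lt_compat|exact Hb].
Qed.

(** On both edges theta and 4 pi - theta give the same weight: they coincide at theta = 2 pi, and at
    theta = phi they differ by 4 pi - 2 phi = 2 Phi, a period. *)
Lemma normal_derive_A_inf (omega0 phi alpha rho : R) :
  0 < omega0 -> 0 < phi < PI -> has_wave_representation omega0 phi alpha -> 0 < rho ->
  is_normal_derive (A_inf_at omega0 phi alpha) (polar rho phi) (normal_phi phi) 0%C /\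
  is_normal_derive (A_inf_at omega0 phi alpha) (polar rho (2 * PI)) normal_2PI 0%C.
Proof.
intros Hw Hphi Hrep Hr. split.
- apply (normal_derive_boundary omega0 phi alpha phi 1 rho); try assumption.
  + intros z. rewrite <- (Hs_period phi alpha phi) by assumption. f_equal. unfold Phi. ring.
  + now left.
  + intros d Hd. lra.
  + intros h. unfold polar, rotated, normal_phi. cbn [fst snd]. f_equal; ring.
- apply (normal_derive_boundary omega0 phi alpha (2 * PI) (-1) rho); try assumption.
  + intros z. f_equal. ring.
  + now right.
  + intros d Hd. lra.
  + intros h. unfold polar, rotated, normal_2PI. cbn [fst snd]. rewrite cos_2PI, sin_2PI. f_equal; ring.
Qed.

(** * The contour integral and the diffracted amplitude *)

Definition wave_integrand (omega0 phi alpha rho theta : R) (z : C) : C :=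
  (Cexp (pw omega0 rho 0 z) * Hs phi alpha theta z)%C.

Lemma contour_integrand_wave (omega0 phi alpha rho theta : R) :
  contour_integrand omega0 phi alpha rho theta = wave_integrand omega0 phi alpha rho theta.
Proof.
extensionality z. unfold contour_integrand, wave_integrand, Hs.
f_equal. f_equal. unfold pw. rewrite RtoC_mult. ring.
Qed.

(** The reflection z -> - z - 3 i pi exchanges the two halves of the contour. *)
Lemma wave_integrand_reflect (omega0 phi alpha rho theta x y : R) :
  wave_integrand omega0 phi alpha rho theta ((- x)%R, (- y - 3 * PI)%R) =
  (- wave_integrand omega0 phi alpha rho (4 * PI - theta) (x, y))%C.
Proof.
unfold wave_integrand. rewrite <- Hs_reflect.
replace (pw omega0 rho 0 ((- x)%R, (- y - 3 * PI)%R)) with (pw omega0 rho 0 (x, y)).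
- ring.
- unfold pw. rewrite Csinh_shift_3pi. ring.
Qed.

Lemma is_half_reflect (f : R -> C) (a : R) (l : C) :
  is_half f a l -> is_RInt_gen (V := CN) (fun s => f (- s)) (Rbar_locally m_infty) (at_point (- a)) l.
Proof.
intros H P HP. destruct (H P HP) as [Q S HQ HS HQS].
apply (Filter_prod _ _ _ (fun x => S (- x)) (fun y => y = - a)).
- destruct HS as [N HN]. exists (- N). intros x Hx. apply HN. lra.
- reflexivity.
- intros x y Hx ->. destruct (HQS a (- x) HQ Hx) as (v & Hv & Pv). exists v. split; [|exact Pv].
  cbn [fst snd] in *.
  pose proof (is_CRInt_reflect (fun t => f t) 0 (- a) x v) as Hr.
  rewrite !Rminus_0_l, Ropp_involutive in Hr. specialize (Hr Hv). apply is_CRInt_swap in Hr.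
  replace v with (- - v)%C by ring.
  eapply is_RInt_ext; [|exact Hr]. intros t _. cbv beta. now rewrite Rminus_0_l.
Qed.

Lemma proper_at_point (a : R) : ProperFilter' (@at_point R_UniformSpace a).
Proof. exact (Proper_StrongProper _ (at_point_filter a)). Qed.

Lemma proper_Rbar_locally (x : Rbar) : ProperFilter' (Rbar_locally x).
Proof. exact (Proper_StrongProper _ (Rbar_locally_filter x)). Qed.

Lemma proper_end_filter (x : Rbar) : ProperFilter' (end_filter x).
Proof. destruct x; [apply proper_at_point|apply proper_Rbar_locally|apply proper_Rbar_locally]. Qed.

Definition is_line_int (F : C -> C) (l : line) (v : C) : Prop :=
  is_RInt_gen (V := CN) (line_integrand F l) (end_filter (start l)) (end_filter (stop l)) v.

Lemma is_line_int_unique (F : C -> C) (l : line) (v : C) : is_line_int F l v ->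
  RInt_gen (V := CV) (line_integrand F l) (end_filter (start l)) (end_filter (stop l)) = v.
Proof.
exact (@is_RInt_gen_unique CV _ _ (proper_end_filter _) (proper_end_filter _) (line_integrand F l) v).
Qed.

Lemma line_integrand_horizontal (F : C -> C) (y : R) (a b : Rbar) :
  line_integrand F (Line (0, y)%R 1 a b) = fun s => F (s, y).
Proof.
extensionality s. unfold line_integrand. cbn [base dir].
rewrite Cmult_1_r. f_equal. apply C_ext; cbn; ring.
Qed.

Lemma line_integrand_vertical (F : C -> C) (x : R) (a b : Rbar) :
  line_integrand F (Line (RtoC x) Ci a b) = fun s => (Ci * F (x, s))%C.
Proof.
extensionality s. unfold line_integrand. cbn [base dir].
rewrite Cmult_comm. do 2 f_equal. apply C_ext; cbn; ring.
Qed.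

(** The heights - 11 pi/4 and - 3 pi/4 of the left half are the images of - pi/4 and - 9 pi/4 under
    y -> - y - 3 pi, and the reflection respects the orientations. It changes the sign of dz, and F
    contributes another sign, so both halves are counted with a plus. *)
Lemma contour_C1_plus (F G : C -> C) (u v : C) :
  (forall x y, F ((- x)%R, (- y - 3 * PI)%R) = (- G (x, y))%C) ->
  is_U F u -> is_U G v ->
  contour_converges F C1_plus /\ contour_int F C1_plus = (u + v)%C.
Proof.
intros HFG (l0 & l1 & m & H0 & H1 & Hm & ->) (g0 & g1 & n & K0 & K1 & Hn & ->).
assert (FA : Filter (@at_point R_UniformSpace 1)) by apply at_point_filter.
assert (FA' : Filter (@at_point R_UniformSpace (-1))) by apply at_point_filter.
assert (FP : Filter (Rbar_locally p_infty)) by apply Rbar_locally_filter.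
assert (FM : Filter (Rbar_locally m_infty)) by apply Rbar_locally_filter.
assert (L1 : is_line_int F (Line (0, - (PI / 4))%R 1 p_infty 1) (- l0)%C).
{ unfold is_line_int. rewrite line_integrand_horizontal.
  exact (@is_RInt_gen_swap CN (Rbar_locally p_infty) (at_point 1) FP FA _ _ H0). }
assert (L2 : is_line_int F (Line 1 Ci (- (PI / 4)) (- (9 * PI / 4))) (Ci * - m)%C).
{ unfold is_line_int. rewrite line_integrand_vertical.
  apply (is_RInt_gen_at_point (V := CN)). apply is_CRInt_mult_l, is_CRInt_swap, Hm. }
assert (L3 : is_line_int F (Line (0, - (9 * PI / 4))%R 1 1 p_infty) l1).
{ unfold is_line_int. rewrite line_integrand_horizontal. exact H1. }
assert (E : forall y s, F (s, - y - 3 * PI) = (- (1) * G ((- s)%R, y))%C).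
{ intros y s. replace s with (- - s) at 1 by ring. rewrite HFG. ring. }
assert (L4 : is_line_int F (Line (0, - (11 * PI / 4))%R 1 m_infty (-1)) (- (1) * g0)%C).
{ unfold is_line_int. rewrite line_integrand_horizontal.
  replace (- (11 * PI / 4)) with (- y_top - 3 * PI) by field.
  replace (fun s => F (s, - y_top - 3 * PI)) with (fun s => (- (1) * G ((- s)%R, y_top))%C)
    by (extensionality s; now rewrite E).
  exact (is_half_reflect _ 1 _ (is_half_mult_l (- (1)) _ _ _ K0)). }
assert (L6 : is_line_int F (Line (0, - (3 * PI / 4))%R 1 (-1) m_infty) (- (- (1) * g1))%C).
{ unfold is_line_int. rewrite line_integrand_horizontal.
  replace (- (3 * PI / 4)) with (- y_bot - 3 * PI) by field.
  replace (fun s => F (s, - y_bot - 3 * PI)) with (fun s => (- (1) * G ((- s)%R, y_bot))%C)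
    by (extensionality s; now rewrite E).
  refine (@is_RInt_gen_swap CN (at_point (-1)) (Rbar_locally m_infty) FA' FM _ _ _).
  exact (is_half_reflect _ 1 _ (is_half_mult_l (- (1)) _ _ _ K1)). }
assert (L5 : is_line_int F (Line (-1) Ci (- (11 * PI / 4)) (- (3 * PI / 4))) (Ci * (- (1) * (- - n)))%C).
{ unfold is_line_int.
  replace (- (1))%C with (RtoC (- (1))) by (apply C_ext; cbn; ring).
  rewrite line_integrand_vertical.
  apply (is_RInt_gen_at_point (V := CN)). apply is_CRInt_mult_l.
  replace (RtoC (- (1))) with (- (1))%C by (apply C_ext; cbn; ring).
  apply (is_RInt_ext (V := CN) (fun s => (- (1) * G (1%R, (- (3 * PI)) - s)%R)%C)).
  { intros s _. pose proof (E (- (3 * PI) - s) (- (1))) as Es. rewrite (Ropp_involutive 1) in Es.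
    rewrite <- Es. do 2 f_equal. ring. }
  apply is_CRInt_mult_l, (is_CRInt_reflect (fun t => G (1%R, t))).
  replace (- (3 * PI) - - (11 * PI / 4)) with y_top by field.
  replace (- (3 * PI) - - (3 * PI / 4)) with y_bot by field.
  now apply is_CRInt_swap. }
split.
- repeat (apply Forall_cons; [eexists; eassumption|]). apply Forall_nil.
- unfold contour_int, C1_plus. cbn [fold_right].
  rewrite (is_line_int_unique _ _ _ L1), (is_line_int_unique _ _ _ L2), (is_line_int_unique _ _ _ L3),
    (is_line_int_unique _ _ _ L4), (is_line_int_unique _ _ _ L5), (is_line_int_unique _ _ _ L6). ring.
Qed.

Lemma contour_wave (omega0 phi alpha rho theta : R) : 0 < omega0 -> 0 < phi < PI -> 0 < rho ->
  contour_converges (contour_integrand omega0 phi alpha rho theta) C1_plus /\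
  contour_int (contour_integrand omega0 phi alpha rho theta) C1_plus =
  (wave omega0 phi alpha theta rho 0 + wave omega0 phi alpha (4 * PI - theta) rho 0)%C.
Proof.
intros Hw Hphi Hr. rewrite contour_integrand_wave.
apply (contour_C1_plus _ (wave_integrand omega0 phi alpha rho (4 * PI - theta))).
- intros x y. apply wave_integrand_reflect.
- now apply is_U_wave.
- now apply is_U_wave.
Qed.

(** On Im z = - pi/2 and on Im z = - 5 pi/2 one has sinh z = - i cosh x, so the exponential becomes
    e^{i omega0 rho cosh x}. *)
Lemma A_d_integrand_wave (omega0 phi alpha rho theta x : R) :
  A_d_integrand omega0 phi alpha rho theta x =
  (wave_integrand omega0 phi alpha rho theta (x, - (5 * PI / 2))%R
   - wave_integrand omega0 phi alpha rho theta (x, - (PI / 2))%R)%C.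
Proof.
unfold A_d_integrand, Z_N, wave_integrand.
assert (H : forall y, cos y = 0 -> sin y = -1 ->
  Cexp (pw omega0 rho 0 (x, y)) = cis (omega0 * rho * cosh x)).
{ intros y Hc Hs. unfold cis, pw. rewrite Csinh_pair, Ccosh_pair, Hc, Hs. f_equal. apply C_ext; cbn; ring. }
rewrite !H.
- assert (E : forall y, Hs phi alpha theta (x, - y) = H_N phi alpha (x + Ci * theta - Ci * y)%C).
  { intros y. unfold Hs. f_equal. apply C_ext; cbn; ring. }
  rewrite !E. ring.
- rewrite cos_neg. apply cos_PI2.
- rewrite sin_neg, sin_PI2. reflexivity.
- rewrite cos_neg. replace (5 * PI / 2) with (PI / 2 + 2 * INR 1 * PI) by (cbn; field).
  rewrite cos_period. apply cos_PI2.
- rewrite sin_neg. replace (5 * PI / 2) with (PI / 2 + 2 * INR 1 * PI) by (cbn; field).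
  rewrite sin_period, sin_PI2. reflexivity.
Qed.

Lemma A_d_integrand_reflect (omega0 phi alpha rho theta x : R) :
  A_d_integrand omega0 phi alpha rho theta (- x) = A_d_integrand omega0 phi alpha rho (4 * PI - theta) x.
Proof.
rewrite !A_d_integrand_wave.
replace (- (5 * PI / 2)) with (- (- (PI / 2)) - 3 * PI) at 1 by field.
replace (- (PI / 2)) with (- (- (5 * PI / 2)) - 3 * PI) at 2 by field.
rewrite !wave_integrand_reflect. ring.
Qed.

Lemma Cmod_cis (x : R) : Cmod (cis x) = 1.
Proof.
unfold cis. rewrite Cmod_Cexp. replace (fst (Ci * x)%C) with 0 by (cbn; ring). apply exp_0.
Qed.

(** Each coth tends to 1 at rate e^{- 2 q x}, and in [Z_N] these limits cancel: two kernels enter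
    with a plus sign and two with a minus sign. *)
Lemma A_d_integrand_decay (omega0 phi alpha rho theta : R) : 0 < phi < PI ->
  exists K, 0 <= K /\ forall x, 1 <= x ->
    Cmod (A_d_integrand omega0 phi alpha rho theta x) <= K * exp (- (2 * qq phi) * x).
Proof.
intros Hphi. pose proof (qq_pos phi Hphi) as Hq. set (q := qq phi) in *.
set (K := 2 / (1 - exp (- 2 * q))).
assert (HK : 0 <= K).
{ assert (exp (- 2 * q) < 1) by (rewrite <- exp_0; apply exp_increasing; lra).
  apply Rdiv_le_0_compat; lra. }
exists (4 * K). split; [lra|]. intros x Hx. unfold A_d_integrand. rewrite Cmod_mult, Cmod_cis, Rmult_1_l.
assert (Hk : forall c y, Cmod (kc q c (x, y) - 1) <= K * exp (- (2 * q) * x)).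
{ intros c y. unfold kc. cbn [fst snd]. replace (- (2 * q) * x) with (- 2 * (q * x)) by ring.
  apply Ccoth_minus_1_bound; [exact Hq|nra]. }
assert (E : forall y : R, H_N phi alpha (x + Ci * theta - Ci * y)%C = Hs phi alpha theta (x, - y)%R).
{ intros y. unfold Hs. f_equal. apply C_ext; cbn; ring. }
unfold Z_N. rewrite !E, !Hs_kc. fold q.
set (c1 := alpha - PI / 2 - theta). set (c2 := 3 * PI / 2 - alpha - theta).
pose proof (Hk c1 (- (5 * PI / 2))) as H1. pose proof (Hk c2 (- (5 * PI / 2))) as H2.
pose proof (Hk c1 (- (PI / 2))) as H3. pose proof (Hk c2 (- (PI / 2))) as H4.
set (k1 := kc q c1 (x, - (5 * PI / 2))) in *. set (k2 := kc q c2 (x, - (5 * PI / 2))) in *.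
set (k3 := kc q c1 (x, - (PI / 2))) in *. set (k4 := kc q c2 (x, - (PI / 2))) in *.
replace (k1 + k2 - (k3 + k4))%C with ((k1 - 1) + ((k2 - 1) + (- (k3 - 1) + - (k4 - 1))))%C by ring.
eapply Rle_trans; [apply Cmod_triangle|].
eapply Rle_trans; [apply Rplus_le_compat_l, Cmod_triangle|].
eapply Rle_trans; [apply Rplus_le_compat_l, Rplus_le_compat_l, Cmod_triangle|].
rewrite !Cmod_opp. lra.
Qed.

Lemma sin_ge_half (u : R) : 0 <= u <= PI / 4 -> u / 2 <= sin u.
Proof.
intros Hu. destruct (proj1 Hu) as [H| <-]; [|rewrite sin_0; lra].
pose proof PI_RGT_0 as Hpi.
destruct (MVT_cor2 sin cos 0 u H) as (c & Hc & Hc2).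
{ intros c _. apply derivable_pt_lim_sin. }
rewrite sin_0 in Hc. pose proof cos_PI4_pos.
assert (cos (PI / 4) <= cos c) by (apply cos_decr_1; lra). nra.
Qed.

(** Jordan's estimate for the short vertical sides, on which cos vanishes at the lower end [a]. *)
Lemma jordan_side (omega0 phi alpha rho theta a : R) :
  0 < omega0 -> 0 < phi < PI -> 0 < rho -> (forall u, cos (a + u) = sin u) ->
  forall eps, 0 < eps -> exists N, forall L, 1 <= L -> N <= L ->
    Cmod (CRInt (fun y => wave_integrand omega0 phi alpha rho theta (L, y)) a (a + PI / 4)) < eps.
Proof.
intros Hw Hphi Hr Ha eps Heps. pose proof PI_RGT_0 as Hpi.
set (M := 2 * (1 + / sinh (qq phi))).
assert (HM : 0 < M).
{ pose proof (sinh_pos _ (qq_pos phi Hphi)) as Hs. apply Rinv_0_lt_compat in Hs. unfold M. lra. }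
(* sin u >= u/2 bounds the side by M/c with c = omega0 rho sinh L / 2, and sinh L > L - 1. *)
exists (2 * (M / (omega0 * rho / 2)) / eps + 1). intros L HL1 HL.
assert (Hwr : 0 < omega0 * rho) by nra.
assert (HsL : L - 1 < sinh L).
{ pose proof (sinh_ge_exp L ltac:(lra)). pose proof (exp_ineq1 (L / 2) ltac:(lra)) as He.
  assert (exp L = exp (L / 2) * exp (L / 2)) by (rewrite <- exp_plus; f_equal; lra).
  assert ((1 + L / 2) * (1 + L / 2) < exp (L / 2) * exp (L / 2)) by (apply Rmult_le_0_lt_compat; lra).
  pose proof (pow2_ge_0 (L - 2)). nra. }
set (c := omega0 * rho * sinh L / 2).
assert (HS : 0 < sinh L) by (apply sinh_pos; lra).
assert (Hc : 0 < c) by (unfold c; nra).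
assert (Han := analytic_on_Hs phi alpha theta Hphi).
assert (I : is_CRInt (fun y => wave_integrand omega0 phi alpha rho theta (L, y)) a (a + PI / 4)
  (CRInt (fun y => wave_integrand omega0 phi alpha rho theta (L, y)) a (a + PI / 4))).
{ apply CRInt_correct, ex_CRInt_continuous. intros y _. apply continuous_vertical.
  apply continuous_Cmult; [apply continuous_Cexp, pw_continuous|].
  apply (analytic_on_continuous _ _ _ Han). cbn; lra. }
eapply Rle_lt_trans.
- eapply (is_CRInt_bound (fun y => wave_integrand omega0 phi alpha rho theta (L, y))
    (fun y => (M * exp (c * a)) * exp (- c * y)) a (a + PI / 4)); [lra| |exact I|].
  + intros y Hy. unfold wave_integrand. rewrite Cmod_mult, Cmod_Cexp, pw_fst.
    replace y with (a + (y - a)) at 1 by ring. rewrite Ha.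
    pose proof (sin_ge_half (y - a) ltac:(lra)) as Hsin.
    replace (M * exp (c * a) * exp (- c * y)) with (exp (c * a + - c * y) * M) by (rewrite exp_plus; ring).
    apply Rmult_le_compat; [left; apply exp_pos|apply Cmod_ge_0| |apply Hs_bound; [exact Hphi|exact HL1]].
    apply exp_le. unfold c.
    assert (omega0 * rho * sinh L * ((y - a) / 2) <= omega0 * rho * sinh L * sin (y - a))
      by (apply Rmult_le_compat_l; nra). nra.
  + apply is_RInt_exp_decay, Hc.
- rewrite Rmult_assoc, <- exp_plus.
  replace (c * a + - c * a) with 0 by ring. rewrite exp_0, Rmult_1_r.
  assert (0 <= M * exp (c * a) * exp (- c * (a + PI / 4)) / c).
  { apply Rdiv_le_0_compat; [|exact Hc]. apply Rmult_le_pos; [apply Rmult_le_pos|]; try lra; left; apply exp_pos. }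
  assert (HX : 0 < M / (omega0 * rho / 2)) by (apply Rdiv_lt_0_compat; lra).
  assert (HN : 2 * (M / (omega0 * rho / 2)) / eps < sinh L) by lra.
  assert (HB : M / c = M / (omega0 * rho / 2) / sinh L) by (unfold c; field; lra).
  assert (M / c < eps).
  { rewrite HB. apply (Rmult_lt_reg_r (sinh L)); [exact HS|]. unfold Rdiv at 1. rewrite Rmult_assoc, Rinv_l, Rmult_1_r by lra.
    apply (Rmult_lt_compat_r eps) in HN; [|exact Heps]. unfold Rdiv at 1 in HN.
    rewrite Rmult_assoc, Rinv_l, Rmult_1_r in HN by lra. lra. }
  lra.
Qed.

Lemma cos_shift_PI2 (u : R) : cos (- (PI / 2) + u) = sin u.
Proof. replace (- (PI / 2) + u) with (- (PI / 2 - u)) by ring. rewrite cos_neg. apply cos_shift. Qed.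

Lemma cos_shift_5PI2 (u : R) : cos (- (5 * PI / 2) + u) = sin u.
Proof.
replace (- (5 * PI / 2) + u) with (- ((PI / 2 - u) + 2 * INR 1 * PI)) by (cbn; field).
rewrite cos_neg, cos_period. apply cos_shift.
Qed.

(** Pushing the horizontal pieces of the right half of the contour to the lines Im = - pi/2 and Im = - 5 pi/2,
    on which the integrand only oscillates. *)
Lemma A_d_half_line (omega0 phi alpha rho theta : R) (d : C) :
  0 < omega0 -> 0 < phi < PI -> 0 < rho ->
  is_half (A_d_integrand omega0 phi alpha rho theta) 1 d ->
  d = (wave omega0 phi alpha theta rho 0
       + Ci * CRInt (fun y => wave_integrand omega0 phi alpha rho theta (1%R, y)) (- (5 * PI / 2)) (- (PI / 2)))%C.
Proof.
intros Hw Hphi Hr Hd. pose proof PI_RGT_0 as Hpi.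
set (F := wave_integrand omega0 phi alpha rho theta).
assert (HF : analytic_on (fun z => 0 < fst z) F).
{ apply analytic_on_mult; [apply analytic_on_Cexp, analytic_on_pw|now apply analytic_on_Hs]. }
assert (Hx : forall y b, 1 <= b -> ex_CRInt (fun x => F (x, y)) 1 b).
{ intros y b Hb. apply ex_CRInt_continuous. intros x Hx. rewrite Rmin_left in Hx by lra.
  apply continuous_horizontal, (analytic_on_continuous _ _ _ HF). cbn; lra. }
assert (Hv : forall a b, ex_CRInt (fun y => F (1, y)) a b).
{ intros a b. apply ex_CRInt_continuous. intros y _.
  apply continuous_vertical, (analytic_on_continuous _ _ _ HF). cbn; lra. }
destruct (is_U_wave omega0 phi alpha theta rho Hw Hphi Hr) as (l0 & l1 & m & H0 & H1 & Hm & ->).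
change (is_half (fun x => F (x, y_top)) 1 l0) in H0. change (is_half (fun x => F (x, y_bot)) 1 l1) in H1.
change (is_CRInt (fun y => F (1, y)) y_bot y_top m) in Hm.
apply is_CRInt_unique in Hm. subst m.
assert (ED : A_d_integrand omega0 phi alpha rho theta = fun x => (F (x, - (5 * PI / 2))%R - F (x, - (PI / 2))%R)%C).
{ extensionality x. apply A_d_integrand_wave. }
rewrite ED in Hd.
assert (HD : forall b, 1 <= b -> is_CRInt (fun x => (F (x, - (5 * PI / 2))%R - F (x, - (PI / 2))%R)%C) 1 b
  (CRInt (fun x => F (x, - (5 * PI / 2))%R) 1 b - CRInt (fun x => F (x, - (PI / 2))%R) 1 b)%C).
{ intros b Hb. apply is_CRInt_minus; apply CRInt_correct, Hx, Hb. }
apply is_half_lim in Hd; [|intros b Hb; eexists; now apply HD].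
apply is_half_lim in H0; [|intros; apply Hx; lra]. apply is_half_lim in H1; [|intros; apply Hx; lra].
pose proof (proj1 (filterlim_C_Cmod _ _ _ _ _) Hd) as Ld.
pose proof (proj1 (filterlim_C_Cmod _ _ _ _ _) H0) as Ll0.
pose proof (proj1 (filterlim_C_Cmod _ _ _ _ _) H1) as Ll1.
set (v1 := CRInt (fun y => F (1, y)) (- (5 * PI / 2)) (- (5 * PI / 2) + PI / 4)).
set (v2 := CRInt (fun y => F (1, y)) (- (PI / 2)) (- (PI / 2) + PI / 4)).
set (vm := CRInt (fun y => F (1, y)) y_bot y_top).
assert (Ev : CRInt (fun y => F (1, y)) (- (5 * PI / 2)) (- (PI / 2)) = (v1 + vm - v2)%C).
{ assert (E1 := CRInt_Chasles (fun y => F (1, y)) (- (5 * PI / 2)) y_bot y_top (Hv _ _) (Hv _ _)).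
  assert (E2 := CRInt_Chasles (fun y => F (1, y)) (- (5 * PI / 2)) (- (PI / 2)) y_top (Hv _ _) (Hv _ _)).
  fold vm in E1. unfold v1, v2.
  replace (- (5 * PI / 2) + PI / 4) with y_bot by field. replace (- (PI / 2) + PI / 4) with y_top by field.
  rewrite E1 in E2.
  set (a := CRInt (fun y => F (1, y)) (- (5 * PI / 2)) (- (PI / 2))) in *.
  set (b := CRInt (fun y => F (1, y)) (- (PI / 2)) y_top) in *.
  replace a with (a + b - b)%C by ring. rewrite <- E2. ring. }
rewrite Ev.
assert (Hz : (d - (l1 - l0 - Ci * vm + Ci * (v1 + vm - v2)))%C = RtoC 0).
{ apply Cmod_eq_0, Rle_antisym; [|apply Cmod_ge_0].
  apply Rle_plus_epsilon. intros eps Heps. rewrite Rplus_0_l.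
  (* Five errors: three truncations and the two short sides at Re z = b. *)
  destruct (Ld (eps / 5) ltac:(lra)) as [N1 HN1].
  destruct (Ll0 (eps / 5) ltac:(lra)) as [N2 HN2].
  destruct (Ll1 (eps / 5) ltac:(lra)) as [N3 HN3].
  destruct (jordan_side omega0 phi alpha rho theta _ Hw Hphi Hr cos_shift_PI2 (eps / 5) ltac:(lra)) as [N4 HN4].
  destruct (jordan_side omega0 phi alpha rho theta _ Hw Hphi Hr cos_shift_5PI2 (eps / 5) ltac:(lra)) as [N5 HN5].
  set (b := 2 + Rabs N1 + Rabs N2 + Rabs N3 + Rabs N4 + Rabs N5).
  pose proof (Rle_abs N1). pose proof (Rle_abs N2). pose proof (Rle_abs N3). pose proof (Rle_abs N4). pose proof (Rle_abs N5).
  pose proof (Rabs_pos N1). pose proof (Rabs_pos N2). pose proof (Rabs_pos N3). pose proof (Rabs_pos N4). pose proof (Rabs_pos N5).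
  assert (Hb : 1 <= b) by (unfold b; lra).
  specialize (HN1 b ltac:(unfold b; lra)). specialize (HN2 b ltac:(unfold b; lra)). specialize (HN3 b ltac:(unfold b; lra)).
  specialize (HN4 b Hb ltac:(unfold b; lra)). specialize (HN5 b Hb ltac:(unfold b; lra)).
  cbv beta in HN1, HN2, HN3.
  rewrite (is_CRInt_unique _ _ _ _ (HD b Hb)) in HN1.
  assert (HF' : forall c d, analytic_on (open_rect 0 (b + 1) c d) F).
  { intros c' d'. eapply analytic_on_subset; [|exact HF]. intros z [Hz _]. lra. }
  pose proof (cauchy_rectangle F 0 1 b (b + 1) (- (PI / 2) - 1) (- (PI / 2)) (- (PI / 2) + PI / 4) 0
    ltac:(lra) Hb ltac:(lra) ltac:(lra) ltac:(lra) ltac:(lra) (HF' _ _)) as G2.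
  pose proof (cauchy_rectangle F 0 1 b (b + 1) (- (5 * PI / 2) - 1) (- (5 * PI / 2)) (- (5 * PI / 2) + PI / 4) 0
    ltac:(lra) Hb ltac:(lra) ltac:(lra) ltac:(lra) ltac:(lra) (HF' _ _)) as G1.
  fold v1 in G1. fold v2 in G2. fold F in HN4, HN5.
  replace (fun x => F (x, - (PI / 2) + PI / 4)) with (fun x => F (x, y_top)) in G2
    by (extensionality x; do 2 f_equal; field).
  replace (fun x => F (x, - (5 * PI / 2) + PI / 4)) with (fun x => F (x, y_bot)) in G1
    by (extensionality x; do 2 f_equal; field).
  set (j0 := CRInt (fun x => F (x, y_top)) 1 b) in *. set (j1 := CRInt (fun x => F (x, y_bot)) 1 b) in *.
  set (k0 := CRInt (fun x => F (x, - (PI / 2))) 1 b) in *. set (k1 := CRInt (fun x => F (x, - (5 * PI / 2))) 1 b) in *.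
  set (w2 := CRInt (fun y => F (b, y)) (- (PI / 2)) (- (PI / 2) + PI / 4)) in *.
  set (w1 := CRInt (fun y => F (b, y)) (- (5 * PI / 2)) (- (5 * PI / 2) + PI / 4)) in *.
  replace (d - (l1 - l0 - Ci * vm + Ci * (v1 + vm - v2)))%C with
    (- (k1 - k0 - d) + ((j1 - l1) + (- (j0 - l0) + (Ci * w2 + - (Ci * w1)))))%C.
  - eapply Rle_trans; [apply Cmod_triangle|].
    eapply Rle_trans; [apply Rplus_le_compat_l, Cmod_triangle|].
    eapply Rle_trans; [apply Rplus_le_compat_l, Rplus_le_compat_l, Cmod_triangle|].
    eapply Rle_trans; [apply Rplus_le_compat_l, Rplus_le_compat_l, Rplus_le_compat_l, Cmod_triangle|].
    rewrite !Cmod_opp, !Cmod_mult, Cmod_Ci, !Rmult_1_l. lra.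
  - assert (E1 : j1 = (k1 + (j1 - k1))%C) by ring. rewrite G1 in E1.
    assert (E0 : j0 = (k0 + (j0 - k0))%C) by ring. rewrite G2 in E0.
    rewrite E1, E0. ring. }
replace d with (d - (l1 - l0 - Ci * vm + Ci * (v1 + vm - v2)) + (l1 - l0 - Ci * vm + Ci * (v1 + vm - v2)))%C by ring.
rewrite Hz. ring.
Qed.

(** * Residues in the central rectangle *)

Definition central_boundary (z : C) : Prop :=
  (snd z = - (5 * PI / 2) \/ snd z = - (PI / 2)) \/ (fst z = 1 \/ fst z = - (1)).

Lemma boundary_int_plus (F G : C -> C) :
  (forall z, central_boundary z -> continuousCC F z) ->
  (forall z, central_boundary z -> continuousCC G z) ->
  boundary_int (fun z => (F z + G z)%C) (- (1)) 1 (- (5 * PI / 2)) (- (PI / 2)) =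
  (boundary_int F (- (1)) 1 (- (5 * PI / 2)) (- (PI / 2)) +
   boundary_int G (- (1)) 1 (- (5 * PI / 2)) (- (PI / 2)))%C.
Proof.
intros HF HG.
assert (Hx : forall y, y = - (5 * PI / 2) \/ y = - (PI / 2) ->
  CRInt (fun x => (F (x, y) + G (x, y))%C) (- (1)) 1 =
  (CRInt (fun x => F (x, y)) (- (1)) 1 + CRInt (fun x => G (x, y)) (- (1)) 1)%C).
{ intros y Hy. apply is_CRInt_unique, is_CRInt_plus; apply CRInt_correct, ex_CRInt_continuous;
    intros x _; apply continuous_horizontal; [apply HF|apply HG]; left; exact Hy. }
assert (Hy : forall x, x = 1 \/ x = - (1) ->
  CRInt (fun y => (F (x, y) + G (x, y))%C) (- (5 * PI / 2)) (- (PI / 2)) =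
  (CRInt (fun y => F (x, y)) (- (5 * PI / 2)) (- (PI / 2)) + CRInt (fun y => G (x, y)) (- (5 * PI / 2)) (- (PI / 2)))%C).
{ intros x Hxx. apply is_CRInt_unique, is_CRInt_plus; apply CRInt_correct, ex_CRInt_continuous;
    intros y _; apply continuous_vertical; [apply HF|apply HG]; right; exact Hxx. }
unfold boundary_int. rewrite !Hx, !Hy by tauto. ring.
Qed.

(** Either i a lies in the open strip - 5 pi / 2 < Im < - pi / 2, or the closed
    strip lies strictly between the consecutive poles i a and i (a + 2 Phi). *)
Definition pole_off_boundary (phi a : R) : Prop :=
  (- (5 * PI / 2) < a < - (PI / 2)) \/ (a < - (5 * PI / 2) /\ - (PI / 2) - a < 2 * Phi phi).

Lemma kc_continuous_boundary (phi a : R) : 0 < phi < PI -> pole_off_boundary phi a ->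
  forall z, central_boundary z -> continuousCC (kc (qq phi) a) z.
Proof.
intros Hphi Ha z Hz. pose proof PI_RGT_0 as Hpi.
pose proof (qq_pos phi Hphi) as Hq. pose proof (qq_Phi phi Hphi) as HqP.
assert (H2P : 2 * PI < 2 * Phi phi) by (unfold Phi; lra).
refine (analytic_on_continuous central_boundary _ z (analytic_on_kc _ (qq phi) a _) Hz).
intros w [Hw|Hw].
- right. set (t := snd w - a).
  (* A horizontal edge is at a nonzero distance less than 2 Phi = pi/q from the height a, so it
     meets no pole of the kernel. *)
  assert (Ht : - (2 * Phi phi) < t < 2 * Phi phi /\ t <> 0).
  { unfold t. destruct Hw as [-> | ->]; destruct Ha; lra. }
  apply sin_neq_0_small.
  + rewrite <- HqP. split; nra.
  + destruct Ht as [_ Ht]. intros E. apply Rmult_integral in E. lra.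
- left. destruct Hw as [-> | ->]; lra.
Qed.

(** The pole that produces the incident wave: 0 < alpha < phi keeps it inside the strip for every
    theta. *)
Lemma pole_theta_first (phi alpha theta : R) : 0 < phi < PI ->
  Rmax (phi - PI / 2) 0 < alpha < Rmin (PI / 2) phi -> phi <= theta <= 2 * PI ->
  - (5 * PI / 2) < alpha - PI / 2 - theta < - (PI / 2).
Proof.
intros Hphi Ha Hth.
pose proof (Rmax_r (phi - PI / 2) 0). pose proof (Rmin_r (PI / 2) phi). lra.
Qed.

(** The poles are i (3 pi/2 - alpha - theta + 2 Phi k), and they move down as theta grows. The one
    with k = - 1 leaves the strip through Im z = - 5 pi/2 at theta = theta_1, the one with k = 0
    enters through Im z = - pi/2 at theta = theta_2, and in between the strip contains none. This is
    the origin of the three sectors of the reflected wave. *)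
Lemma pole_theta_second (phi alpha theta : R) : 0 < phi < PI ->
  Rmax (phi - PI / 2) 0 < alpha < Rmin (PI / 2) phi -> Theta phi alpha theta ->
  exists a, pole_off_boundary phi a /\
    (forall z, kc (qq phi) (3 * PI / 2 - alpha - theta) z = kc (qq phi) a z) /\
    ((theta < theta1 phi alpha /\ a = - (5 * PI / 2) + (theta1 phi alpha - theta)
        /\ - (5 * PI / 2) < a < - (PI / 2)) \/
     (theta1 phi alpha < theta < theta2 alpha /\ a < - (5 * PI / 2) /\ - (PI / 2) - a < 2 * Phi phi) \/
     (theta2 alpha < theta /\ a = - (PI / 2) + (theta2 alpha - theta)
        /\ - (5 * PI / 2) < a < - (PI / 2))).
Proof.
intros Hphi Ha (Hth & H1 & H2).
pose proof (Rmax_r (phi - PI / 2) 0). pose proof (Rmin_r (PI / 2) phi). pose proof (Rmin_l (PI / 2) phi).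
assert (Hper : forall z, kc (qq phi) (3 * PI / 2 - alpha - theta) z =
  kc (qq phi) (3 * PI / 2 - alpha - theta - 2 * Phi phi) z).
{ intros z. rewrite <- (kc_period _ (3 * PI / 2 - alpha - theta - 2 * Phi phi) (2 * Phi phi)) by now apply qq_Phi.
  f_equal. ring. }
unfold pole_off_boundary, theta1, theta2, Phi in *.
destruct (Rlt_dec theta (2 * phi - alpha)) as [D1|D1].
- exists (3 * PI / 2 - alpha - theta - 2 * (2 * PI - phi)).
  split; [left; lra|split; [exact Hper|left; lra]].
- destruct (Rlt_dec theta (2 * PI - alpha)) as [D2|D2].
  + exists (3 * PI / 2 - alpha - theta - 2 * (2 * PI - phi)).
    split; [right; lra|split; [exact Hper|right; left; lra]].
  + exists (3 * PI / 2 - alpha - theta).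
    split; [left; lra|split; [reflexivity|right; right; lra]].
Qed.

Lemma Cexp_pw_axis (omega0 rho a : R) : Cexp (pw omega0 rho 0 (0, a)) = cis (- (omega0 * rho * sin a)).
Proof.
unfold cis, pw. rewrite Csinh_pair, Ccosh_pair. f_equal.
unfold sinh, cosh. rewrite Ropp_0, exp_0. apply C_ext; cbn; field.
Qed.

(** q Phi = pi/2 makes the product of the prefactor, 2 pi i and the residue 1/q of the kernel equal
    to - 1, so that each pole yields a plane wave of amplitude one. *)
Lemma residue_factor (phi : R) (w : C) : 0 < phi < PI ->
  (Ci / (4 * Phi phi)%R * (2 * PI * Ci * (w / qq phi)) = - w)%C.
Proof.
intros Hphi. pose proof PI_RGT_0 as Hpi.
assert (Hq0 : RtoC (qq phi) <> 0%C) by (pose proof (qq_pos phi Hphi); intros E; apply RtoC_inj in E; lra).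
assert (HP0 : RtoC (Phi phi) <> 0%C) by (intros E; apply RtoC_inj in E; unfold Phi in E; lra).
assert (Ei : (Ci * Ci = - (1))%C) by (apply C_ext; cbn; ring).
assert (E : RtoC PI = (qq phi * (2 * Phi phi))%C).
{ rewrite <- (qq_Phi phi Hphi) at 1. now rewrite !RtoC_mult. }
rewrite E, RtoC_mult.
transitivity ((Ci * Ci) * w)%C; [|rewrite Ei; ring].
field. split; [exact Hq0|exact HP0].
Qed.

Lemma boundary_int_wave (omega0 phi alpha rho theta : R) : 0 < phi < PI ->
  Rmax (phi - PI / 2) 0 < alpha < Rmin (PI / 2) phi -> Theta phi alpha theta ->
  (Ci / (4 * Phi phi)%R *
   boundary_int (wave_integrand omega0 phi alpha rho theta) (- (1)) 1 (- (5 * PI / 2)) (- (PI / 2))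
   = - (A_in omega0 alpha rho theta + A_r omega0 phi alpha rho theta))%C.
Proof.
intros Hphi Ha HT. pose proof HT as (Hth & Hn1 & Hn2). pose proof PI_RGT_0 as Hpi.
pose proof (qq_pos phi Hphi) as Hq. pose proof (qq_Phi phi Hphi) as HqP.
set (E := fun z => Cexp (pw omega0 rho 0 z)).
assert (HE : analytic_on (fun _ => True) E) by (apply analytic_on_Cexp, analytic_on_pw).
assert (HEc : forall z, continuousCC E z).
{ intros z. apply (analytic_on_continuous _ _ z HE I). }
pose proof (pole_theta_first phi alpha theta Hphi Ha Hth) as Ha1.
destruct (pole_theta_second phi alpha theta Hphi Ha HT) as (a2 & Hoff & Hk2 & Hcase).
set (a1 := alpha - PI / 2 - theta) in *.
assert (EF : wave_integrand omega0 phi alpha rho theta =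
  fun z => (E z * kc (qq phi) a1 z + E z * kc (qq phi) a2 z)%C).
{ extensionality z. unfold wave_integrand. rewrite Hs_kc, Hk2. fold a1 (E z). ring. }
rewrite EF, boundary_int_plus.
2:{ intros z Hz. apply continuous_Cmult; [apply HEc|]. apply (kc_continuous_boundary phi); try assumption. now left. }
2:{ intros z Hz. apply continuous_Cmult; [apply HEc|]. now apply (kc_continuous_boundary phi). }
assert (H2P : qq phi * (- (PI / 2) - - (5 * PI / 2)) < PI).
{ rewrite <- HqP at 3. apply Rmult_lt_compat_l; [exact Hq|]. unfold Phi. lra. }
rewrite (boundary_int_kc_pole E (qq phi) a1 1) by (try assumption; lra).
assert (B1 : E (0, a1) = A_in omega0 alpha rho theta).
{ unfold E. rewrite Cexp_pw_axis. unfold A_in. f_equal. unfold a1.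
  replace (alpha - PI / 2 - theta) with (- (PI / 2 + (theta - alpha))) by ring.
  rewrite sin_neg, <- cos_sin. ring. }
rewrite B1, Cmult_plus_distr_l, residue_factor by exact Hphi.
assert (B2 : (Ci / (4 * Phi phi)%R * boundary_int (fun z => (E z * kc (qq phi) a2 z)%C) (- (1)) 1 (- (5 * PI / 2)) (- (PI / 2))
  = - A_r omega0 phi alpha rho theta)%C).
{ unfold A_r. destruct Hcase as [(C1 & C2 & C3)|[(C1 & C2 & C3)|(C1 & C2 & C3)]].
  - rewrite (boundary_int_kc_pole E (qq phi) a2 1) by (try assumption; lra).
    rewrite residue_factor by exact Hphi. destruct (Rlt_dec theta (theta1 phi alpha)); [|lra].
    f_equal. unfold E. rewrite Cexp_pw_axis. f_equal. rewrite C2.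
    replace (- (5 * PI / 2) + (theta1 phi alpha - theta)) with (- ((PI / 2 + (theta - theta1 phi alpha)) + 2 * INR 1 * PI))
      by (cbn; field).
    rewrite sin_neg, sin_period, <- cos_sin. ring.
  - assert (Hq2 : qq phi * (- (PI / 2) - a2) < PI).
    { apply (Rlt_le_trans _ (qq phi * (2 * Phi phi))); [apply Rmult_lt_compat_l; assumption|lra]. }
    rewrite (boundary_int_kc_no_pole E (qq phi) a2 1) by (try assumption; lra).
    destruct (Rlt_dec theta (theta1 phi alpha)); [lra|]. destruct (Rle_dec theta (theta2 alpha)); [|lra]. ring.
  - rewrite (boundary_int_kc_pole E (qq phi) a2 1) by (try assumption; lra).
    rewrite residue_factor by exact Hphi.
    assert (H12 : theta1 phi alpha < theta2 alpha) by (unfold theta1, theta2; lra).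
    destruct (Rlt_dec theta (theta1 phi alpha)); [lra|]. destruct (Rle_dec theta (theta2 alpha)); [lra|].
    f_equal. unfold E. rewrite Cexp_pw_axis. f_equal. rewrite C2.
    replace (- (PI / 2) + (theta2 alpha - theta)) with (- (PI / 2 + (theta - theta2 alpha))) by ring.
    rewrite sin_neg, <- cos_sin. ring. }
rewrite B2. ring.
Qed.

Lemma wave_integrand_continuous_boundary (omega0 phi alpha rho theta : R) : 0 < phi < PI ->
  Rmax (phi - PI / 2) 0 < alpha < Rmin (PI / 2) phi -> Theta phi alpha theta ->
  forall z, central_boundary z ->
    continuousCC (wave_integrand omega0 phi alpha rho theta) z.
Proof.
intros Hphi Ha HT z Hz. pose proof HT as (Hth & _ & _).
destruct (pole_theta_second phi alpha theta Hphi Ha HT) as (a2 & Hoff & Hk2 & _).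
apply continuous_Cmult; [apply continuous_Cexp, pw_continuous|].
apply (continuous_ext (fun z => (kc (qq phi) (alpha - PI / 2 - theta) z + kc (qq phi) a2 z)%C)).
{ intros w. now rewrite Hs_kc, Hk2. }
apply continuous_Cplus; apply (kc_continuous_boundary phi); try assumption.
left. now apply (pole_theta_first phi).
Qed.

Lemma A_d_integrand_continuous (omega0 phi alpha rho theta : R) : 0 < phi < PI ->
  Rmax (phi - PI / 2) 0 < alpha < Rmin (PI / 2) phi -> Theta phi alpha theta ->
  forall x, continuousRC (A_d_integrand omega0 phi alpha rho theta) x.
Proof.
intros Hphi Ha HT x.
apply (continuous_ext (T := R_UniformSpace) (U := C_UniformSpace)
  (fun x => (wave_integrand omega0 phi alpha rho theta (x, - (5 * PI / 2))%R
    + - wave_integrand omega0 phi alpha rho theta (x, - (PI / 2))%R)%C)).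
{ intros t. now rewrite A_d_integrand_wave. }
apply continuous_Cplus; [|apply continuous_Copp];
  apply continuous_horizontal, wave_integrand_continuous_boundary; try assumption; left; [now left|now right].
Qed.

(** * The diffracted amplitude assembled from its two half-lines *)

Lemma is_RInt_gen_both (f : R -> C) (l m : C) :
  is_half f 0 l -> is_half (fun x => f (- x)) 0 m ->
  is_RInt_gen (V := CN) f (Rbar_locally m_infty) (Rbar_locally p_infty) (m + l)%C.
Proof.
intros H1 H2.
assert (FP : Filter (Rbar_locally p_infty)) by apply Rbar_locally_filter.
assert (FM : Filter (Rbar_locally m_infty)) by apply Rbar_locally_filter.
refine (@is_RInt_gen_Chasles CN (Rbar_locally m_infty) (Rbar_locally p_infty) FM FP f 0 m l _ H1).
apply is_half_reflect in H2. rewrite Ropp_0 in H2.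
replace f with (fun s => f (- - s)); [exact H2|].
extensionality s. now rewrite Ropp_involutive.
Qed.

Lemma int_R_unique (f : R -> C) (l : C) :
  is_RInt_gen (V := CN) f (Rbar_locally m_infty) (Rbar_locally p_infty) l -> int_R f = l.
Proof.
exact (@is_RInt_gen_unique CV _ _ (proper_Rbar_locally m_infty) (proper_Rbar_locally p_infty) f l).
Qed.

Lemma A_d_integrand_half (omega0 phi alpha rho theta : R) : 0 < phi < PI ->
  (forall x, continuousRC (A_d_integrand omega0 phi alpha rho theta) x) ->
  exists d, is_half (A_d_integrand omega0 phi alpha rho theta) 1 d.
Proof.
intros Hphi Hc. destruct (A_d_integrand_decay omega0 phi alpha rho theta Hphi) as (K & HK & H).
pose proof (qq_pos phi Hphi).
destruct (is_half_dominated (A_d_integrand omega0 phi alpha rho theta) 1 K (2 * qq phi)) as (d & Hd & _).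
- lra.
- intros b Hb. apply ex_CRInt_continuous. intros x _. apply Hc.
- exact H.
- now exists d.
Qed.

Lemma A_d_integrand_continuous_reflect (omega0 phi alpha rho theta : R) :
  (forall x, continuousRC (A_d_integrand omega0 phi alpha rho theta) x) ->
  forall x, continuousRC (A_d_integrand omega0 phi alpha rho (4 * PI - theta)) x.
Proof.
intros Hc x.
apply (continuous_ext (T := R_UniformSpace) (U := C_UniformSpace)
  (fun x => A_d_integrand omega0 phi alpha rho theta (- x))).
{ intros t. apply A_d_integrand_reflect. }
apply (continuous_comp (V := R_UniformSpace) (W := C_UniformSpace) Ropp (A_d_integrand omega0 phi alpha rho theta)); [|apply Hc].
apply (continuous_opp (V := R_NormedModule) (fun t => t)), continuous_id.
Qed.

(** The parts of the integral of [A_d] beyond |x| = 1 give w(theta) and w(4 pi - theta), each with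
    an integral over a vertical side. These two sides and the part over [-1, 1] make up the boundary
    of the central rectangle, whose residues are the incident and reflected amplitudes. *)
Lemma amplitude_wave (omega0 phi alpha rho theta : R) :
  0 < omega0 -> 0 < phi < PI -> Rmax (phi - PI / 2) 0 < alpha < Rmin (PI / 2) phi ->
  0 < rho -> Theta phi alpha theta ->
  (A_in omega0 alpha rho theta + A_r omega0 phi alpha rho theta + A_d omega0 phi alpha rho theta
   = Ci / (4 * Phi phi)%R * (wave omega0 phi alpha theta rho 0 + wave omega0 phi alpha (4 * PI - theta) rho 0))%C.
Proof.
intros Hw Hphi Ha Hr HT. pose proof PI_RGT_0 as Hpi.
pose proof (boundary_int_wave omega0 phi alpha rho theta Hphi Ha HT) as HB.
pose proof (A_d_integrand_continuous omega0 phi alpha rho theta Hphi Ha HT) as Hc.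
pose proof (A_d_integrand_continuous_reflect _ _ _ _ _ Hc) as Hc'.
pose proof (wave_integrand_continuous_boundary omega0 phi alpha rho theta Hphi Ha HT) as HF.
set (A := A_d_integrand omega0 phi alpha rho theta) in *.
set (A' := A_d_integrand omega0 phi alpha rho (4 * PI - theta)) in *.
set (F := wave_integrand omega0 phi alpha rho theta) in *.
destruct (A_d_integrand_half omega0 phi alpha rho theta Hphi Hc) as (d & Hd).
destruct (A_d_integrand_half omega0 phi alpha rho (4 * PI - theta) Hphi Hc') as (d' & Hd').
pose proof (A_d_half_line omega0 phi alpha rho theta d Hw Hphi Hr Hd) as Ed.
pose proof (A_d_half_line omega0 phi alpha rho (4 * PI - theta) d' Hw Hphi Hr Hd') as Ed'.
fold A in Hd. fold A' in Hd'. fold F in Ed.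
assert (I : forall a b, is_CRInt A a b (CRInt A a b)) by (intros; apply CRInt_correct, ex_CRInt_continuous; intros; apply Hc).
assert (H0 : is_half A 0 (CRInt A 0 1 + d)%C) by (apply (is_half_Chasles _ 0 1); [apply I|exact Hd]).
assert (EA : A' = fun x => A (- x)).
{ extensionality x. symmetry. apply A_d_integrand_reflect. }
assert (H0' : is_half A' 0 (CRInt A (- (1)) 0 + d')%C).
{ apply (is_half_Chasles _ 0 1); [|exact Hd']. rewrite EA.
  pose proof (I (- (1)) 0) as I1. apply is_CRInt_swap in I1.
  pose proof (is_CRInt_reflect A 0 0 1 (- CRInt A (- (1)) 0)%C) as Hrf.
  rewrite Rminus_0_r, Rminus_0_l in Hrf. specialize (Hrf I1).
  replace (CRInt A (- (1)) 0) with (- - CRInt A (- (1)) 0)%C by ring.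
  eapply is_RInt_ext; [|exact Hrf]. intros x _. cbv beta. now rewrite Rminus_0_l. }
rewrite EA in H0'. pose proof (is_RInt_gen_both A _ _ H0 H0') as HI. apply int_R_unique in HI.
assert (Emid : (CRInt A (- (1)) 0 + CRInt A 0 1 =
   CRInt (fun x => F (x, - (5 * PI / 2))%R) (- (1)) 1 - CRInt (fun x => F (x, - (PI / 2))%R) (- (1)) 1)%C).
{ transitivity (CRInt A (- (1)) 1).
  - symmetry. apply is_CRInt_unique. apply (is_CRInt_Chasles _ _ 0); apply I.
  - apply is_CRInt_unique.
    replace A with (fun x => (F (x, - (5 * PI / 2))%R - F (x, - (PI / 2))%R)%C)
      by (extensionality x; symmetry; apply A_d_integrand_wave).
    apply is_CRInt_minus; apply CRInt_correct, ex_CRInt_continuous; intros x _;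
      apply continuous_horizontal, HF; left; [now left|now right]. }
(* The reflection carries the side Re z = 1 for the angle 4 pi - theta to the side Re z = - 1 for
   theta. *)
assert (Ev : CRInt (fun y => wave_integrand omega0 phi alpha rho (4 * PI - theta) (1%R, y)) (- (5 * PI / 2)) (- (PI / 2)) =
  (- CRInt (fun y => F ((- (1))%R, y)) (- (5 * PI / 2)) (- (PI / 2)))%C).
{ apply is_CRInt_unique.
  assert (Iv : is_CRInt (fun y => F ((- (1))%R, y)) (- (5 * PI / 2)) (- (PI / 2))
     (CRInt (fun y => F ((- (1))%R, y)) (- (5 * PI / 2)) (- (PI / 2)))).
  { apply CRInt_correct, ex_CRInt_continuous. intros y _. apply continuous_vertical, HF. right; now right. }
  apply is_CRInt_swap in Iv.
  pose proof (is_CRInt_reflect (fun y => F ((- (1))%R, y)) (- (3 * PI)) (- (5 * PI / 2)) (- (PI / 2))) as Hrf.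
  replace (- (3 * PI) - - (5 * PI / 2)) with (- (PI / 2)) in Hrf by field.
  replace (- (3 * PI) - - (PI / 2)) with (- (5 * PI / 2)) in Hrf by field.
  specialize (Hrf _ Iv). apply is_CRInt_opp in Hrf.
  replace (- CRInt (fun y => F ((- (1))%R, y)) (- (5 * PI / 2)) (- (PI / 2)))%C
    with (- - - CRInt (fun y => F ((- (1))%R, y)) (- (5 * PI / 2)) (- (PI / 2)))%C by ring.
  eapply is_RInt_ext; [|exact Hrf]. intros y _. cbv beta.
  replace (- (3 * PI) - y) with (- y - 3 * PI) by ring.
  unfold F. rewrite wave_integrand_reflect.
  match goal with |- @eq _ ?a ?b => change (@eq C a b) end. ring. }
unfold A_d. fold A. rewrite HI.
unfold boundary_int in HB. change (wave_integrand omega0 phi alpha rho theta) with F in HB.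
rewrite Ed, Ed', Ev.
set (u := wave omega0 phi alpha theta rho 0) in *. set (u' := wave omega0 phi alpha (4 * PI - theta) rho 0) in *.
set (k := (Ci / (4 * Phi phi)%R)%C) in *.
set (v := CRInt (fun y => F (1%R, y)) (- (5 * PI / 2)) (- (PI / 2))) in *.
set (v' := CRInt (fun y => F ((- (1))%R, y)) (- (5 * PI / 2)) (- (PI / 2))) in *.
set (h := CRInt (fun x => F (x, - (5 * PI / 2))%R) (- (1)) 1) in *.
set (h' := CRInt (fun x => F (x, - (PI / 2))%R) (- (1)) 1) in *.
set (m1 := CRInt A (- (1)) 0) in *. set (m2 := CRInt A 0 1) in *.
transitivity (A_in omega0 alpha rho theta + A_r omega0 phi alpha rho theta
  + (k * (h - h' + Ci * (v - v')) + k * (u + u') + k * ((m1 + m2) - (h - h'))))%C; [ring|].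
rewrite HB, Emid. ring.
Qed.

Lemma wave_representation (omega0 phi alpha : R) :
  0 < omega0 -> 0 < phi < PI -> Rmax (phi - PI / 2) 0 < alpha < Rmin (PI / 2) phi ->
  has_wave_representation omega0 phi alpha.
Proof.
intros Hw Hphi Ha rho theta Hr Hth. unfold A_inf.
assert (Hcont : A_contour omega0 phi alpha rho theta =
  (Ci / (4 * Phi phi)%R * (wave omega0 phi alpha theta rho 0 + wave omega0 phi alpha (4 * PI - theta) rho 0))%C).
{ unfold A_contour. now rewrite (proj2 (contour_wave omega0 phi alpha rho theta Hw Hphi Hr)). }
destruct (Req_dec_T theta (theta1 phi alpha)) as [E1|E1]; [exact Hcont|].
destruct (Req_dec_T theta (theta2 alpha)) as [E2|E2]; [exact Hcont|].
apply amplitude_wave; try assumption. split; [exact Hth|split; assumption].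
Qed.

(** * The large time limit *)

Lemma profile_one (s0 : R) (f : R -> R) : s0 < 1 -> profile s0 f -> forall s, 1 <= s -> f s = 1.
Proof. intros Hs0 [(H0 & _ & _ & H)|(H0 & _ & H)] s Hs; apply H; lra. Qed.

(** Gives a bound of the tails that is uniform in t. In the Heaviside case |f 0| enters the bound,
    since that value is arbitrary. *)
Lemma profile_bounded (s0 : R) (f : R -> R) : profile s0 f -> exists M, 0 <= M /\ forall s, Rabs (f s) <= M.
Proof.
intros [(H0 & Hd & Hl & Hr)|(H0 & Hl & Hr)].
- assert (Hc : forall s, 0 <= s <= s0 -> continuity_pt (fun t => Rabs (f t)) s).
  { intros s _. apply (continuity_pt_comp f Rabs); [|apply Rcontinuity_abs].
    apply continuity_pt_filterlim. apply (ex_derive_continuous (V := R_NormedModule)). exact (Hd 1%nat s). }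
  destruct (continuity_ab_maj (fun t => Rabs (f t)) 0 s0 ltac:(lra) Hc) as (m & Hm & _).
  exists (Rabs (f m) + 1). split; [pose proof (Rabs_pos (f m)); lra|]. intros s.
  destruct (Rle_dec s 0) as [D1|D1]; [rewrite Hl, Rabs_R0 by lra; pose proof (Rabs_pos (f m)); lra|].
  destruct (Rle_dec s0 s) as [D2|D2]; [rewrite Hr, Rabs_R1 by lra; pose proof (Rabs_pos (f m)); lra|].
  specialize (Hm s ltac:(lra)). lra.
- exists (Rabs (f 0) + 1). split; [pose proof (Rabs_pos (f 0)); lra|]. intros s.
  destruct (Rtotal_order s 0) as [D|[-> |D]].
  + rewrite Hl, Rabs_R0 by lra. pose proof (Rabs_pos (f 0)). lra.
  + lra.
  + rewrite Hr, Rabs_R1 by lra. pose proof (Rabs_pos (f 0)). lra.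
Qed.

Lemma cosh_increasing (x y : R) : 0 <= x -> x < y -> cosh x < cosh y.
Proof.
intros Hx Hxy. pose proof (sinh_lt x y Hxy) as H.
assert (H0 : 0 <= sinh x).
{ destruct Hx as [Hx| <-]; [left; now apply sinh_pos|rewrite sinh_0; lra]. }
pose proof (cosh_sqr x). pose proof (cosh_sqr y). pose proof (cosh_pos x). pose proof (cosh_pos y). nra.
Qed.

Lemma cosh_surjective (c : R) : 1 <= c -> exists b, 0 <= b /\ cosh b = c.
Proof.
intros Hc. exists (arcsinh (sqrt (c ^ 2 - 1))).
assert (Hs : 0 <= sqrt (c ^ 2 - 1)) by apply sqrt_pos.
split.
- destruct (Rle_dec 0 (arcsinh (sqrt (c ^ 2 - 1)))) as [H|H]; [exact H|exfalso].
  apply Rnot_le_lt in H. apply sinh_lt in H. rewrite sinh_arcsinh, sinh_0 in H. lra.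
- pose proof (cosh_sqr (arcsinh (sqrt (c ^ 2 - 1)))) as H. rewrite sinh_arcsinh in H.
  rewrite pow2_sqrt in H by nra. pose proof (cosh_pos (arcsinh (sqrt (c ^ 2 - 1)))). nra.
Qed.

Lemma cosh_ge_1 (x : R) : 1 <= cosh x.
Proof. pose proof (cosh_sqr x). pose proof (cosh_pos x). pose proof (pow2_ge_0 (sinh x)). nra. Qed.

Lemma continuous_cosh (x : R) : continuous cosh x.
Proof.
apply continuity_pt_filterlim, derivable_continuous_pt. exists (sinh x). apply derivable_pt_lim_cosh.
Qed.

Lemma ex_CRInt_zero (f : R -> C) (a b : R) : (forall x, Rmin a b < x < Rmax a b -> f x = 0%C) -> ex_CRInt f a b.
Proof.
intros H. apply (ex_RInt_ext (V := CN) (fun _ => RtoC 0)); [intros x Hx; symmetry; now apply H|].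
apply (ex_RInt_const (V := CN)).
Qed.

(** For the Heaviside function the integrand can jump, at b0 with rho cosh b0 = t: it is A before b0
    and 0 after it, and the single point b0, where the arbitrary value f 0 appears, does not affect
    integrability. For t < rho it vanishes throughout. *)
Lemma profile_integrable (s0 : R) (f : R -> R) (A : R -> C) (rho t b : R) :
  profile s0 f -> 0 < rho -> 0 <= b ->
  (forall x, continuousRC A x) ->
  ex_CRInt (fun x => (A x * f (t - rho * cosh x)%R)%C) 0 b.
Proof.
intros Hf Hr Hb HA. destruct Hf as [(H0 & Hd & Hl & Hrr)|(H0 & Hl & Hrr)].
- apply ex_CRInt_continuous. intros x _. apply continuous_Cmult; [apply HA|].
  apply continuous_C_pair; cbn [RtoC fst snd]; [|apply continuous_const].
  apply (continuous_comp (fun x => t - rho * cosh x) f).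
  + apply (continuous_minus (V := R_NormedModule) (fun _ => t) (fun x => rho * cosh x)); [apply continuous_const|].
    apply (continuous_mult (K := R_AbsRing) (fun _ => rho) cosh); [apply continuous_const|apply continuous_cosh].
  + apply (ex_derive_continuous (V := R_NormedModule)). exact (Hd 1%nat _).
- assert (Hzero : forall x, t < rho * cosh x -> (A x * f (t - rho * cosh x)%R)%C = 0%C).
  { intros x Hx. rewrite Hl by lra. ring. }
  destruct (Rlt_dec t rho) as [Ht|Ht].
  + apply ex_CRInt_zero. intros x _. apply Hzero. pose proof (cosh_ge_1 x). nra.
  + destruct (cosh_surjective (t / rho)) as (b0 & Hb0 & Hcosh).
    { apply (Rmult_le_reg_r rho); [exact Hr|]. unfold Rdiv. rewrite Rmult_assoc, Rinv_l by lra. lra. }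
    assert (Hc : rho * cosh b0 = t) by (rewrite Hcosh; field; lra).
    assert (Hin : forall b, 0 <= b <= b0 -> ex_CRInt (fun x => (A x * f (t - rho * cosh x)%R)%C) 0 b).
    { intros c Hc'. apply (ex_RInt_ext (V := CN) A); [|apply ex_CRInt_continuous; intros; apply HA].
      intros x Hx. rewrite Rmin_left, Rmax_right in Hx by lra.
      pose proof (cosh_increasing x b0 ltac:(lra) ltac:(lra)). rewrite Hrr by nra.
      match goal with |- @eq _ ?a ?b => change (@eq C a b) end. ring. }
    destruct (Rle_dec b b0) as [Hbb|Hbb]; [apply Hin; lra|].
    apply (ex_RInt_Chasles (V := CN) _ 0 b0 b); [apply Hin; lra|].
    apply ex_CRInt_zero. intros x Hx. rewrite Rmin_left, Rmax_right in Hx by lra. apply Hzero.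
    pose proof (cosh_increasing b0 x ltac:(lra) ltac:(lra)). nra.
Qed.

(** Up to a cut B the factor f is 1 as soon as t > 1 + rho cosh B, so the integrals with and without
    it agree there; beyond B both are bounded by exponential tails, uniformly in t. *)
Lemma profile_half_limit (s0 : R) (f : R -> R) (A : R -> C) (rho K c : R) :
  s0 < 1 -> profile s0 f -> 0 < rho -> 0 < c ->
  (forall x, continuousRC A x) ->
  (forall x, 1 <= x -> Cmod (A x) <= K * exp (- c * x)) ->
  exists (l : C) (lt : R -> C), is_half A 0 l /\
    (forall t, is_half (fun x => (A x * f (t - rho * cosh x)%R)%C) 0 (lt t)) /\
    filterlim lt (Rbar_locally p_infty) (locallyC l).
Proof.
intros Hs0 Hf Hr Hc HA HK.
destruct (profile_bounded s0 f Hf) as (M & HM & HfM).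
assert (HK0 : 0 <= K).
{ specialize (HK 1 (Rle_refl 1)). pose proof (Cmod_ge_0 (A 1)). pose proof (exp_pos (- c * 1)). nra. }
set (g := fun t x => (A x * f (t - rho * cosh x)%R)%C).
assert (Hg : forall t b, 0 <= b -> ex_CRInt (g t) 0 b) by (intros; now apply (profile_integrable s0)).
assert (Hg1 : forall t a b, 0 <= a -> a <= b -> ex_CRInt (g t) a b).
{ intros t a b Ha Hab. apply (ex_RInt_Chasles (V := CN) _ a 0 b); [apply (ex_RInt_swap (V := CN))|]; apply Hg; lra. }
assert (HAi : forall a b, ex_CRInt A a b) by (intros; apply ex_CRInt_continuous; intros; apply HA).
assert (Tail : forall t B, 1 <= B -> exists l, is_half (g t) B l /\ Cmod l <= M * K * exp (- c * B) / c).
{ intros t B HB. destruct (is_half_dominated (g t) B (M * K) c Hc) as (l & Hl & Hb & _).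
  - intros b Hb. apply Hg1; lra.
  - intros x Hx. unfold g. rewrite Cmod_mult, Cmod_R.
    specialize (HK x ltac:(lra)). specialize (HfM (t - rho * cosh x)).
    rewrite Rmult_comm, Rmult_assoc. apply Rmult_le_compat; [apply Rabs_pos|apply Cmod_ge_0|exact HfM|exact HK].
  - now exists l. }
assert (TailA : forall B, 1 <= B -> exists l, is_half A B l /\ Cmod l <= K * exp (- c * B) / c).
{ intros B HB. destruct (is_half_dominated A B K c Hc) as (l & Hl & Hb & _).
  - intros b Hb. apply HAi.
  - intros x Hx. apply HK. lra.
  - now exists l. }
destruct (TailA 1 (Rle_refl 1)) as (l1 & Hl1 & _).
set (lt := fun t => RInt_gen (V := CV) (g t) (at_point 0) (Rbar_locally p_infty) : C).
assert (Hlt : forall t, is_half (g t) 0 (lt t)).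
{ intros t. destruct (Tail t 1 (Rle_refl 1)) as (l & Hl & _).
  assert (H0 : is_half (g t) 0 (CRInt (g t) 0 1 + l)%C).
  { apply (is_half_Chasles _ 0 1); [apply CRInt_correct, Hg; lra|exact Hl]. }
  unfold lt. now rewrite (is_half_unique _ _ _ H0). }
exists (CRInt A 0 1 + l1)%C, lt. split; [|split].
- apply (is_half_Chasles _ 0 1); [apply CRInt_correct, HAi|exact Hl1].
- exact Hlt.
- apply filterlim_C_Cmod; [apply Rbar_locally_filter|]. intros eps Heps.
  (* M K / c bounds the tail that contains f, and K / c the one that does not. *)
  destruct (exp_eventually_small ((M + 1) * K / c) c eps Hc Heps) as [N HN].
  set (B := Rmax 1 N). assert (HB : 1 <= B) by apply Rmax_l.
  specialize (HN B (Rmax_r 1 N)).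
  exists (1 + rho * cosh B). intros t Ht.
  destruct (Tail t B HB) as (l & Hl & Hlb). destruct (TailA B HB) as (k & Hk & Hkb).
  assert (E1 : lt t = (CRInt A 0 B + l)%C).
  { apply (is_half_eq (g t) 0); [apply Hlt|]. apply (is_half_Chasles _ 0 B); [|exact Hl].
    apply (is_RInt_ext (V := CN) A); [|apply CRInt_correct, HAi].
    intros x Hx. rewrite Rmin_left, Rmax_right in Hx by lra. unfold g.
    pose proof (cosh_increasing x B ltac:(lra) ltac:(lra)).
    rewrite (profile_one s0 f Hs0 Hf) by nra.
    match goal with |- @eq _ ?a ?b => change (@eq C a b) end. ring. }
  assert (E2 : (CRInt A 0 1 + l1)%C = (CRInt A 0 B + k)%C).
  { apply (is_half_eq A 0); [apply (is_half_Chasles _ 0 1)|apply (is_half_Chasles _ 0 B)];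
      try assumption; apply CRInt_correct, HAi. }
  rewrite E1, E2. replace (CRInt A 0 B + l - (CRInt A 0 B + k))%C with (l + - k)%C by ring.
  eapply Rle_lt_trans; [apply Cmod_triangle|]. rewrite Cmod_opp.
  eapply Rle_lt_trans; [|exact HN].
  replace ((M + 1) * K / c * exp (- c * B)) with (M * K * exp (- c * B) / c + K * exp (- c * B) / c) by (field; lra).
  lra.
Qed.

(** * Convergence of the amplitude *)

Lemma filterlim_Cplus (T : Type) (F : (T -> Prop) -> Prop) (FF : Filter F) (f g : T -> C) (l m : C) :
  filterlim f F (locallyC l) -> filterlim g F (locallyC m) ->
  filterlim (fun t => (f t + g t)%C) F (locallyC (l + m)%C).
Proof.
intros Hf Hg. apply filterlim_C_Cmod; [exact FF|]. intros eps Heps.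
pose proof (proj1 (filterlim_C_Cmod _ _ _ _ _) Hf (eps / 2) ltac:(lra)) as H1.
pose proof (proj1 (filterlim_C_Cmod _ _ _ _ _) Hg (eps / 2) ltac:(lra)) as H2.
generalize (filter_and _ _ H1 H2). apply filter_imp. intros t [K1 K2].
replace (f t + g t - (l + m))%C with ((f t - l) + (g t - m))%C by ring.
eapply Rle_lt_trans; [apply Cmod_triangle|]. lra.
Qed.

Lemma filterlim_Cmult_l (T : Type) (F : (T -> Prop) -> Prop) (FF : Filter F) (c : C) (f : T -> C) (l : C) :
  filterlim f F (locallyC l) ->
  filterlim (fun t => (c * f t)%C) F (locallyC (c * l)%C).
Proof.
intros Hf. eapply filterlim_comp; [exact Hf|].
apply (continuous_Cmult C_UniformSpace (fun _ => c) (fun z => z)); [apply continuous_const|apply continuous_id].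
Qed.

Lemma cis_plus (x y : R) : cis (x + y) = (cis x * cis y)%C.
Proof. unfold cis. rewrite <- Cexp_plus. f_equal. apply C_ext; cbn; ring. Qed.

Lemma plane_wave_amplitude (omega0 : R) (f : R -> R) (a rho theta t : R) :
  1 <= t - rho * cos (theta - a) -> (forall s, 1 <= s -> f s = 1) ->
  (plane_wave omega0 f a (polar rho theta) t * cis (omega0 * t))%C = cis (omega0 * rho * cos (theta - a)).
Proof.
intros Ht Hf. unfold plane_wave.
assert (E : dot (cos a, sin a) (polar rho theta) = rho * cos (theta - a)).
{ unfold dot, polar. cbn [fst snd]. rewrite cos_minus. ring. }
rewrite E, Hf by exact Ht. rewrite Cmult_1_r, <- cis_plus. f_equal. ring.
Qed.

Lemma u_d_half_lines (omega0 phi alpha s0 rho theta : R) (f : R -> R) :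
  s0 < 1 -> profile s0 f -> 0 < phi < PI -> Rmax (phi - PI / 2) 0 < alpha < Rmin (PI / 2) phi ->
  0 < rho -> Theta phi alpha theta ->
  exists (l : C) (lt : R -> C),
    is_RInt_gen (V := CN) (A_d_integrand omega0 phi alpha rho theta) (Rbar_locally m_infty) (Rbar_locally p_infty) l /\
    (forall t, is_RInt_gen (V := CN) (u_d_integrand omega0 phi alpha f rho theta t)
       (Rbar_locally m_infty) (Rbar_locally p_infty) (lt t)) /\
    filterlim lt (Rbar_locally p_infty) (locallyC l).
Proof.
intros Hs0 Hf Hphi Ha Hr HT.
pose proof (A_d_integrand_continuous omega0 phi alpha rho theta Hphi Ha HT) as Hc.
pose proof (A_d_integrand_continuous_reflect _ _ _ _ _ Hc) as Hc'.
pose proof (qq_pos phi Hphi) as Hq.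
destruct (A_d_integrand_decay omega0 phi alpha rho theta Hphi) as (K & _ & HK).
destruct (A_d_integrand_decay omega0 phi alpha rho (4 * PI - theta) Hphi) as (K' & _ & HK').
destruct (profile_half_limit s0 f _ rho K (2 * qq phi) Hs0 Hf Hr ltac:(lra) Hc HK) as (l & lt & H1 & H2 & H3).
destruct (profile_half_limit s0 f _ rho K' (2 * qq phi) Hs0 Hf Hr ltac:(lra) Hc' HK') as (l' & lt' & H1' & H2' & H3').
exists (l' + l)%C, (fun t => (lt' t + lt t)%C). split; [|split].
- apply is_RInt_gen_both; [exact H1|].
  eapply is_half_ext; [|exact H1']. intros x _. symmetry. apply A_d_integrand_reflect.
- intros t. apply is_RInt_gen_both; [apply H2|].
  eapply is_half_ext; [|apply (H2' t)]. intros x _. unfold u_d_integrand.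
  now rewrite A_d_integrand_reflect, cosh_neg.
- apply filterlim_Cplus; [apply Rbar_locally_filter|exact H3'|exact H3].
Qed.

Lemma amplitude_limit (omega0 phi alpha s0 rho theta : R) (f : R -> R) :
  s0 < 1 -> profile s0 f -> 0 < phi < PI -> Rmax (phi - PI / 2) 0 < alpha < Rmin (PI / 2) phi ->
  0 < rho -> Theta phi alpha theta ->
  filterlim (fun t : R => amplitude omega0 phi alpha f rho theta t) (Rbar_locally p_infty)
    (locallyC (A_in omega0 alpha rho theta + A_r omega0 phi alpha rho theta
       + A_d omega0 phi alpha rho theta)%C).
Proof.
intros Hs0 Hf Hphi Ha Hr HT.
destruct (u_d_half_lines omega0 phi alpha s0 rho theta f Hs0 Hf Hphi Ha Hr HT) as (l & lt & H1 & H2 & H3).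
pose proof HT as (Hth & Hn1 & Hn2).
assert (Hf1 := profile_one s0 f Hs0 Hf).
apply (filterlim_ext_loc (fun t => (A_in omega0 alpha rho theta + A_r omega0 phi alpha rho theta
  + Ci / (4 * Phi phi)%R * lt t)%C)).
(* From here on the argument of f in every plane wave is at least 1, whatever its direction: the
   incident and reflected parts of the amplitude have already reached their limits. *)
- exists (1 + rho). intros t Ht.
  assert (Hcos : forall a, 1 <= t - rho * cos a).
  { intros a. pose proof (COS_bound a). nra. }
  unfold amplitude, u_sol. rewrite !Cmult_plus_distr_r.
  unfold u_in. rewrite plane_wave_amplitude by auto.
  (* [u_r] and [A_r] are defined differently on the critical rays, which [Theta] excludes. *)
  assert (Er : (u_r omega0 phi alpha f rho theta t * cis (omega0 * t))%C = A_r omega0 phi alpha rho theta).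
  { unfold u_r, A_r.
    assert (H12 : theta1 phi alpha < theta2 alpha) by (unfold theta1, theta2; lra).
    destruct (Rle_dec theta (theta1 phi alpha)), (Rlt_dec theta (theta1 phi alpha)); try lra.
    - now rewrite plane_wave_amplitude by auto.
    - destruct (Rlt_dec theta (theta2 alpha)), (Rle_dec theta (theta2 alpha)); try lra.
      + ring.
      + now rewrite plane_wave_amplitude by auto. }
  rewrite Er. unfold u_d. rewrite (int_R_unique _ _ (H2 t)). unfold A_in. f_equal.
  assert (Ec : (cis (- (omega0 * t)) * cis (omega0 * t))%C = 1%C).
  { rewrite <- cis_plus, Rplus_opp_l. unfold cis. rewrite Cmult_0_r. apply Cexp_0. }
  transitivity (Ci / (4 * Phi phi)%R * lt t * (cis (- (omega0 * t)) * cis (omega0 * t)))%C; [rewrite Ec; ring|].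
  unfold Cdiv. ring.
- unfold A_d. rewrite (int_R_unique _ _ H1).
  apply filterlim_Cplus; [apply Rbar_locally_filter|apply filterlim_const|].
  apply filterlim_Cmult_l; [apply Rbar_locally_filter|exact H3].
Qed.

Theorem theorem7p2 (omega0 phi alpha s0 : R) (f : R -> R)
    (Homega0 : 0 < omega0)
    (Hphi : 0 < phi < PI)
    (Halpha : Rmax (phi - PI / 2) 0 < alpha < Rmin (PI / 2) phi)
    (Hs0 : 0 <= s0 < 1)
    (Hf : profile s0 f) :
  (* the integrals involved converge *)
  (forall rho theta : R, 0 < rho -> Theta phi alpha theta ->
     (forall t : R, ex_int_R (u_d_integrand omega0 phi alpha f rho theta t)) /\
     ex_int_R (A_d_integrand omega0 phi alpha rho theta)) /\
  (forall rho theta : R, 0 < rho -> phi <= theta <= 2 * PI ->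
     contour_converges (contour_integrand omega0 phi alpha rho theta) C1_plus) /\
  (* the limiting amplitude and its representation *)
  (forall rho theta : R, 0 < rho -> Theta phi alpha theta ->
     filterlim (fun t : R => amplitude omega0 phi alpha f rho theta t)
       (Rbar_locally p_infty)
       (locally (A_in omega0 alpha rho theta + A_r omega0 phi alpha rho theta
                 + A_d omega0 phi alpha rho theta)%C) /\
     (A_in omega0 alpha rho theta + A_r omega0 phi alpha rho theta
        + A_d omega0 phi alpha rho theta)%C =
     (Ci / (4 * Phi phi)%R *
        contour_int (contour_integrand omega0 phi alpha rho theta) C1_plus)%C) /\
  (* the stationary scattering problem *)
  (forall y : R * R, Qdom phi y ->
     exists L : C, is_laplacian (A_inf_at omega0 phi alpha) y L /\
       (L + (omega0 ^ 2)%R * A_inf_at omega0 phi alpha y)%C = 0) /\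
  (forall rho : R, 0 < rho ->
     is_normal_derive (A_inf_at omega0 phi alpha) (polar rho phi) (normal_phi phi) 0 /\
     is_normal_derive (A_inf_at omega0 phi alpha) (polar rho (2 * PI)) normal_2PI 0).
Proof.
pose proof (wave_representation omega0 phi alpha Homega0 Hphi Halpha) as Hrep.
split; [|split; [|split; [|split]]].
- intros rho theta Hr HT.
  destruct (u_d_half_lines omega0 phi alpha s0 rho theta f (proj2 Hs0) Hf Hphi Halpha Hr HT)
    as (l & lt & H1 & H2 & _).
  split; [intros t; exists (lt t); apply H2|now exists l].
- intros rho theta Hr Hth. now apply contour_wave.
- intros rho theta Hr HT. split.
  + now apply (amplitude_limit omega0 phi alpha s0).
  + rewrite (proj2 (contour_wave omega0 phi alpha rho theta Homega0 Hphi Hr)).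
    now apply amplitude_wave.
- intros y HQ. now apply helmholtz_A_inf.
- intros rho Hr. now apply normal_derive_A_inf.
Qed.
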